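(* Let $p,q\in\mathbb{N}$ be positive integers with greatest common divisor $1$, and suppose that $\theta\in(0,\frac{\pi}{3})$ satisfies $\tan\theta=\frac{\sqrt{3}\,p}{2q+p}$. Then (1) for $b_{\min}\le\alpha\le b_{\max}$, $$\dim_H\{a\in\Delta_\theta:\dim_B E_{\theta,a}=\alpha\}=\inf_{t\in\mathbb{R}}\left\{-\alpha t+\frac{P(t)}{\log2}\right\};$$ (2) for $s-b_{\max}\le\alpha\le s-b_{\min}$, $$\dim_H\{a\in\Delta_\theta:d_{\nu_\theta}(a)=\alpha\}=\inf_{t\in\mathbb{R}}\left\{-(s-\alpha)t+\frac{P(t)}{\log2}\right\}.$$ Both of these functions of $\alpha$ are concave and continuous.
   Context: $\Delta\subset\mathbb{R}^2$ is the Sierpiński gasket: the unique non-empty compact set with $\Delta=S_0(\Delta)\cup S_1(\Delta)\cup S_2(\Delta)$, where $S_0(x,y)=(\frac x2,\frac y2)$, $S_1(x,y)=(\frac x2+\frac12,\frac y2)$, $S_2(x,y)=(\frac x2+\frac14,\frac y2+\frac{\sqrt3}{4})$. Put $s=\frac{\log3}{\log2}$. For $a\in\mathbb{R}$ let $L_{\theta,a}=\{(x,a+x\tan\theta):x\in\mathbb{R}\}$, $\mathrm{proj}_\theta(x,y)=y-x\tan\theta$, $\Delta_\theta=\mathrm{proj}_\theta(\Delta)$, $E_{\theta,a}=L_{\theta,a}\cap\Delta$. $\nu$ is the unique Borel probability measure with $\nu=\sum_{i=0}^2\frac13\,\nu\circ S_i^{-1}$ and $\nu_\theta=\nu\circ\mathrm{proj}_\theta^{-1}$.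 $d_{\nu_\theta}(a)=\lim_{r\to0}\frac{\log\nu_\theta(B_r(a))}{\log r}$; the condition $d_{\nu_\theta}(a)=\alpha$ means the limit exists and equals $\alpha$, and $\dim_B E_{\theta,a}=\alpha$ means upper and lower box dimension both equal $\alpha$. Matrices: let $f_0(t)=\frac t2$, $f_1(t)=\frac t2+\frac12$, $f_2(t)=\frac t2-\frac{p}{2q}$. For $k=1,\dots,p+q$ let $I_k=[1-\frac kq,1-\frac{k-1}q]$, $I_k^0=[1-\frac{2k-1}{2q},1-\frac{k-1}{q}]$ (upper half), $I_k^1=[1-\frac kq,1-\frac{2k-1}{2q}]$ (lower half). For $n\in\{0,1\}$ let $A_n$ be the $(p+q)\times(p+q)$ matrix with entries $(A_n)_{i,j}=\sharp\{k\in\{0,1,2\}: f_k(I_j)=I_i^n\}$. Let $\underline e=(1,\dots,1)\in\mathbb{R}^{p+q}$. The pressure is $$P(t)=\lim_{n\to\infty}\frac1n\log\sum_{\xi_1,\dots,\xi_n=0}^1\left(\underline e A_{\xi_1}\cdots A_{\xi_n}\underline e\right)^t,\qquad t\in\mathbb{R},$$ and $b_{\min}=\lim_{t\to-\infty}\frac{P(t)}{t\log2}$, $b_{\max}=\lim_{t\to\infty}\frac{P(t)}{t\log 2}$. *)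

(* Defs.v *)
From HB Require Import structures.
From mathcomp Require Import all_boot all_order all_algebra.
From mathcomp Require Import all_classical all_reals all_analysis.

Set Implicit Arguments.
Unset Strict Implicit.
Unset Printing Implicit Defensive.

Import Order.TTheory GRing.Theory Num.Theory.
Import numFieldNormedType.Exports.

Local Open Scope classical_set_scope.
Local Open Scope ring_scope.

Section Dimensions.
Context {R : realType} {T : Type} (d : T -> T -> R).
Implicit Types (A U : set T) (s r : R).
Local Open Scope ereal_scope.

(* [diam set0 = -oo], so the empty set is allowed in every r-cover. *)
Definition diam U : \bar R := ereal_sup [set (d x y)%:E | x in U & y in U].

(* |U|^s, with the conventions |set0|^s = 0 and 0^0 = 1. *)
Definition diam_pow s U : \bar R := if U == set0 then 0 else diam U `^ s.

(* Empty sets count for 0, so sequences of sets also account for finite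
   covers. *)
Definition hausdorff_premeasure r s A : \bar R :=
  ereal_inf [set \sum_(0 <= i <oo) diam_pow s (U i) |
    U in [set U : nat -> set T |
      (forall i, diam (U i) <= r%:E) /\ A `<=` \bigcup_i U i]].

Definition hausdorff_measure s A : \bar R :=
  ereal_sup [set hausdorff_premeasure r s A | r in [set r : R | (0 < r)%R]].

Definition hausdorff_dim A : \bar R :=
  ereal_inf [set s%:E | s in [set s : R |
    (0 <= s)%R /\ hausdorff_measure s A = 0]].

(* [+oo] if there is no finite such cover. *)
Definition covering_number r A : \bar R :=
  ereal_inf [set n%:R%:E | n in [set n : nat |
    exists U : 'I_n -> set T,
      (forall i, diam (U i) <= r%:E) /\ A `<=` \bigcup_i U i]].

Definition lower_box_dim A : \bar R :=
  limf_einf (fun r : R => lne (covering_number r A) * ((- ln r)^-1)%:E) 0^'+.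

Definition upper_box_dim A : \bar R :=
  limf_esup (fun r : R => lne (covering_number r A) * ((- ln r)^-1)%:E) 0^'+.

Definition has_box_dim A (alpha : R) : Prop :=
  lower_box_dim A = alpha%:E /\ upper_box_dim A = alpha%:E.

End Dimensions.

Definition dist1 {R : realType} (x y : R) : R := `|x - y|.

(* The norm of the library on [R * R] is the sup norm. *)
Definition dist2 {R : realType} (u v : R * R) : R :=
  Num.sqrt ((u.1 - v.1) ^+ 2 + (u.2 - v.2) ^+ 2).

Definition has_local_dim {R : realType} (mu : set R -> \bar R) (a alpha : R)
    : Prop :=
  (fun r : R => lne (mu (ball a r)) * ((ln r)^-1)%:E)%E @ 0^'+ --> alpha%:E.

Definition concave_on {R : realType} (D : set R) (f : R -> R) : Prop :=
  @convex_function R R^o D (fun x => - f x).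

Section Gasket.
Context {R : realType}.

Definition gasket_map (i : 'I_3) (z : R * R) : R * R :=
  match val i with
  | 0%N => (z.1 / 2, z.2 / 2)
  | 1%N => (z.1 / 2 + 1 / 2, z.2 / 2)
  | _ => (z.1 / 2 + 1 / 4, z.2 / 2 + Num.sqrt 3 / 4)
  end.

Definition is_gasket (Delta : set (R * R)) : Prop :=
  [/\ Delta !=set0, compact Delta &
      Delta = \bigcup_(i : 'I_3) (gasket_map i @` Delta)].

(* The product sigma-algebra on [R * R] is the Borel one. *)
Definition is_gasket_measure
    (nu : probability (measurableTypeR R * measurableTypeR R)%type R) : Prop :=
  forall A, measurable A ->
    nu A = (\sum_(i < 3) (3^-1)%:E * nu (gasket_map i @^-1` A))%E.

Definition slice_line (theta a : R) : set (R * R) :=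
  [set z | exists x : R, z = (x, a + x * tan theta)].

Definition gasket_proj (theta : R) (z : R * R) : R := z.2 - z.1 * tan theta.

Definition slice (Delta : set (R * R)) (theta a : R) : set (R * R) :=
  slice_line theta a `&` Delta.

Definition proj_measure
    (nu : probability (measurableTypeR R * measurableTypeR R)%type R)
    (theta : R) : set R -> \bar R :=
  pushforward nu (gasket_proj theta : _ -> measurableTypeR R).

End Gasket.

Section Pressure.
Context (R : realType) (p q : nat).

Definition int_map (k : 'I_3) (t : R) : R :=
  match val k with
  | 0%N => t / 2
  | 1%N => t / 2 + 1 / 2
  | _ => t / 2 - p%:R / (2 * q%:R)
  end.

(* [i : 'I_(p + q)] is numbered from 0: it stands for the index k = i + 1. *)
Definition itvI (i : 'I_(p + q)) : set R :=
  let k : R := i.+1%:R in `[1 - k / q%:R, 1 - (k - 1) / q%:R].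

Definition half_itvI (n : 'I_2) (i : 'I_(p + q)) : set R :=
  let k : R := i.+1%:R in
  if val n == 0%N
  then `[1 - (2 * k - 1) / (2 * q%:R), 1 - (k - 1) / q%:R]%classic
  else `[1 - k / q%:R, 1 - (2 * k - 1) / (2 * q%:R)]%classic.

Definition transfer_mx (n : 'I_2) : 'M[R]_(p + q) :=
  \matrix_(i, j)
    #|[pred k : 'I_3 | `[< int_map k @` itvI j = half_itvI n i >]]|%:R.

Definition word_weight (n : nat) (xi : {ffun 'I_n -> 'I_2}) : R :=
  ((const_mx 1 : 'rV[R]_(p + q))
     *m (\big[mulmx/1%:M]_(k < n) transfer_mx (xi k))
     *m (const_mx 1 : 'cV[R]_(p + q))) 0 0.

Definition pressure (t : R) : R :=
  lim ((n%:R^-1 * ln (\sum_(xi : {ffun 'I_n -> 'I_2}) word_weight xi `^ t))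
    @[n --> \oo]).

Definition bmin : R := lim (pressure t / (t * ln 2) @[t --> -oo]).

Definition bmax : R := lim (pressure t / (t * ln 2) @[t --> +oo]).

End Pressure.

Definition gasket_dim {R : realType} : R := ln 3 / ln 2.

(* Main.v *)
(* Parametrise the projection by y = kap (q - x) with x in [0, p + q]: the maps of
   the gasket become x -> (x + d) / 2 with d in {q, p + q, 0}. The number of
   level-n triangles met by the slice over x, and up to the factor 3^-n the
   measure of the ball of radius 2^-n around x, are comparable to the
   multiplicity of the n-th dyadic cell of x, which is a row sum of the product
   of the transfer matrices along the binary digits of x. So both dimensions say
   that this multiplicity grows like e^(n a) for some a.

   A product of transfer matrices fails to be positive only for polynomially
   many digit words (every further digit enlarges the set of states leading to a
   proper set of states, for at least one of the two digits), so that after a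
   positive word W all row sums are comparable to the weight of the word, and
   weights are multiplicative along concatenations s W t up to a constant. The
   upper bound is then the covering argument with sums of t-th powers of
   weights. For the lower bound, exponential tilting of long concatenations
   provides about e^(n inf_t (P(t) - a t)) words of length n and weight about
   e^(n a); concatenating such words with W in between gives a Moran set
   contained in the level set.

   The result is an infimum of affine functions with values in [0, 1], hence
   concave, and continuous up to the end points. *)

Require Import Defs.
From HB Require Import structures.
From mathcomp Require Import all_boot all_order all_algebra.
From mathcomp Require Import finmap.
From mathcomp Require Import all_classical all_reals all_analysis.
From mathcomp Require Import measurable_realfun.
From mathcomp Require Import zify lra ring.

Set Implicit Arguments.
Unset Strict Implicit.
Unset Printing Implicit Defensive.

Import Order.TTheory GRing.Theory Num.Theory.
Import numFieldNormedType.Exports.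

(** * Words and transfer operators *)

(** Slices and balls around [x] do not see one cell exactly: all counts lie between the multiplicity
    [rn] of the cell of [x] and the sum [rsum] over four adjacent cells. Hence two sets replace the
    level set: [Xlow], where even [rsum] is small and [rn] is large, and [Xup], where only [rn] is
    small and [rsum] is large. Each level set of the theorem, in the coordinate [x], lies between
    them, and both get the same dimension. The two signs of [t] behave differently. For [t >= 0] a
    large row sum forces a large weight at once. For [t < 0] a small row sum says nothing about the
    weight unless some prefix already has a positive row; the points without such a prefix are
    covered by polynomially many cells and have dimension 0. In the Moran set neighbouring cells are
    controlled because the positive word ends in the digits 1, 0: points stay away from the ends of
    their cells, so adjacent cells share a long prefix. No differentiability of the pressure is
    used: subadditivity, monotonicity, a Lipschitz bound and the comparison of power sums
    suffice. *)

Fixpoint words (n : nat) : seq (seq bool) :=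
  if n is m.+1 then map (cons false) (words m) ++ map (cons true) (words m)
  else [:: [::]].

Lemma mem_words n s : (s \in words n) = (size s == n).
Proof.
elim: n s => [|n IH] [|b s] //=; rewrite mem_cat.
  by apply/negbTE; rewrite negb_or; apply/andP; split; apply/mapP => -[].
rewrite eqSS -IH; case: b.
- rewrite (mem_map (f := cons true)); last by move=> ? ? [].
  by apply/orb_idl => /mapP[].
- rewrite (mem_map (f := cons false)); last by move=> ? ? [].
  by apply/orb_idr => /mapP[].
Qed.

Lemma uniq_words n : uniq (words n).
Proof.
elim: n => //= n IH; rewrite cat_uniq !map_inj_uniq ?IH; try by move=> ? ? [].
by rewrite andbT; apply/hasP => -[x /mapP[y _ ->] /mapP[z _]].
Qed.

Lemma size_words n : size (words n) = 2 ^ n.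
Proof. by elim: n => //= n IH; rewrite size_cat !size_map IH expnS mul2n addnn. Qed.

Lemma perm_words_add n m :
  perm_eq (words (n + m)) [seq s ++ t | s <- words n, t <- words m].
Proof.
apply: uniq_perm; first exact: uniq_words.
  apply: allpairs_uniq; rewrite ?uniq_words // => -[s t] [s' t'].
  move=> /allpairsP[[a b] /= [+ + [-> ->]]].
  rewrite !mem_words => /eqP sa /eqP sb.
  move=> /allpairsP[[c d] /= [+ + [-> ->]]].
  rewrite !mem_words => /eqP sc /eqP sd /eqP.
  by rewrite eqseq_cat ?sa ?sc // => /andP[/eqP-> /eqP->].
move=> s; rewrite mem_words; apply/eqP/allpairsP => [ss|[[a b] /= []]].
  exists (take n s, drop n s); rewrite !mem_words /= cat_take_drop.
  by rewrite size_drop size_takel ss ?leq_addr ?addKn ?eqxx.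
by rewrite !mem_words => /eqP sa /eqP sb ->; rewrite size_cat sa sb.
Qed.

Lemma count_words_rcons (P : pred (seq bool)) n :
  count P (words n.+1) =
  count (fun s => P (rcons s false)) (words n) +
  count (fun s => P (rcons s true)) (words n).
Proof.
rewrite -addn1 (permP (perm_words_add n 1)) /=.
elim: (words n) => //= s l ->; rewrite !cats1; lia.
Qed.

Fixpoint bin (s : seq bool) : nat :=
  if s is b :: s' then b * 2 ^ size s' + bin s' else 0.

Lemma bin_lt s : bin s < 2 ^ size s.
Proof. by elim: s => //= b s IH; rewrite expnS; case: b; lia. Qed.

Lemma bin_cat s t : bin (s ++ t) = bin s * 2 ^ size t + bin t.
Proof.
elim: s => //= b s ->; rewrite size_cat expnD; lia.
Qed.

Lemma bin_inj s t : size s = size t -> bin s = bin t -> s = t.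
Proof.
elim: s t => [|b s IH] [|c t] //= [st] H.
have := bin_lt s; have := bin_lt t; rewrite st in H * => ? ?.
have bc : b = c by case: b c H => -[]; lia.
by rewrite bc (IH t) //; move: H; rewrite bc; lia.
Qed.

Lemma words_binP n m : m < 2 ^ n -> exists2 s, size s = n & bin s = m.
Proof.
elim: n m => [|n IH] m; first by rewrite ltnS leqn0 => /eqP ->; exists [::].
rewrite expnS => H; have [|s ss sm] := IH (m %% 2 ^ n).
  by rewrite ltn_mod expn_gt0.
have dv := divn_eq m (2 ^ n).
have : m %/ 2 ^ n < 2 by rewrite ltn_divLR ?expn_gt0.
move: dv; case: (m %/ 2 ^ n) => [|[|//]] dv _.
  by exists (false :: s) => /=; rewrite ?ss // sm; lia.
by exists (true :: s) => /=; rewrite ?ss // sm; lia.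
Qed.

Lemma poly_lt_exp2 (c k : nat) : exists n, c * n.+1 ^ k < 2 ^ n.
Proof.
pose a := 2 * k + c + 1.
(* With [n + 1] a power of two its [k]-th power is one as well, so only exponents are compared:
   [c + 2 a k < 2 ^ (2 a)], which follows from [(a + 1) ^ 2 <= 2 ^ (2 a)]. *)
exists (2 ^ (2 * a)).-1; rewrite prednK ?expn_gt0 // -expnM.
have H1 : a < 2 ^ a by exact: ltn_expl.
have H2 : a.+1 ^ 2 <= 2 ^ (2 * a) by rewrite mulnC expnM leq_exp2r.
have H3 : c < 2 ^ c by exact: ltn_expl.
apply: (@leq_trans (2 ^ c * 2 ^ (2 * a * k))).
  by rewrite ltn_mul2r H3 expn_gt0.
rewrite -expnD leq_exp2l //.
have ak : 2 * k <= a by rewrite /a; lia.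
have ac : c <= a by rewrite /a; lia.
move: H2 (leq_mul ak (leqnn a)); rewrite -mulnn; move: (2 ^ _) => z.
rewrite mulnAC mulSn mulnS; move: (2 * k * a) (a * a) ak ac => X Y; lia.
Qed.

(** Splitting by parity separates the two digits, splitting into halves ([sum_half]) pairs [m] with
    [m + n]; [size_pre_lt] plays one against the other. *)
Lemma sum_double (F : nat -> nat) n :
  \sum_(m < n.*2) F m = \sum_(k < n) (F k.*2 + F k.*2.+1).
Proof.
elim: n => [|n IH]; first by rewrite !big_ord0.
by rewrite doubleS !big_ord_recr /= IH addnA.
Qed.

Lemma sum_half (F : nat -> nat) n :
  \sum_(m < n.*2) F m = \sum_(k < n) (F k + F (k + n)).
Proof.
by rewrite -addnn big_split_ord /= big_split /=; congr (_ + _);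
  apply: eq_bigr => i _; rewrite addnC.
Qed.

Section Transfer.
Variables p q : nat.
Local Notation N := (p + q)%N.
Local Open Scope ring_scope.

(* On indices in [0, p + q), [tr s] is the product of the transfer matrices of
   the digits of [s]: with indices from 0, (A_b)_{ij} = 1 iff [2 i + b - j] is
   one of the digits 0, q, p + q. *)
Fixpoint tr (s : seq bool) (f : int -> nat) (i : int) : nat :=
  if s is b :: s' then
    (tr s' f (2 * i + b%:Z) + tr s' f (2 * i + b%:Z - q%:Z) +
     tr s' f (2 * i + b%:Z - N%:Z))%N
  else f i.

Definition inb (i : int) : nat := (0 <= i < N%:Z)%R.
(** A row sum of the matrix product along [s]; [wt] is then the sum of all entries, the
    [word_weight] of the pressure. *)
Definition cnt s := tr s inb.
Definition wt s : nat := (\sum_(j < N) cnt s j%:Z)%N.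

Lemma tr_cat s t f i : tr (s ++ t) f i = tr s (tr t f) i.
Proof. by elim: s i => //= b s IH i; rewrite !IH. Qed.

Lemma tr_mono s (f g : int -> nat) i :
  (forall j, f j <= g j)%N -> (tr s f i <= tr s g i)%N.
Proof. by move=> fg; elim: s i => //= b s IH i; rewrite !leq_add. Qed.

Lemma eq_tr s (f g : int -> nat) i : f =1 g -> tr s f i = tr s g i.
Proof. by move=> fg; elim: s i => //= b s IH i; rewrite !IH. Qed.

Lemma tr_scale s c (f : int -> nat) i :
  tr s (fun j => c * f j)%N i = (c * tr s f i)%N.
Proof. by elim: s i => //= b s IH i; rewrite !IH !mulnDr. Qed.

Lemma tr_sum s (I : finType) (c : I -> nat) (f : I -> int -> nat) i :
  tr s (fun j => \sum_k c k * f k j)%N i = (\sum_k c k * tr s (f k) i)%N.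
Proof.
elim: s i => //= b s IH i; rewrite !IH -!big_split /=.
by apply: eq_bigr => k _; rewrite !mulnDr.
Qed.

Lemma tr_pos s (f g : int -> nat) i :
  (forall j, (0 < f j)%N = (0 < g j)%N) -> (0 < tr s f i)%N = (0 < tr s g i)%N.
Proof. by move=> fg; elim: s i => //= b s IH i; rewrite !addn_gt0 !IH. Qed.

Lemma tr_supp s (f : int -> nat) :
  (forall i, inb i = 0%N -> f i = 0%N) -> forall i, inb i = 0%N -> tr s f i = 0%N.
Proof.
move=> f0; elim: s => //= b s IH i; rewrite /inb => Hi.
by rewrite !IH // /inb; case: b; lia.
Qed.

Lemma cnt_supp s i : inb i = 0%N -> cnt s i = 0%N.
Proof. exact: tr_supp. Qed.

(** For [i] in range exactly one of [2 i + b] and [2 i + b - N] is in range again, and the digit [q]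
    contributes at most one more. *)
Lemma tr1_inb b i : (inb i <= tr [:: b] inb i <= 2 * inb i)%N.
Proof. by rewrite /= /inb; case: b; lia. Qed.

Lemma cnt_cat_bounds s t i :
  (cnt s i <= cnt (s ++ t) i <= 2 ^ size t * cnt s i)%N.
Proof.
elim/last_ind: t => [|t b /andP[IH1 IH2]]; first by rewrite cats0 mul1n leqnn.
rewrite -rcons_cat -cats1 /cnt tr_cat size_rcons expnS.
apply/andP; split.
  by apply: (leq_trans IH1); apply: tr_mono => j; case/andP: (tr1_inb b j).
rewrite -mulnA; move: IH2; rewrite -(leq_pmul2l (m := 2)) // => IH2.
apply: leq_trans IH2; rewrite -[X in (_ <= X)%N]tr_scale.
by apply: tr_mono => j; case/andP: (tr1_inb b j).
Qed.

Lemma cnt_ltN (j : 'I_N) : inb j%:Z = 1%N.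
Proof. by rewrite /inb; case: j => /= j; lia. Qed.

Lemma wt_cat_bounds s t : (wt s <= wt (s ++ t) <= 2 ^ size t * wt s)%N.
Proof.
rewrite /wt big_distrr /=; apply/andP.
by split; apply: leq_sum => j _; case/andP: (cnt_cat_bounds s t j%:Z).
Qed.

Lemma wt_bounds s : (N <= wt s <= 2 ^ size s * N)%N.
Proof.
have := wt_cat_bounds [::] s; rewrite cat0s.
suff -> : wt [::] = N by [].
by rewrite /wt (eq_bigr (fun=> 1%N)) ?sum1_card ?card_ord // => j _; rewrite /cnt /= cnt_ltN.
Qed.

Lemma cnt_le_wt s i : (cnt s i <= wt s * inb i)%N.
Proof.
case E : (inb i) => [|k]; first by rewrite cnt_supp.
have -> : k = 0%N by move: E; rewrite /inb; lia.
rewrite muln1; case: i E => [i|i]; rewrite /inb; last by lia.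
move=> H; have iN : (i < N)%N by lia.
by rewrite /wt (bigD1 (Ordinal iN)) //= leq_addr.
Qed.

Lemma cnt_cat_le s t i : (cnt (s ++ t) i <= wt t * cnt s i)%N.
Proof. by rewrite /cnt tr_cat -tr_scale; apply: tr_mono => j; exact: cnt_le_wt. Qed.

Lemma wt_cat_le s t : (wt (s ++ t) <= wt s * wt t)%N.
Proof.
rewrite mulnC [X in (_ * X)%N]/wt big_distrr /=.
by apply: leq_sum => j _; exact: cnt_cat_le.
Qed.

Definition delta (j i : int) : nat := (i == j).

(** A point sees a single row, fixed by its integer part, so positivity of one row is the notion for
    points; positivity of all rows is the one for gluing words. *)
Definition rowfull s (i : int) := [forall j : 'I_N, (0 < tr s (delta j%:Z) i)%N].
Definition full s := [forall i : 'I_N, rowfull s i%:Z].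

Lemma supp_delta (f : int -> nat) : (forall i, inb i = 0%N -> f i = 0%N) ->
  f =1 (fun i => \sum_(j < N) f j%:Z * delta j%:Z i)%N.
Proof.
move=> f0 i; case: (posnP (inb i)) => [E|E].
  rewrite f0 // big1 // => j _; rewrite /delta; case: eqP => [ij|]; rewrite ?muln0 //.
  by move: E; rewrite ij cnt_ltN.
case: i E => [i|i]; rewrite /inb => H; last by lia.
have iN : (i < N)%N by lia.
rewrite (bigD1 (Ordinal iN)) //= /delta eqxx muln1 big1 ?addn0 // => j /eqP nj.
case: eqP; rewrite ?muln0 // => -[ij]; case: nj; apply: val_inj => /=; lia.
Qed.

(** Positive entries are integers, hence at least 1: the row dominates the all-one row. *)
Lemma rowfull_cat s t i : rowfull s i -> (wt t <= cnt (s ++ t) i)%N.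
Proof.
move=> /forallP sf; rewrite /cnt tr_cat.
rewrite (eq_tr _ _ (supp_delta (@cnt_supp t))) tr_sum /wt.
by apply: leq_sum => j _; rewrite leq_pmulr.
Qed.

Lemma full_cat_cnt s W t i : full W -> (wt t * cnt s i <= cnt (s ++ W ++ t) i)%N.
Proof.
move=> /forallP Wf; rewrite /cnt tr_cat -tr_scale; apply: tr_mono => j.
case: (posnP (inb j)) => [->|E]; first by rewrite muln0.
case: j E => [j|j] H; last by move: H; rewrite /inb; lia.
have jN : (j < N)%N by move: H; rewrite /inb; lia.
have -> : inb (Posz j) = 1%N by rewrite /inb; lia.
by rewrite muln1; apply: rowfull_cat; exact: (Wf (Ordinal jN)).
Qed.

Lemma full_cat_wt s W t : full W -> (wt s * wt t <= wt (s ++ W ++ t))%N.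
Proof.
move=> Wf; rewrite mulnC [X in (_ * X)%N]/wt big_distrr /=.
by apply: leq_sum => j _; exact: full_cat_cnt.
Qed.

(* The number of ways to write [M - r], [0 <= r < p + q], as
   [sum_(k < n) 2 ^ k d_k] with [d_k] in {0, q, p + q}. *)
Fixpoint rn (n : nat) (M : int) : nat :=
  if n is m.+1 then
    (rn m M + rn m (M - (2 ^ m)%N%:Z * q%:Z) + rn m (M - (2 ^ m)%N%:Z * N%:Z))%N
  else inb M.

(** Row index and digits merge into one integer, the number of a dyadic cell. Neighbouring cells are
    then reached by adding integers, with no carries to follow in words. *)
Lemma cnt_rn s i : cnt s i = rn (size s) ((2 ^ size s)%N%:Z * i + (bin s)%:Z).
Proof.
rewrite /cnt; elim: s i => [|b s IH] i /=; first by rewrite mul1r addr0.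
rewrite !IH; congr (rn _ _ + rn _ _ + rn _ _)%N; rewrite expnS; nia.
Qed.

(* [m = 2 i + b] ranges over [0, 2N) when [i] ranges over [0, N). *)
Definition hit (X : pred nat) (m : nat) : bool :=
  [|| X m, (q <= m)%N && X (m - q)%N | (N <= m)%N && X (m - N)%N].

(** States with a transition into [X] under the digit [b]. Appending a last letter to a word
    replaces the target [X] by [pre b X]. *)
Definition pre (b : bool) (X : pred nat) : pred nat := fun k => hit X (k.*2 + b).

Definition size_st (X : pred nat) : nat := (\sum_(j < N) X j)%N.

Definition ind (X : pred nat) (i : int) : nat := if i is Posz j then X j else 0%N.

Definition good (X : pred nat) s := [forall i : 'I_N, (0 < tr s (ind X) i%:Z)%N].

(** * Growth of the set of states leading to a given set *)

Section State.
Variable X : pred nat.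
Hypothesis XN : forall j, X j -> (j < N)%N.

Lemma pre_lt b j : pre b X j -> (j < N)%N.
Proof.
by have := leq_b1 b; rewrite /pre /hit => ? /or3P[/XN|/andP[? /XN]|/andP[? /XN]]; lia.
Qed.

Lemma tr_ind_rcons b s i :
  (0 < tr (rcons s b) (ind X) i)%N = (0 < tr s (ind (pre b X)) i)%N.
Proof.
rewrite -cats1 tr_cat; apply: tr_pos => j.
rewrite (_ : tr _ _ _ = ind X (2 * j + b%:Z) + ind X (2 * j + b%:Z - q%:Z)
  + ind X (2 * j + b%:Z - N%:Z))%N //; case: j => [j|j].
  rewrite /pre /hit (_ : 2 * Posz j + b%:Z = (j.*2 + b)%N%:Z); last by lia.
  set m := (j.*2 + b)%N.
  rewrite !addn_gt0 /= !lt0b -orbA; congr (_ || (_ || _)).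
    case: (leqP q m) => [qm|qm] /=; first by rewrite subzn //= lt0b.
    by rewrite (_ : m%:Z - q%:Z = Negz (q - m).-1) //; lia.
  case: (leqP N m) => [qm|qm] /=; first by rewrite subzn //= lt0b.
  by rewrite (_ : m%:Z - N%:Z = Negz (N - m).-1) //; lia.
have neg (d : nat) : 0%N = ind X (2 * Negz j + b%:Z - d%:Z).
  have b1 := leq_b1 b.
  by case E : (2 * Negz j + b%:Z - d%:Z) => [k|k] //=; lia.
by rewrite -!neg -[2 * _ + _]subr0 -(neg 0%N).
Qed.

Lemma good_rcons b s : good X (rcons s b) = good (pre b X) s.
Proof. by apply: eq_forallb => i; exact: tr_ind_rcons. Qed.

Hypothesis p_gt0 : (0 < p)%N.
Hypothesis q_gt0 : (0 < q)%N.
Hypothesis pq : coprime p q.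

Lemma sum_perm (g : nat -> nat) (F : nat -> nat) :
  (forall k, k < N -> g k < N)%N ->
  (forall k l, k < N -> l < N -> g k = g l -> k = l)%N ->
  (\sum_(k < N) F (g k) = \sum_(k < N) F k)%N.
Proof.
move=> gN gi; pose h (k : 'I_N) := Ordinal (gN k (ltn_ord k)).
have hi : injective h by move=> k l [kl]; apply: val_inj; apply: gi kl => //=.
by rewrite [RHS](reindex_inj hi).
Qed.

(** Some choice [g] of one transition per state is a permutation. For odd [N] doubling modulo [N]
    does it. For even [N] both [p] and [q] are odd: subtracting [q] in the middle range yields all
    values of the parity other than [b], and reduction modulo [N] on the two outer ranges yields
    those of the parity of [b]. *)
Lemma size_pre b : (size_st X <= size_st (pre b X))%N.
Proof.
pose g k := let m := (k.*2 + b)%N in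
  if odd N then (if m < N then m else m - N)%N
  else if (q <= m < N + q)%N then (m - q)%N else if (m < N)%N then m else (m - N)%N.
have oq : odd N = false -> odd q.
  move=> oN; apply/negPn/negP => eq; move: oN; rewrite oddD (negbTE eq) addbF => ep.
  have : (2 %| gcdn p q)%N by rewrite dvdn_gcd !dvdn2 ep eq.
  by rewrite (eqP pq).
rewrite /size_st -(@sum_perm g (fun j => X j : nat)).
- apply: leq_sum => k _; rewrite /g /pre /hit; set m := (k.*2 + b)%N.
  case: ifP => _; first by case: ltnP => mN; case: (X _) => //=; rewrite ?orbT ?andbT ?orbT.
  case: ifP => [/andP[-> _]|_]; first by case: (X (m - q)%N); rewrite ?orbT.
  by case: ltnP => mN; case: (X _) => //=; rewrite ?orbT ?andbT ?orbT.
- move=> k kN; rewrite /g /=; move: (nat_of_bool b) (leq_b1 b) => B B1.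
  by case: ifP => _; [case: (ltnP (_ + B) N) | case: ifP => [/andP[]|_]; [|case: (ltnP (_ + B) N)]]; lia.
- move=> k l kN lN; rewrite /g /=.
  case: (odd N) oq (odd_double_half N) => [_|/(_ erefl) oq] E.
    by move: (nat_of_bool b) (leq_b1 b) => B B1; case: (ltnP (k.*2 + B)%N N); case: (ltnP (l.*2 + B)%N N); lia.
  move: (odd_double_half q); rewrite oq.
  move: (nat_of_bool b) (leq_b1 b) => B B1.
  by case: (boolP (q <= k.*2 + B < N + q)%N) => ?;
    case: (boolP (q <= l.*2 + B < N + q)%N) => ?;
    try (case: (ltnP (k.*2 + B)%N N) => ?);
    try (case: (ltnP (l.*2 + B)%N N) => ?); lia.
Qed.

(** Modulo [N], adding [p] is subtracting [q]. If no state outside [X] were carried into [X] by it,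
    [X] would be invariant under adding [q], a transitive rotation as [q] is prime to [N]. *)
Lemma exists_boundary j0 j1 : X j0 -> (j1 < N)%N -> ~~ X j1 ->
  exists m, [/\ (m < N)%N, ~~ X m & hit X m || hit X (m + N)%N].
Proof.
move=> Xj0 j1N Xj1; have j0N := XN Xj0.
have [/existsP[m /andP[Xm Xmp]]|none] :=
    boolP [exists m : 'I_N, ~~ X m && X ((m + p) %% N)%N].
  exists m; split => //; have mN := ltn_ord m; rewrite /hit.
  have [mq|qm] := leqP q m.
    suff E : ((m + p) %% N = m - q)%N by rewrite -E Xmp /= !orbT.
    rewrite (_ : m + p = m - q + N)%N; last by lia.
    by rewrite modnDr modn_small //; lia.
  move: Xmp; rewrite modn_small; last by lia.
  rewrite (_ : m + p = m + N - q)%N; last by lia.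
  by move=> ->; rewrite (_ : q <= m + N)%N ?orbT //; lia.
have step j : X j -> X ((j + q) %% N)%N.
  move=> Xj; have mN : ((j + q) %% N < N)%N by rewrite ltn_mod; lia.
  move: none => /existsPn/(_ (Ordinal mN)) /=; rewrite negb_and negbK.
  case/orP=> //; rewrite modnDml -addnA (addnC q) modnDr modn_small ?Xj //.
  exact: XN.
have steps k : X ((j0 + k * q) %% N)%N.
  elim: k => [|k /step]; first by rewrite mul0n addn0 modn_small.
  by rewrite modnDml -addnA -mulSnr.
have N0 : (0 < N)%N by lia.
(* [a q] is congruent to -1 modulo [N], so [a (j0 + N - j1)] steps of length [q] lead from [j0] to
   [j1]. *)
have [a aN] := Bezoutl q N0.
rewrite (_ : gcdn N q = 1)%N; last by rewrite gcdnC gcdnDr gcdnC; exact/eqP.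
move=> /dvdnP[c Hc].
have := steps (a * (j0 + N - j1))%N.
have -> : (j0 + a * (j0 + N - j1) * q = j1 + (j0 + N - j1) * c * N - N)%N by nia.
rewrite -(modnDr (_ - N)) subnK; last first.
  have : (0 < c)%N by lia.
  have : (0 < j0 + N - j1)%N by lia.
  nia.
by rewrite addnC modnMDl modn_small // (negbTE Xj1).
Qed.

(** Each [k] in [X] is hit from both [k] and [k + N], by the digits 0 and [N]; this gives twice the
    size of [X]. A boundary state outside [X] gives one more hit, by the digit [q]. *)
Lemma size_pre_lt j0 j1 : X j0 -> (j1 < N)%N -> ~~ X j1 ->
  (2 * size_st X < size_st (pre false X) + size_st (pre true X))%N.
Proof.
move=> Xj0 j1N Xj1; have [m [mN Xm Hm]] := exists_boundary Xj0 j1N Xj1.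
rewrite /size_st -big_split /= /pre.
have E : (\sum_(k < N.*2) hit X k =
    \sum_(i < N) (hit X (i.*2 + false) + hit X (i.*2 + true)))%N.
  by rewrite (sum_double (fun k => hit X k : nat)); apply: eq_bigr => i _; rewrite addn0 addn1.
rewrite -E (sum_half (fun k => hit X k : nat)) big_distrr /= (bigD1 (Ordinal mN)) //= [X in (_ < X)%N](bigD1 (Ordinal mN)) //=.
rewrite (negbTE Xm) muln0 -addSn leq_add //.
  by move: Hm; do 2!case: (hit _ _).
apply: leq_sum => k _; rewrite {1}/hit /hit leq_addl addnK.
by case: (X k) => //=; rewrite !orbT.
Qed.

End State.

Hypothesis p_gt0 : (0 < p)%N.
Hypothesis q_gt0 : (0 < q)%N.
Hypothesis pq : coprime p q.

Definition stst (X : pred nat) := forall j, X j -> (j < N)%N.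

Lemma size_stP (X : pred nat) : size_st X = N -> forall j, (j < N)%N -> X j.
Proof.
move=> XE j jN; apply/negPn/negP => Xj.
have : (size_st X < N)%N; last by rewrite XE ltnn.
rewrite -[X in (_ < X)%N](card_ord N) -sum1_card /size_st.
rewrite (bigD1 (Ordinal jN)) //= [X in (_ < X)%N](bigD1 (Ordinal jN)) //=.
by rewrite (negbTE Xj) add0n add1n ltnS; apply: leq_sum => i _; exact: leq_b1.
Qed.

Lemma size_st_le X : (size_st X <= N)%N.
Proof.
rewrite -[X in (_ <= X)%N](card_ord N) -sum1_card /size_st.
by apply: leq_sum => i _; exact: leq_b1.
Qed.

Definition nbad n X := count (fun s => ~~ good X s) (words n).

Lemma size_st_gt0P X : stst X -> (0 < size_st X)%N <-> exists j, X j.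
Proof.
move=> XN; split=> [|[j Xj]].
  rewrite lt0n sum_nat_eq0 => /forallPn[k].
  by rewrite eqb0 negbK => H; exists k.
by rewrite /size_st (bigD1 (Ordinal (XN _ Xj))) //= Xj.
Qed.

Lemma pre_ex b X : stst X -> (exists j, X j) -> exists j, pre b X j.
Proof.
move=> XN /(size_st_gt0P XN) X0; apply/size_st_gt0P; first by move=> k; exact: pre_lt.
by apply: leq_trans X0 _; exact: size_pre.
Qed.

Lemma nbadS n X : stst X ->
  nbad n.+1 X = (nbad n (pre false X) + nbad n (pre true X))%N.
Proof.
move=> XN; rewrite /nbad count_words_rcons; congr (_ + _)%N; apply: eq_count => s.
  by rewrite good_rcons.
by rewrite good_rcons.
Qed.

Lemma nbad_full n X : stst X -> size_st X = N -> nbad n X = 0%N.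
Proof.
elim: n X => [|n IH] X XN XE.
  have gX : good X [::] by apply/forallP => i /=; rewrite (size_stP XE).
  by rewrite /nbad /= gX.
have preE b : size_st (pre b X) = N.
  by apply/eqP; rewrite eqn_leq size_st_le -{1}XE size_pre.
by rewrite nbadS // !IH // => j; exact: pre_lt.
Qed.

(* Adding a last digit never shrinks the set of states leading to [X], and for
   at least one of the two digits it strictly enlarges a proper set. *)
Lemma nbad_le n X : stst X -> (exists j, X j) ->
  (nbad n X <= n.+1 ^ (N - size_st X))%N.
Proof.
elim: n X => [|n IH] X XN [j Xj].
  by rewrite exp1n /nbad /=; case: (good _ _).
have [sN|sN] := eqVneq (size_st X) N; first by rewrite nbad_full.
have ltN : (size_st X < N)%N by rewrite ltn_neqAle sN size_st_le.
have [i iN Xi] : exists2 i, (i < N)%N & ~~ X i.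
  have [/existsP[i Xi]|/existsPn H] := boolP [exists i : 'I_N, ~~ X i]; first by exists i.
  case/eqP: sN; rewrite -[RHS](card_ord N) -sum1_card.
  by apply: eq_bigr => k _; have := H k; rewrite negbK => ->.
have preN b : stst (pre b X) by move=> k; exact: pre_lt.
have Xex : exists j, X j by exists j.
rewrite nbadS //; have := IH _ (preN false) (@pre_ex false X XN Xex).
have := IH _ (preN true) (@pre_ex true X XN Xex).
have := @size_pre X p_gt0 q_gt0 pq false; have := @size_pre X p_gt0 q_gt0 pq true.
have := size_pre_lt XN p_gt0 q_gt0 pq Xj iN Xi.
have ltN' := ltN; move: {sN ltN} ltN'.
move: (size_st X) (size_st (pre false X)) (size_st (pre true X)).
move=> s s0 s1 sltN lt01 le1 le0 b1 b0.
have mono a b : (a <= b -> n.+1 ^ a <= n.+1 ^ b)%N by move=> ab; rewrite leq_pexp2l.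
have [k kE] : exists k, (N - s = k.+1)%N by exists (N - s).-1; lia.
(* With [N - s = k + 1], the letter that enlarges the set leaves an exponent of at most [k], the
   other one at most [k + 1]. *)
rewrite kE; have key : (n.+1 ^ k.+1 + n.+1 ^ k <= n.+2 ^ k.+1)%N.
  rewrite !expnS -[X in (_ + X)%N]mul1n -mulnDl addn1 leq_mul //.
  by case: (k) => [|l] //; rewrite leq_exp2r.
apply: leq_trans key.
have [h|h] := ltnP s s0.
  by rewrite addnC; apply: leq_add; [apply: (leq_trans b1)|apply: (leq_trans b0)]; apply: mono; lia.
by apply: leq_add; [apply: (leq_trans b0)|apply: (leq_trans b1)]; apply: mono; lia.
Qed.

Definition single (j : 'I_N) : pred nat := fun k => k == j.

Lemma not_rowfull s (i : 'I_N) : ~~ rowfull s i%:Z -> exists j, ~~ good (single j) s.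
Proof.
move=> /forallPn[j H]; exists j; apply/forallPn; exists i.
apply: contra H; rewrite (@tr_pos _ _ (delta j%:Z)) // => -[k|k] //=.
Qed.

Definition nonfull n := count (fun s => [exists i : 'I_N, ~~ rowfull s i%:Z]) (words n).

(** A missing entry in column [j] makes the word bad for the singleton of [j]; the bounds of
    [nbad_le] are summed over the [N] columns. *)
Lemma nonfull_le n : (nonfull n <= N * n.+1 ^ N)%N.
Proof.
rewrite /nonfull -sum1_count big_mkcond /=.
apply: (@leq_trans (\sum_(s <- words n) \sum_(j < N) ~~ good (single j) s)).
  apply: leq_sum => s _; case: existsP => // -[i /not_rowfull[j gj]].
  by rewrite (bigD1 j) //= gj.
rewrite exchange_big /= (@leq_trans (\sum_(j < N) n.+1 ^ N)) //; last first.
  by rewrite sum_nat_const card_ord.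
apply: leq_sum => j _.
rewrite (_ : \sum_(s <- words n) _ = nbad n (single j))%N; last first.
  by rewrite /nbad -sum1_count [RHS]big_mkcond /=; apply: eq_bigr => s _; case: (good _ _).
have st : stst (single j) by move=> k /eqP ->.
apply: leq_trans (nbad_le _ st _) _; first by exists j; rewrite /single eqxx.
by rewrite leq_pexp2l // leq_subr.
Qed.

Lemma tr_ex t X : stst X -> (exists j, X j) ->
  exists k : 'I_N, (0 < tr t (ind X) k%:Z)%N.
Proof.
elim/last_ind: t X => [|t b IH] X XN [j Xj].
  by exists (Ordinal (XN _ Xj)) => /=; rewrite Xj.
have [||k Hk] := IH (pre b X); first by move=> k; exact: pre_lt.
  by apply: pre_ex => //; exists j.
by exists k; rewrite tr_ind_rcons.
Qed.

Lemma ind_single (j : 'I_N) : ind (single j) =1 delta j%:Z.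
Proof. by case. Qed.

(** Every column of the matrix of [t] has a positive entry, since nonempty sets of states have
    nonempty preimages. *)
Lemma full_cat W t : full W -> full (W ++ t).
Proof.
move=> /forallP Wf; apply/forallP => i; apply/forallP => j; rewrite tr_cat.
have [||k Hk] := @tr_ex t (single j); first by move=> k /eqP ->.
  by exists j; rewrite /single eqxx.
apply: leq_trans (forallP (Wf i) k) _; apply: tr_mono => l.
by rewrite /delta; case: eqP => // ->; rewrite -(eq_tr _ _ (ind_single j)).
Qed.

(** Polynomially many words fail to be full, out of [2 ^ n]. The last two letters serve [bin_W]. *)
Lemma exists_full : exists W, full (W ++ [:: true; false]).
Proof.
have [n Hn] := poly_lt_exp2 N N.
suff [W Wf] : exists W, full W by exists W; rewrite full_cat.
have [/hasP[s _ sf]|/hasPn H] := boolP (has full (words n)); first by exists s.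
suff : (nonfull n = 2 ^ n)%N by have := nonfull_le n; lia.
rewrite -size_words; apply/eqP; rewrite /nonfull -all_count; apply/allP => s /H.
by rewrite -negb_forall.
Qed.

End Transfer.

Local Open Scope classical_set_scope.
Local Open Scope ring_scope.

(** * The pressure *)

Section Matrix.
Variables (R : realType) (p q : nat).
Local Notation N := (p + q)%N.
Hypothesis q_gt0 : (0 < q)%N.

Lemma image_half (c a b : R) :
  (fun t => t / 2 + c) @` `[a, b] = `[a / 2 + c, b / 2 + c]%classic.
Proof.
apply/seteqP; split=> [_ [t] /= + <-|y] /=; rewrite !in_itv /=; first by lra.
by move=> H; exists (2 * (y - c)) => /=; rewrite ?in_itv /=; lra.
Qed.

Lemma eq_itvcc (a b c d : R) : a = c -> b = d ->
  `[a, b]%classic = `[c, d]%classic.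
Proof. by move=> -> ->. Qed.

Lemma itv_eq_left (a b c d : R) : a <= b -> c <= d ->
  (`[a, b]%classic = `[c, d]%classic) -> a = c.
Proof.
move=> ab cd /seteqP[s1 s2]; have := s1 a; have := s2 c.
by rewrite /= !in_itv /= !lexx /= => /(_ cd) /andP[? _] /(_ ab) /andP[? _]; lra.
Qed.

Definition shift_of (k : 'I_3) : nat :=
  match val k with 0%N => q | 1%N => 0%N | _ => N end.

(** Counted downwards from 1 in units of [1 / (2 q)], both sides are unit intervals with integer
    ends, so they agree as soon as their left ends do. *)
Lemma int_map_itvE (k : 'I_3) (j i : 'I_N) (n : 'I_2) :
  `[< int_map p q k @` @itvI R p q j = @half_itvI R p q n i >] = (j + shift_of k == 2 * i + n)%N.
Proof.
have q0 : (0 < q%:R :> R) by rewrite ltr0n.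
have hE : @half_itvI R p q n i =
    `[1 - ((2 * i + n)%N%:R + 1) / (2 * q%:R), 1 - (2 * i + n)%N%:R / (2 * q%:R)]%classic.
  case: n => -[|[|//]] n2; rewrite /half_itvI /=; apply: eq_itvcc;
    rewrite ?addn0 ?natrD ?natrM -?natr1; field; lra.
have mE : int_map p q k @` @itvI R p q j =
   `[1 - ((j + shift_of k)%N%:R + 1) / (2 * q%:R), 1 - (j + shift_of k)%N%:R / (2 * q%:R)]%classic.
  pose c : R := match val k with 0%N => 0 | 1%N => 1 / 2 | _ => - (p%:R / (2 * q%:R)) end.
  have -> : int_map p q k = (fun t => t / 2 + c).
    by apply/funext => t; rewrite /int_map /c; case: k c => -[|[|[|//]]] //=; rewrite addr0.
  rewrite /itvI image_half /c; case: k c => -[|[|[|//]]] k3 c /=;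
    apply: eq_itvcc;
    rewrite /shift_of /= ?addn0 ?natrD ?natrM -?natr1; field; lra.
have iq : 0 < (2 * q%:R)^-1 :> R by rewrite invr_gt0; lra.
rewrite hE mE; apply/asboolP/eqP => [/itv_eq_left H|->//].
have : 1 - ((j + shift_of k)%N%:R + 1) / (2 * q%:R) = 1 - ((2 * i + n)%N%:R + 1) / (2 * q%:R) :> R.
  by apply: H; rewrite lerD2l lerN2 ler_pM2r // lerDl.
move=> /addrI/oppr_inj/(mulIf (lt0r_neq0 iq))/addIr/eqP.
by rewrite eqr_nat => /eqP.
Qed.

Definition bit (n : 'I_2) : bool := val n == 1%N.

Lemma transfer_mxE (n : 'I_2) (i j : 'I_N) :
  transfer_mx R p q n i j = (tr p q [:: bit n] (delta j%:Z) i%:Z)%:R.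
Proof.
rewrite mxE; congr (_%:R).
rewrite -sum1_card big_mkcond /= !big_ord_recl big_ord0 /= !inE !int_map_itvE /shift_of /=.
rewrite /delta; have -> : bit n = n :> nat by case: n => -[|[|]].
by do 3 (case: eqP => ?); do 3 (case: eqP => ?); lia.
Qed.

Lemma mx_cnt n (x : 'I_n -> 'I_2) (i : 'I_N) :
  ((\big[mulmx/1%:M]_(k < n) transfer_mx R p q (x k)) *m (const_mx 1 : 'cV[R]_N)) i 0
  = (cnt p q [seq bit (x k) | k <- enum 'I_n] i%:Z)%:R.
Proof.
elim: n x i => [|n IH] x i.
  have -> : enum 'I_0 = [::] by apply: size0nil; rewrite size_enum_ord.
  by rewrite big_ord0 mul1mx mxE /cnt /= cnt_ltN.
rewrite big_ord_recl -mulmxA mxE enum_ordSl /= -map_comp.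
pose s := [seq bit (x (lift ord0 k)) | k <- enum 'I_n].
rewrite (_ : map _ _ = s); last by apply: eq_map => k.
rewrite -[_ :: s]/([:: bit (x ord0)] ++ s) /cnt tr_cat.
rewrite (eq_tr _ _ _ _ (supp_delta (@cnt_supp p q s))) tr_sum natr_sum.
apply: eq_bigr => j _; rewrite (IH (fun k => x (lift ord0 k))) transfer_mxE natrM mulrC.
by [].
Qed.

Lemma word_weightE n (xi : {ffun 'I_n -> 'I_2}) :
  word_weight R p q xi = (wt p q [seq bit (xi k) | k <- enum 'I_n])%:R.
Proof.
rewrite /word_weight -mulmxA mxE /wt natr_sum; apply: eq_bigr => j _.
by rewrite mxE mul1r mx_cnt.
Qed.

Definition zn (n : nat) (t : R) : R := \sum_(s <- words n) (wt p q s)%:R `^ t.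

Lemma sum_word_weight n t :
  \sum_(xi : {ffun 'I_n -> 'I_2}) word_weight R p q xi `^ t = zn n t.
Proof.
pose f (xi : {ffun 'I_n -> 'I_2}) := [seq bit (xi k) | k <- enum 'I_n].
rewrite /zn (perm_big (map f (enum {: {ffun 'I_n -> 'I_2}}))); last first.
  apply: uniq_perm; first exact: uniq_words.
    rewrite map_inj_uniq ?enum_uniq // => x y /eq_in_map xy; apply/ffunP => k.
    have := xy k; rewrite mem_enum => /(_ isT); rewrite /bit.
    by case: (x k) (y k) => -[|[|//]] ? [[|[|//]] ?] //= _; apply: val_inj.
  move=> s; rewrite mem_words; apply/eqP/mapP => [ss|[xi _ ->]]; last first.
    by rewrite size_map size_enum_ord.
  exists [ffun k : 'I_n => if nth false s k then 1 else 0 : 'I_2]; first by rewrite mem_enum.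
  apply: (@eq_from_nth _ false); first by rewrite size_map size_enum_ord.
  move=> k; rewrite ss => kn; rewrite (nth_map (Ordinal kn)) ?size_enum_ord // ffunE.
  by rewrite nth_enum_ord //; case: (nth _ _ _).
rewrite big_map big_enum /=; apply: eq_bigr => xi _; rewrite word_weightE //.
Qed.

End Matrix.

Section Fekete.
Variable R : realType.

Lemma nat_ge (x : R) : exists n : nat, x <= n%:R.
Proof.
exists (Num.bound `|x|); apply: (le_trans (ler_norm x)).
exact/ltW/archi_boundP.
Qed.

(** Fekete's lemma. The bound [l n <= u n] at every finite [n] is kept because [pressure_le_lz]
    needs it without error term. *)
Lemma fekete (u : nat -> R) (c : R) :
  (forall n m, u (n + m)%N <= u n + u m) -> (forall n, c * n%:R <= u n) ->
  exists l : R, (forall n, (0 < n)%N -> l * n%:R <= u n) /\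
    (n%:R^-1 * u n @[n --> \oo] --> l).
Proof.
move=> sub lb; pose A := [set u n / n%:R | n in [set n | (0 < n)%N]].
have A0 : A !=set0 by exists (u 1%N / 1), 1%N.
have Alb : has_lbound A.
  exists c => _ [n /= n0 <-]; rewrite ler_pdivlMr ?ltr0n //.
have lE n : (0 < n)%N -> inf A * n%:R <= u n.
  move=> n0; rewrite -ler_pdivlMr ?ltr0n //; apply: ge_inf => //; exists n => //.
exists (inf A); split=> //; apply/cvgrPdist_le => e e0.
have [_ [m /= m0 <-] Hm] := inf_adherent (divr_gt0 e0 (ltr0n R 2)) (conj A0 Alb).
set v := u m / m%:R in Hm; pose B := \sum_(r < m) `|u r|.
have umul k : u (k * m)%N <= k%:R * u m + `|u 0%N|.
  elim: k => [|k IH]; first by rewrite mul0n mul0r add0r ler_norm.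
  rewrite mulSn; apply: (le_trans (sub _ _)); rewrite -natr1 mulrDl mul1r; lra.
have u0B : `|u 0%N| <= B.
  by rewrite /B (bigD1 (Ordinal m0)) //= lerDl sumr_ge0.
have [n0 Hn0] := nat_ge (2 * (m%:R * `|v| + 2 * B) / e).
near=> n; have nn0 : (n0.+1 <= n)%N by near: n; exists n0.+1.
have n_gt0 : (0 < n)%N by lia.
have nR : 0 < n%:R :> R by rewrite ltr0n.
have uE : u n <= n%:R * v + (m%:R * `|v| + 2 * B).
  rewrite {1}(divn_eq n m); apply: (le_trans (sub _ _)).
  have rm : (n %% m < m)%N by rewrite ltn_mod.
  have ur : u (n %% m)%N <= B.
    by rewrite /B (bigD1 (Ordinal rm)) //=; apply: (le_trans (ler_norm _)); rewrite lerDl sumr_ge0.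
  have umE : u m = m%:R * v by rewrite /v mulrC divfK // pnatr_eq0 -lt0n.
  have := umul (n %/ m)%N; rewrite umE mulrA -natrM.
  have nE : n%:R = (n %/ m * m)%N%:R + (n %% m)%N%:R :> R by rewrite -natrD -divn_eq.
  rewrite nE mulrDl.
  have : - ((n %% m)%N%:R * v) <= m%:R * `|v|.
    apply: (@le_trans _ _ ((n %% m)%N%:R * `|v|)).
      by rewrite -mulrN ler_wpM2l // -normrN ler_norm.
    by rewrite ler_wpM2r // ler_nat ltnW.
  lra.
have n0n : n0%:R <= n%:R :> R by rewrite ler_nat; lia.
have Kn : (m%:R * `|v| + 2 * B) / n%:R <= e / 2.
  rewrite ler_pdivrMr //; have := le_trans Hn0 n0n.
  by rewrite ler_pdivrMr //; lra.
have ul : inf A <= n%:R^-1 * u n by rewrite mulrC ler_pdivlMr // lE.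
have uu : n%:R^-1 * u n <= v + (m%:R * `|v| + 2 * B) / n%:R.
  by rewrite mulrC ler_pdivrMr // mulrDl divfK ?lt0r_neq0 // [v * _]mulrC.
rewrite distrC ger0_norm; lra.
Unshelve. all: end_near. Qed.

End Fekete.

(** * Partition sums and elementary properties of the pressure *)

Section Pressure.
Variables (R : realType) (p q : nat).
Local Notation N := (p + q)%N.
Hypothesis p_gt0 : (0 < p)%N.
Hypothesis q_gt0 : (0 < q)%N.

Definition lw (s : seq bool) : R := ln (wt p q s)%:R.
Local Notation zn := (@zn R p q).

Lemma wt_gt0 s : (0 < wt p q s)%N.
Proof. by have /andP[+ _] := wt_bounds p q s; lia. Qed.

Lemma wtR_gt0 s : 0 < (wt p q s)%:R :> R.
Proof. by rewrite ltr0n wt_gt0. Qed.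
Hint Resolve wtR_gt0 : core.

Lemma expR_lw s : expR (lw s) = (wt p q s)%:R.
Proof. by rewrite lnK // posrE. Qed.

Lemma powR_wt s t : (wt p q s)%:R `^ t = expR (t * lw s).
Proof. by rewrite /powR gt_eqF. Qed.

Lemma lw_ge0 s : 0 <= lw s.
Proof. by rewrite ln_ge0 // ler1n wt_gt0. Qed.

Lemma lw_le s : lw s <= (size s)%:R * ln 2 + ln N%:R.
Proof.
have N0 : 0 < N%:R :> R by rewrite ltr0n; lia.
rewrite -ler_expR expR_lw expRD (lnK N0) expRM_natl lnK ?posrE //.
by rewrite -natrX -natrM ler_nat; case/andP: (wt_bounds p q s).
Qed.

Lemma lw_cat_le s t : lw (s ++ t) <= lw s + lw t.
Proof.
rewrite -lnM ?posrE // ler_ln ?posrE ?mulr_gt0 //.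
by rewrite -natrM ler_nat wt_cat_le.
Qed.

Lemma zn_expR n t : zn n t = \sum_(s <- words n) expR (t * lw s).
Proof. by apply: eq_bigr => s _; rewrite powR_wt. Qed.

Lemma zn_gt0 n t : 0 < zn n t.
Proof.
rewrite zn_expR; have := size_words n; case: (words n) => [|s l _].
  by move=> /esym/eqP; rewrite expn_eq0.
by rewrite big_cons ltr_pwDl ?expR_gt0 // sumr_ge0 // => s' _; rewrite expR_ge0.
Qed.
Hint Resolve zn_gt0 : core.

Definition lz n t : R := ln (zn n t).

Lemma big_words_add n m (F : seq bool -> R) :
  \sum_(s <- words (n + m)) F s = \sum_(s <- words n) \sum_(t <- words m) F (s ++ t).
Proof. by rewrite (perm_big _ (perm_words_add n m)) /= big_allpairs_dep. Qed.

Lemma lz_sub n m t : 0 <= t -> lz (n + m) t <= lz n t + lz m t.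
Proof.
move=> t0; rewrite -lnM ?posrE // ler_ln ?posrE ?mulr_gt0 // !zn_expR.
rewrite big_words_add mulr_suml; apply: ler_sum => s _.
rewrite mulr_sumr; apply: ler_sum => s' _.
by rewrite -expRD ler_expR -mulrDr ler_wpM2l // lw_cat_le.
Qed.

Lemma lz_super n m t : t <= 0 -> lz n t + lz m t <= lz (n + m) t.
Proof.
move=> t0; rewrite -lnM ?posrE // ler_ln ?posrE ?mulr_gt0 // !zn_expR.
rewrite big_words_add mulr_suml; apply: ler_sum => s _.
rewrite mulr_sumr; apply: ler_sum => s' _.
by rewrite -expRD ler_expR -mulrDr ler_wnM2l // lw_cat_le.
Qed.

Lemma lz0 n : lz n 0 = n%:R * ln 2.
Proof.
rewrite /lz zn_expR (eq_bigr (fun=> 1)); last by move=> s _; rewrite mul0r expR0.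
rewrite big_const_seq count_predT size_words iter_addr_0 natrX lnXn //.
by rewrite mulr_natl.
Qed.

Lemma lz_mono n t h : 0 <= h -> lz n t <= lz n (t + h).
Proof.
move=> h0; rewrite ler_ln ?posrE // !zn_expR; apply: ler_sum => s _.
by rewrite ler_expR mulrDl lerDl mulr_ge0 // lw_ge0.
Qed.

Lemma lz_lip n t h : 0 <= h -> lz n (t + h) <= lz n t + h * (n%:R * ln 2 + ln N%:R).
Proof.
move=> h0; rewrite -[h * _]expRK -lnM ?posrE ?expR_gt0 // ler_ln ?posrE ?mulr_gt0 ?expR_gt0 //.
rewrite !zn_expR mulr_suml !big_seq; apply: ler_sum => s; rewrite mem_words => /eqP sn.
by rewrite -expRD ler_expR mulrDl lerD2l ler_wpM2l // -sn lw_le.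
Qed.

(** Monotonicity of the power norms: with [r = t / u >= 1], the sum of [r]-th powers of the numbers
    [wt ^ u] is at most the [r]-th power of their sum, as each of them is at most the sum. *)
Lemma lz_conv n t u : 0 <= (t - u) / u -> u != 0 -> lz n t <= t / u * lz n u.
Proof.
move=> tu u0; have -> : t / u = 1 + (t - u) / u by field.
rewrite mulrDl mul1r -[(t - u) / u * _]expRK -lnM ?posrE ?expR_gt0 //.
rewrite ler_ln ?posrE ?mulr_gt0 ?expR_gt0 // [zn n u]zn_expR mulr_suml [zn n t]zn_expR.
rewrite !big_seq; apply: ler_sum => s sn.
rewrite -expRD ler_expR (_ : t * lw s = u * lw s + (t - u) / u * (u * lw s)); last by field.
rewrite lerD2l ler_wpM2l // -[u * _]expRK ler_ln ?posrE ?expR_gt0 // zn_expR.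
rewrite (bigD1_seq s) ?uniq_words //= lerDl; apply: sumr_ge0 => s' _; exact: expR_ge0.
Qed.

Local Notation P := (@pressure R p q).

(** Submultiplicative weights make [lz] subadditive for [t >= 0] and superadditive for [t <= 0], so
    Fekete's lemma is applied to [lz] or to [- lz]; the comparison with [t = 0] supplies the linear
    bound. *)
Lemma pressure_cvg t : n%:R^-1 * lz n t @[n --> \oo] --> P t.
Proof.
have -> : P t = lim (n%:R^-1 * lz n t @[n --> \oo]).
  rewrite /pressure (_ : (fun n => _) = (fun n => n%:R^-1 * lz n t)) //.
  by apply/funext => n; rewrite sum_word_weight.
suff [l Hl] : exists l : R, n%:R^-1 * lz n t @[n --> \oo] --> l.
  by rewrite (cvg_lim _ Hl).
have [t0|t0] := leP 0 t.
  have [||l [_ Hl]] := @fekete R (fun n => lz n t) 0; last by exists l.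
    by move=> n m; exact: lz_sub.
  move=> n; rewrite mul0r; have := lz_mono n 0 t0; rewrite add0r lz0.
  by apply: le_trans; rewrite mulr_ge0 // ln_ge0 // ler1n.
have [||l [_ Hl]] := @fekete R (fun n => - lz n t) (- ln 2).
- by move=> n m; rewrite -opprD lerN2 lz_super // ltW.
- move=> n; rewrite mulNr lerN2 mulrC -lz0.
  by have := @lz_mono n t (- t); rewrite subrr; apply; lra.
exists (- l); rewrite (_ : (fun n => _) = (fun n => - (n%:R^-1 * - lz n t))).
  exact: cvgN.
by apply/funext => n; rewrite mulrN opprK.
Qed.

(** On this side the limit is an infimum, so the bound is free of errors and uniform in [t]. *)
Lemma pressure_le_lz n t : 0 <= t -> P t * n%:R <= lz n t.
Proof.
move=> t0; case: n => [|n].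
  by rewrite mulr0 -(mul0r (ln 2)) -(lz0 0) -[X in _ <= lz _ X]add0r lz_mono.
have [||l [H Hl]] := @fekete R (fun n => lz n t) 0.
- by move=> ? ?; exact: lz_sub.
- move=> k; rewrite mul0r; have := lz_mono k 0 t0; rewrite add0r lz0.
  by apply: le_trans; rewrite mulr_ge0 // ln_ge0 // ler1n.
by rewrite (cvg_unique (@Rhausdorff R) (@pressure_cvg t) Hl) //; exact: H.
Qed.

Lemma pressure0 : P 0 = ln 2.
Proof.
have Hc : n%:R^-1 * lz n 0 @[n --> \oo] --> (ln 2 : R).
  apply: cvg_near_cst; near=> n.
  rewrite lz0 mulKf // pnatr_eq0 -lt0n; near: n; exists 1%N => //.
by rewrite (cvg_unique (@Rhausdorff R) (@pressure_cvg 0) Hc).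
Unshelve. all: end_near. Qed.

Lemma pressure_mono t h : 0 <= h -> P t <= P (t + h).
Proof.
move=> h0; apply: (ler_cvg_to (@pressure_cvg t) (@pressure_cvg (t + h))).
by near=> n; rewrite ler_wpM2l ?lz_mono.
Unshelve. all: end_near. Qed.

Lemma cvg_natV : (n%:R^-1 : R) @[n --> \oo] --> 0.
Proof.
apply/cvgrPdist_le => e e0; have [n0 Hn0] := nat_ge e^-1.
near=> n; have nn0 : (n0.+1 <= n)%N by near: n; exists n0.+1.
rewrite sub0r normrN ger0_norm // -[e]invrK lef_pV2 ?posrE ?invr_gt0 ?ltr0n; try by lia.
by apply: (le_trans Hn0); rewrite ler_nat; lia.
Unshelve. all: end_near. Qed.

Lemma pressure_lip t h : 0 <= h -> P (t + h) <= P t + h * ln 2.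
Proof.
move=> h0; rewrite -[X in _ <= X]addr0 -(mulr0 (h * ln N%:R)).
apply: (ler_cvg_to (@pressure_cvg (t + h))).
  apply: cvgD; last by apply: cvgM; [exact: cvg_cst|exact: cvg_natV].
  by apply: cvgD; [exact: (@pressure_cvg t)|exact: cvg_cst].
near=> n; have n0 : (0 < n)%N by near: n; exists 1%N.
have nR : 0 < n%:R :> R by rewrite ltr0n.
have := @lz_lip n t h h0; rewrite -[n%:R^-1 * _ <= _](ler_pM2l nR) mulVKf ?gt_eqF //.
suff -> : n%:R * (n%:R^-1 * lz n t + h * ln 2 + h * ln N%:R * n%:R^-1) =
  lz n t + h * (n%:R * ln 2 + ln N%:R) by [].
by field; rewrite gt_eqF.
Unshelve. all: end_near. Qed.

Lemma pressure_conv t u : 0 <= (t - u) / u -> u != 0 -> P t <= t / u * P u.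
Proof.
move=> tu u0; apply: (ler_cvg_to (@pressure_cvg t)).
  by apply: cvgM; [exact: cvg_cst|exact: (@pressure_cvg u)].
near=> n; rewrite -[X in _ <= X]/(t / u * (n%:R^-1 * lz n u)) mulrCA ler_wpM2l ?lz_conv //.
Unshelve. all: end_near. Qed.

Lemma ln2_gt0 : 0 < ln 2 :> R. Proof. by rewrite ln_gt0 // ltr1n. Qed.
Hint Resolve ln2_gt0 : core.

(** By [pressure_conv] the quotient [P t / (t ln 2)] is nonincreasing for [t > 0], so its limit
    [bmax] is its infimum. *)
Lemma bmax_le t : 0 < t -> t * ln 2 * bmax R p q <= P t.
Proof.
move=> t0; pose f t := P t / (t * ln 2).
have fmono u v : 0 < u -> u <= v -> f v <= f u.
  move=> u0 uv; have v0 := lt_le_trans u0 uv.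
  rewrite /f ler_pdivrMr ?mulr_gt0 //.
  rewrite (_ : P u / _ * _ = v / u * P u); last first.
    by field; rewrite !gt_eqF.
  by apply: pressure_conv; rewrite ?gt_eqF // divr_ge0 // ?subr_ge0 // ltW.
have f0 u : 0 < u -> 0 <= f u.
  move=> u0; have : P 0 <= P (0 + u) by rewrite pressure_mono // ltW.
  rewrite pressure0 add0r => Pu.
  by rewrite divr_ge0 ?mulr_ge0 ?(ltW u0) ?(ltW ln2_gt0) // (le_trans (ltW ln2_gt0)).
pose A := [set f u | u in [set u : R | 0 < u]].
have Alb : has_lbound A by exists 0 => _ [u /= u0 <-]; exact: f0.
have A0 : A !=set0 by exists (f 1), 1 => /=.
have Hl : P u / (u * ln 2) @[u --> +oo] --> inf A.
  apply/cvgrPdist_le => e e0.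
  have [_ [v /= v0 <-] Hv] := inf_adherent e0 (conj A0 Alb).
  near=> u; have uv : v <= u by near: u; apply: nbhs_pinfty_ge; exact: num_real.
  have u0 := lt_le_trans v0 uv.
  have : inf A <= f u by apply: ge_inf => //; exists u.
  have := fmono _ _ v0 uv; rewrite -/(f u) distrC => ? ?; rewrite ger0_norm; lra.
rewrite /bmax (cvg_lim _ Hl) // mulrC -ler_pdivlMr ?mulr_gt0 //.
by apply: ge_inf => //; exists t.
Unshelve. all: end_near. Qed.

(** For [t < 0] the quotient increases as [t] goes to [-oo] and stays at most 1, so [bmin] is its
    supremum; multiplying by the negative [t ln 2] reverses the inequality. *)
Lemma bmin_le t : t < 0 -> t * ln 2 * bmin R p q <= P t.
Proof.
move=> t0; pose f t := P t / (t * ln 2).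
have fmono u v : v < 0 -> u <= v -> f v <= f u.
  move=> v0 uv; have u0 := le_lt_trans uv v0.
  rewrite /f ler_ndivlMr; last by rewrite nmulr_rlt0.
  rewrite (_ : P v / _ * _ = u / v * P v); last first.
    by field; rewrite (gt_eqF ln2_gt0) lt_eqF.
  by apply: pressure_conv; rewrite ?lt_eqF // mulr_le0 ?invr_le0 ?subr_le0 // ltW.
have f1 u : u < 0 -> f u <= 1.
  move=> u0; rewrite ler_ndivrMr ?nmulr_rlt0 // mul1r.
  have nu : 0 <= - u by lra.
  by have := pressure_lip u nu; rewrite addrN pressure0; have := ln2_gt0; lra.
pose A := [set f u | u in [set u : R | u < 0]].
have Aub : has_ubound A by exists 1 => _ [u /= u0 <-]; exact: f1.
have A0 : A !=set0 by exists (f (-1)), (-1) => //=; lra.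
have Hl : P u / (u * ln 2) @[u --> -oo] --> sup A.
  apply/cvgrPdist_le => e e0.
  have [_ [v /= v0 <-] Hv] := sup_adherent e0 (conj A0 Aub).
  near=> u; have uv : u <= v by near: u; apply: nbhs_ninfty_le; exact: num_real.
  have u0 := le_lt_trans uv v0.
  have : f u <= sup A by apply: ub_le_sup => //; exists u.
  have := fmono _ _ v0 uv; rewrite -/(f u) => ? ?; rewrite ger0_norm; lra.
rewrite /bmin (cvg_lim _ Hl) // mulrC -ler_ndivrMr ?nmulr_rlt0 //.
by apply: ub_le_sup => //; exists t.
Unshelve. all: end_near. Qed.

End Pressure.

(** * Large deviations *)

Section Tilt.
Variables (R : realType) (T : eqType) (X : seq T) (y : T -> R).

Fixpoint tups (K : nat) : seq (seq T) :=
  if K is K'.+1 then [seq x :: l | x <- X, l <- tups K'] else [:: [::]].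

Lemma tupsP K l : l \in tups K -> size l = K /\ all (mem X) l.
Proof.
elim: K l => [|K IH] l /=; first by rewrite inE => /eqP ->.
by move=> /allpairsP[[x l'] /= [xX /IH[<- lX] ->]] /=; rewrite lX andbT.
Qed.

Lemma uniq_tups K : uniq X -> uniq (tups K).
Proof.
move=> uX; elim: K => //= K IH; apply: allpairs_uniq => // -[x l] [x' l'] _ _.
by move=> /= [-> ->].
Qed.

Definition phi (t : R) := \sum_(x <- X) expR (t * y x).
Definition ysum (l : seq T) : R := \sum_(x <- l) y x.

Lemma tups_sum K t : \sum_(l <- tups K) expR (t * ysum l) = phi t ^+ K.
Proof.
elim: K => [|K IH] /=; first by rewrite big_seq1 /ysum big_nil mulr0 expR0.
rewrite big_allpairs_dep /= exprS -IH /phi mulr_suml; apply: eq_bigr => x _.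
rewrite mulr_sumr; apply: eq_bigr => l _.
by rewrite /ysum big_cons mulrDr expRD.
Qed.

(** Exponential Markov inequality for the weights [expR (t y)]: the hypothesis bounds the tilted
    mean of [expR (k y)]. A positive [k] treats upper tails, a negative one lower tails. *)
Lemma chernoff t k u c K (Q : pred (seq T)) : phi (t + k) <= phi t * expR (k * u) ->
  (forall l, Q l -> K%:R * (k * u + c) <= k * ysum l) ->
  \sum_(l <- tups K | Q l) expR (t * ysum l) <= phi t ^+ K * expR (- c * K%:R).
Proof.
move=> H HQ; have phi0 s : 0 <= phi s by apply: sumr_ge0 => *; exact: expR_ge0.
apply: (@le_trans _ _ (\sum_(l <- tups K) expR ((t + k) * ysum l) * expR (- (K%:R * (k * u + c))))).
  rewrite big_mkcond; apply: ler_sum => l _; case: ifP => [/HQ Ql|_]; last first.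
    by rewrite mulr_ge0 ?expR_ge0.
  by rewrite -expRD ler_expR; lra.
rewrite -mulr_suml tups_sum.
apply: (@le_trans _ _ ((phi t * expR (k * u)) ^+ K * expR (- (K%:R * (k * u + c))))).
  by rewrite ler_wpM2r ?expR_ge0 // lerXn2r ?nnegrE ?mulr_ge0 ?expR_ge0.
rewrite exprMn -expRM_natr -[X in X <= _]mulrA -expRD ler_wpM2l ?exprn_ge0 // ler_expR.
by rewrite le_eqVlt; apply/orP; left; apply/eqP; ring.
Qed.

Lemma tilted_count t k u u' v K M : 0 <= k ->
  phi (t + k) <= phi t * expR (k * u) ->
  phi (t - k) <= phi t * expR (- (k * u')) ->
  expR (- (k * v) * K%:R) <= 1 / 4 ->
  (forall z, K%:R * (u' - v) <= z <= K%:R * (u + v) -> t * z <= M) ->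
  phi t ^+ K / 2 <=
    (count (fun l => K%:R * (u' - v) <= ysum l <= K%:R * (u + v)) (tups K))%:R * expR M.
Proof.
move=> k0 H1 H2 H3 HM.
have T1 : \sum_(l <- tups K | K%:R * (u + v) < ysum l) expR (t * ysum l)
    <= phi t ^+ K * expR (- (k * v) * K%:R).
  by apply: chernoff H1 _ => l Hl; have := ler_wpM2l k0 (ltW Hl); lra.
have T2 : \sum_(l <- tups K | ysum l < K%:R * (u' - v)) expR (t * ysum l)
    <= phi t ^+ K * expR (- (k * v) * K%:R).
  apply: (@chernoff t (- k) u'); first by rewrite mulNr.
  by move=> l Hl; have := ler_wpM2l k0 (ltW Hl); lra.
have phi0 : 0 <= phi t ^+ K by apply: exprn_ge0; apply: sumr_ge0 => *; exact: expR_ge0.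
have := ler_wpM2l phi0 H3.
set G := fun l => _.
have : phi t ^+ K <= \sum_(l <- tups K | K%:R * (u + v) < ysum l) expR (t * ysum l)
   + \sum_(l <- tups K | ysum l < K%:R * (u' - v)) expR (t * ysum l)
   + \sum_(l <- tups K | G l) expR (t * ysum l).
  rewrite -tups_sum [X in X + _ + _]big_mkcond [X in _ + X + _]big_mkcond [X in _ + _ + X]big_mkcond.
  rewrite -!big_split /=; apply: ler_sum => l _; rewrite /G.
  have e0 := expR_ge0 (t * ysum l).
  case: (ltP (K%:R * (u + v)) (ysum l)); case: (ltP (ysum l) (K%:R * (u' - v))) => /= _ _; lra.
have : \sum_(l <- tups K | G l) expR (t * ysum l) <= (count G (tups K))%:R * expR M.
  rewrite -sum1_count natr_sum mulr_suml; apply: ler_sum => l Gl.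
  by rewrite mul1r ler_expR HM.
lra.
Qed.

Lemma expR_le_quad (x : R) : `|x| <= 1 / 2 -> expR x <= 1 + x + 2 * x ^+ 2.
Proof.
rewrite ler_norml => /andP[x1 x2].
have h : 1 - x <= expR (- x) by have := expR_ge1Dx (- x); lra.
have h0 : 0 < 1 - x by lra.
rewrite -[expR x]invrK -expRN -[X in _ <= X]invrK lef_pV2 ?posrE ?invr_gt0 ?expR_gt0 //; last by nra.
apply: le_trans h; rewrite -[1 - x]invrK lef_pV2 ?posrE ?invr_gt0 //; last by nra.
rewrite -[(1 - x)^-1]mul1r ler_pdivrMr //; have : 0 <= x ^+ 2 by exact: sqr_ge0.
by move=> ?; nra.
Qed.

(** A bound on the second difference of [phi]: a lower bound at one neighbour of [t] becomes an
    upper bound at the other, with an error quadratic in the step. *)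
Lemma second_order t k Y : 0 <= k -> (forall x, x \in X -> `|y x| <= Y) ->
  k * Y <= 1 / 2 -> phi (t + k) + phi (t - k) <= phi t * (2 + 4 * (k * Y) ^+ 2).
Proof.
move=> k0 HY kY; rewrite /phi -big_split mulr_suml /= !big_seq.
apply: ler_sum => x /HY yY.
have ky : `|k * y x| <= k * Y by rewrite normrM ger0_norm // ler_wpM2l.
have h1 : `|k * y x| <= 1 / 2 by exact: le_trans kY.
have e1 := expR_le_quad h1.
have e2 : expR (- (k * y x)) <= 1 - k * y x + 2 * (k * y x) ^+ 2.
  by rewrite -[(_ * y x) ^+ 2]sqrrN; apply: expR_le_quad; rewrite normrN.
have sq : (k * y x) ^+ 2 <= (k * Y) ^+ 2.
  by rewrite -(@real_normK _ (k * y x)) ?num_real // lerXn2r ?nnegrE // (le_trans _ ky).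
rewrite mulrDl mulrBl !expRD -mulrDr ler_wpM2l ?expR_ge0 //; lra.
Qed.

Lemma phi_gt0 t : X != [::] -> 0 < phi t.
Proof.
rewrite /phi; case: X => // x l _.
by rewrite big_cons ltr_pwDl ?expR_gt0 // sumr_ge0 // => *; exact: expR_ge0.
Qed.

(* The minimum over a fine grid replaces a critical point of the convex
   function [ln phi]: it exists without any differentiability, and the penalty
   [H `|t|] keeps it away from the ends of the grid. *)
Lemma tilt_main (Y T0 H m : R) : X != [::] -> (forall x, x \in X -> `|y x| <= Y) ->
  0 < T0 -> 0 < H ->
  phi 0 < phi T0 * expR (H * T0) -> phi 0 < phi (- T0) * expR (H * T0) ->
  (forall t, `|t| <= T0 -> expR m <= phi t * expR (H * `|t|)) ->
  exists K1, forall K, (K1 <= K)%N ->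
   expR (K%:R * (m - 2 * H)) / 2 <=
   (count (fun l => `|ysum l| <= 3 * H * K%:R) (tups K))%:R.
Proof.
move=> X0 HY T_gt0 H_gt0 endR endL Hm.
have Y0 : 0 <= Y.
  case: X X0 HY => // x l _ /(_ x); rewrite inE eqxx => /(_ isT).
  exact: le_trans (normr_ge0 _).
(* The slack in the tilted mean; it is multiplied by [|t| <= T0] later on, and [v T0 + v = H] keeps
   the total loss below [2 H]. *)
pose v := H / (T0 + 1).
have v0 : 0 < v by rewrite divr_gt0 // addr_gt0.
have vE : v * T0 + v = H by rewrite /v; field; rewrite gt_eqF // addr_gt0.
have vT : 0 <= v * T0 by rewrite mulr_ge0 // ltW.
have [J1 HJ1] := nat_ge (2 * T0 * Y).
have [J2 HJ2] := nat_ge (4 * T0 * Y ^+ 2 / v).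
(* The grid has [J] steps on each side of 0, fine enough for [second_order] to apply and for its
   error [4 (k Y) ^ 2] to be at most [k v]. *)
pose J := (J1 + J2).+1.
have JR : 0 < J%:R :> R by rewrite ltr0n.
pose k := T0 / J%:R.
have k_gt0 : 0 < k by rewrite divr_gt0.
have kJ : J%:R * k = T0 by rewrite /k mulrC divfK // gt_eqF.
have kY : k * Y <= 1 / 2.
  rewrite /k mulrAC ler_pdivrMr //.
  have : J1%:R <= J%:R :> R by rewrite ler_nat ltnW // ltnS leq_addr.
  lra.
have kYv : 4 * (k * Y) ^+ 2 <= k * v.
  have : J2%:R <= J%:R :> R by rewrite ler_nat ltnW // ltnS leq_addl.
  move=> /(le_trans HJ2); rewrite ler_pdivrMr // => h.
  rewrite exprMn (_ : 4 * _ = k * (k * (4 * Y ^+ 2))); last by ring.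
  by rewrite ler_pM2l // /k mulrAC ler_pdivrMr //; lra.
have J_gt0 : (0 < J)%N by [].
move: J JR k k_gt0 kJ kY kYv J_gt0 => J JR k k_gt0 kJ kY kYv J_gt0.
clearbody v; clear J1 HJ1 J2 HJ2.
pose g (j : nat) : R := (j%:R - J%:R) * k.
pose psi t := phi t * expR (H * `|t|).
have Jlt : (J < (J + J).+1)%N by rewrite ltnS leq_addr.
case: (@Order.TotalTheory.arg_minP _ _ _ (Ordinal Jlt) xpredT (fun j : 'I_(J + J).+1 => psi (g j)) isT) => j _ jmin.
have psi0 : psi (g J) = phi 0 by rewrite /psi /g subrr mul0r normr0 mulr0 expR0 mulr1.
have jJ : psi (g j) <= phi 0 by rewrite -psi0; exact: (jmin (Ordinal Jlt)).
have gR : g (J + J)%N = T0 by rewrite /g natrD addrK.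
have gL : g 0%N = - T0 by rewrite /g sub0r mulNr kJ.
have j0 : (0 < j)%N.
  rewrite lt0n; apply/eqP => jE; move: jJ; rewrite jE gL /psi normrN gtr0_norm //.
  by move/(lt_le_trans endL); rewrite ltxx.
have jL : (j < J + J)%N.
  rewrite ltn_neqAle -ltnS ltn_ord andbT; apply/eqP => jE; move: jJ; rewrite jE gR /psi gtr0_norm //.
  by move/(lt_le_trans endR); rewrite ltxx.
set t := g j in jJ.
have jl1 : (j.-1 < (J + J).+1)%N by rewrite ltnS (leq_trans (leq_pred j)) // ltnW.
have jr1 : (j.+1 < (J + J).+1)%N by rewrite ltnS.
have tl : g j.-1 = t - k by rewrite /t /g -[in RHS](prednK j0) -natr1; ring.
have tr : g j.+1 = t + k by rewrite /t /g -natr1; ring.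
have minL : psi t <= psi (t - k) by rewrite -tl; exact: (jmin (Ordinal jl1)).
have minR : psi t <= psi (t + k) by rewrite -tr; exact: (jmin (Ordinal jr1)).
have phi0 s : 0 < phi s by exact: phi_gt0.
have tT : `|t| <= T0.
  have : (j%:R : R) <= (J + J)%N%:R by rewrite ler_nat ltnW.
  rewrite natrD => jR; have jR0 : 0 <= j%:R :> R by [].
  by rewrite -kJ /t /g normrM (gtr0_norm k_gt0) ler_pM2r // ler_norml; lra.
have so := second_order t (ltW k_gt0) HY kY.
(* [c] bounds from below one neighbour of [t], [second_order] then bounds the
   other one from above *)
have ratio s c : psi t <= psi s -> c * k <= `|t| - `|s| ->
    phi t * (1 + H * (c * k)) <= phi s.
  rewrite /psi => h1 h2; apply: (@le_trans _ _ (phi t * expR (H * (c * k)))).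
    by rewrite ler_pM2l // expR_ge1Dx.
  apply: (@le_trans _ _ (phi t * expR (H * `|t| - H * `|s|))).
    by rewrite ler_pM2l // ler_expR -mulrBr ler_pM2l.
  by rewrite expRD mulrA expRN ler_pdivrMr ?expR_gt0.
have upper a b w : phi a + phi b <= phi t * (2 + 4 * (k * Y) ^+ 2) ->
    phi t * (1 + H * (w * k)) <= phi b -> phi a <= phi t * expR (k * (v - H * w)).
  move=> h1 h2; apply: (@le_trans _ _ (phi t * (1 + k * (v - H * w)))); last first.
    by rewrite ler_pM2l // expR_ge1Dx.
  have := ler_wpM2l (ltW (phi0 t)) kYv; lra.
have absR : - (1) * k <= `|t| - `|t + k|.
  by have := ler_normD t k; rewrite (gtr0_norm k_gt0); lra.
have absL : - (1) * k <= `|t| - `|t - k|.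
  by have := ler_normB t k; rewrite (gtr0_norm k_gt0); lra.
have so' : phi (t - k) + phi (t + k) <= phi t * (2 + 4 * (k * Y) ^+ 2) by rewrite addrC.
(* The constant 3 gives the factor 1/4 on each tail through [expR 3 >= 1 + 3]. *)
have [K1 HK1] := nat_ge (3 / (k * v)).
exists K1 => K KK1.
have tail : expR (- (k * v) * K%:R) <= 1 / 4.
  have : 3 <= k * v * K%:R.
    rewrite -ler_pdivrMl ?mulr_gt0 // mulrC; apply: (le_trans HK1).
    by rewrite ler_nat.
  move=> h; have := expR_ge1Dx (k * v * K%:R).
  by rewrite mulNr expRN -[1 / 4]mul1r -[X in _ <= 1 * X]invrK mul1r invf_div divr1 lef_pV2 ?posrE ?expR_gt0 //; lra.
have K0 : 0 <= K%:R :> R by [].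
have KH : 0 <= K%:R * H by rewrite mulr_ge0 // ltW.
have Kv : 0 <= K%:R * v by rewrite mulr_ge0 // ltW.
have KvE : K%:R * (v * T0) + K%:R * v = K%:R * H by rewrite -mulrDr vE.
suff [u [u' [M [h1 h2 h3 h4 h5]]]] : exists u u' M,
    [/\ phi (t + k) <= phi t * expR (k * u),
        phi (t - k) <= phi t * expR (- (k * u')),
        forall z, K%:R * (u' - v) <= z <= K%:R * (u + v) -> t * z <= M,
        - (3 * H) <= u' - v /\ u + v <= 3 * H &
        M <= K%:R * (2 * H) - K%:R * (H * `|t|)].
  have C := tilted_count (ltW k_gt0) h1 h2 tail h3.
  pose G1 (l : seq T) := K%:R * (u' - v) <= ysum l <= K%:R * (u + v).
  pose G2 (l : seq T) := `|ysum l| <= 3 * H * K%:R.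
  have cnt_le : (count G1 (tups K) <= count G2 (tups K))%N.
    apply: sub_count => l /andP[l1 l2]; rewrite /G2 ler_norml.
    case: h4 => h6 h7.
    have := ler_wpM2l K0 h6; have := ler_wpM2l K0 h7; lra.
  rewrite -(ler_nat R) in cnt_le.
  have E1 : expR (K%:R * (m - H * `|t|)) <= phi t ^+ K.
    rewrite expRM_natl lerXn2r ?nnegrE ?expR_ge0 ?(ltW (phi0 t)) //.
    rewrite expRD expRN ler_pdivrMr ?expR_gt0 //; exact: Hm.
  rewrite -(ler_pM2r (expR_gt0 M)); apply: (le_trans _ (le_trans C _)); last first.
    by rewrite ler_wpM2r ?expR_ge0.
  rewrite mulrAC -expRD ler_pM2r ?invr_gt0 //; apply: le_trans E1.
  rewrite ler_expR; lra.
(* For nonzero [t] the penalty forces the tilted mean to the side opposite to [t], near [- H] or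
   [H]. Then [t z] contains [- K H |t|], which cancels the penalty in the lower bound for [phi t].
   At [t = 0] the mean is only known to be within about [H] of 0, which is enough. *)
have [t_gt0|t_lt0|t_eq0] := ltgtP 0 t.
- have kt : k <= t.
    move: t_gt0; rewrite /t /g pmulr_lgt0 // subr_gt0 ltr_nat => jJ'.
    have : (1 : R) <= j%:R - J%:R by rewrite lerBrDl natr1 ler_nat.
    by move=> h; rewrite -[X in X <= _]mul1r ler_wpM2r // ltW.
  exists (v - H * 1), (- (v - H * (- (1)))), (K%:R * t * (- H + 2 * v)); split.
  + apply: (upper _ _ _ so); apply: ratio => //.
    by rewrite (gtr0_norm t_gt0) ger0_norm; lra.
  + by rewrite mulrN opprK; apply: (upper _ _ _ so'); apply: ratio.
  + by move=> z /andP[_ z2]; have := ler_wpM2l (ltW t_gt0) z2; lra.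
  + by do !split; lra.
  + rewrite (gtr0_norm t_gt0) in tT *.
    have : (K%:R * v) * t <= (K%:R * v) * T0 by rewrite ler_wpM2l.
    lra.
- have kt : t <= - k.
    move: t_lt0; rewrite /t /g pmulr_llt0 // subr_lt0 ltr_nat => jJ'.
    have : j%:R - J%:R <= - (1) :> R by rewrite lerBlDr addrC lerBrDr natr1 ler_nat.
    by move=> h; rewrite -[X in _ <= X]mulN1r ler_wpM2r // ltW.
  exists (v - H * (- (1))), (- (v - H * 1)), (K%:R * t * (H - 2 * v)); split.
  + by apply: (upper _ _ _ so); apply: ratio.
  + rewrite mulrN opprK; apply: (upper _ _ _ so'); apply: ratio => //.
    by rewrite (ltr0_norm t_lt0) ler0_norm; lra.
  + by move=> z /andP[z1 _]; have := ler_wnM2l (ltW t_lt0) z1; lra.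
  + by do !split; lra.
  + rewrite (ltr0_norm t_lt0) in tT *.
    have : (K%:R * v) * (- t) <= (K%:R * v) * T0 by rewrite ler_wpM2l.
    lra.
- exists (v - H * (- (1))), (- (v - H * (- (1)))), 0; split.
  + by apply: (upper _ _ _ so); apply: ratio.
  + by rewrite mulrN opprK; apply: (upper _ _ _ so'); apply: ratio.
  + by move=> z _; rewrite -t_eq0 mul0r.
  + by do !split; lra.
  + by rewrite -t_eq0 normr0; lra.
Qed.

End Tilt.

Lemma eventually_forall (Q : nat -> nat -> Prop) J :
  (forall i, exists n1, forall n, (n1 <= n)%N -> Q i n) ->
  exists n1, forall n, (n1 <= n)%N -> forall i, (i <= J)%N -> Q i n.
Proof.
move=> H; elim: J => [|J [n1 H1]].
  by have [n1 H1] := H 0%N; exists n1 => n nn i; rewrite leqn0 => /eqP->; exact: H1.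
have [n2 H2] := H J.+1; exists (maxn n1 n2) => n; rewrite geq_max => /andP[h1 h2] i.
by rewrite leq_eqVlt ltnS => /orP[/eqP->|]; [exact: H2|exact: H1].
Qed.

Lemma ln2_le1 (R : realType) : ln 2 <= 1 :> R.
Proof. by rewrite -[1 in X in _ <= X]expRK ler_ln ?posrE ?expR_gt0 //; have := expR_ge1Dx (1 : R). Qed.

(** * Many words with a prescribed growth of weight *)

Section Block.
Variables (R : realType) (p q : nat).
Local Notation N := (p + q)%N.
Hypothesis p_gt0 : (0 < p)%N.
Hypothesis q_gt0 : (0 < q)%N.
Hypothesis pq : coprime p q.
Local Notation P := (@pressure R p q).
Local Notation lw := (@lw R p q).
Local Notation lz := (@lz R p q).

(** Uniform in [t]: for [t >= 0] by [pressure_le_lz], and on [[- T0, 0]] by finitely many grid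
    points, monotonicity and the Lipschitz bound. *)
Lemma lz_lower (T0 e : R) : 0 < T0 -> 0 < e ->
  exists n1, forall n, (n1 <= n)%N -> forall t, - T0 <= t ->
   n%:R * (P t - 2 * e) <= lz n t.
Proof.
move=> T_gt0 e_gt0; have [J HJ] := nat_ge (T0 / e).
pose tau i : R := - T0 + i%:R * e.
have [|n1 Hn1] := @eventually_forall (fun i n => n%:R * (P (tau i) - e) <= lz n (tau i)) J.
  move=> i; have /cvgrPdist_le/(_ e e_gt0)[n1 _ Hn1] := @pressure_cvg R p q p_gt0 q_gt0 (tau i).
  exists n1.+1 => n nn; have n0 : (0 < n)%N by exact: leq_trans nn.
  have nR : 0 < n%:R :> R by rewrite ltr0n.
  have := Hn1 n (ltnW nn); rewrite ler_norml => /andP[_ h].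
  by rewrite mulrC -ler_pdivlMr // mulrC; lra.
exists n1 => n nn t tT; have n0 : 0 <= n%:R :> R by [].
have [t0|t0] := leP 0 t.
  have := pressure_le_lz p_gt0 q_gt0 n t0.
  have : 0 <= n%:R * e by rewrite mulr_ge0 // ltW.
  lra.
have te0 : 0 <= (t + T0) / e by rewrite divr_ge0 ?(ltW e_gt0) //; lra.
pose i := Num.truncn ((t + T0) / e).
have /andP[] := truncn_itv te0; rewrite -/i.
rewrite ler_pdivlMr // ltr_pdivrMr // => i1 i2.
have iJ : (i <= J)%N.
  rewrite -(ler_nat R) -(ler_pM2r e_gt0); apply: (le_trans i1).
  move: HJ; rewrite ler_pdivrMr // => HJ; lra.
have dt : 0 <= t - tau i by rewrite /tau; lra.
have := Hn1 n nn i iJ; have := lz_mono p_gt0 q_gt0 n (tau i) dt; rewrite subrKC => h1 h2.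
have := pressure_lip p_gt0 q_gt0 (tau i) dt; rewrite subrKC => h3.
have h4 : (t - tau i) * ln 2 <= e.
  apply: (@le_trans _ _ ((t - tau i) * 1)); first by rewrite ler_wpM2l // ln2_le1.
  by rewrite mulr1 /tau; move: i2; rewrite -natr1; clear -R; lra.
have h5 : P t - 2 * e <= P (tau i) - e by move: h3 h4; clear -R; lra.
by apply: le_trans (ler_wpM2l n0 h5) _; exact: le_trans h1.
Qed.

Variable W : seq bool.
Hypothesis Wfull : full p q W.

Definition glue (l : seq (seq bool)) := flatten [seq x ++ W | x <- l].

Lemma size_glue n l : all (mem (words n)) l ->
  size (glue l) = (size l * (n + size W))%N.
Proof.
elim: l => //= x l IH /andP[]; rewrite mem_words => /eqP xn /IH h.
by rewrite /glue /= -/(glue l) !size_cat h xn mulSn.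
Qed.

Lemma glue_inj n l l' : size l = size l' -> all (mem (words n)) l ->
  all (mem (words n)) l' -> glue l = glue l' -> l = l'.
Proof.
elim: l l' => [|x l IH] [|x' l'] //= [ll] /andP[xn ln] /andP[xn' ln'].
rewrite !mem_words in xn xn'; move=> /eqP; rewrite /glue /= -!catA.
rewrite eqseq_cat ?(eqP xn) ?(eqP xn') // eqseq_cat // => /andP[/eqP-> /andP[_ /eqP h]].
by rewrite (IH l').
Qed.

Lemma lw_full_cat s t : lw s + lw t <= lw (s ++ W ++ t).
Proof.
rewrite -lnM ?posrE ?wtR_gt0 // ler_ln ?posrE ?mulr_gt0 ?wtR_gt0 // -natrM ler_nat.
exact: full_cat_wt.
Qed.

Lemma lw_nil : lw [::] = ln N%:R.
Proof.
rewrite /lw; congr (ln _%:R); apply/eqP.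
by rewrite eqn_leq; have := wt_bounds p q [::]; rewrite mul1n andbC.
Qed.

Lemma glue_lo l : \sum_(x <- l) lw x <= lw (glue l).
Proof.
elim: l => [|x l IH]; first by rewrite big_nil lw_ge0.
rewrite big_cons /glue /= -catA; apply: le_trans (lw_full_cat _ _).
by rewrite lerD2l.
Qed.

Lemma glue_hi l : lw (glue l) <= \sum_(x <- l) lw x + (size l)%:R * lw W + ln N%:R.
Proof.
elim: l => [|x l IH]; first by rewrite big_nil mul0r !add0r -lw_nil.
rewrite big_cons /glue /= -/(glue l); apply: (le_trans (lw_cat_le _ p_gt0 q_gt0 _ _)).
have := @lw_cat_le R p q p_gt0 q_gt0 x W; rewrite -natr1; lra.
Qed.

(** [tilt_main] is applied to the centred log-weights of words of a fixed length [n]; its tuples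
    become long words by gluing with [W], so that log-weights add up to an error bounded per factor,
    which a large [n] absorbs. *)
Lemma block (a h del : R) (L0 : nat) : 0 <= h -> (forall t, h <= P t - a * t) ->
  0 < del -> exists n G, [/\ (L0 <= n)%N, uniq G, {subset G <= words n},
    {in G, forall s, `|lw s - a * n%:R| <= del * n%:R} &
    expR (n%:R * (h - del)) <= (size G)%:R].
Proof.
move=> h0 hP del0; pose e := Num.min del 1 / 8.
have e_gt0 : 0 < e by rewrite divr_gt0 // lt_min del0 ltr01.
have e1 : 8 * e <= 1 by rewrite /e; case: (leP del 1) => ?; lra.
have ed : 8 * e <= del by rewrite /e; case: (leP del 1) => ?; lra.
(* The penalty at the ends of the grid is then [e n T0 = 2 n], which exceeds [ln (phi 0) = n ln 2]
   by more than the error [2 e n]. *)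
clearbody e; pose T0 := 2 / e; have eT : e * T0 = 2 by rewrite /T0 mulrC divfK // gt_eqF.
have T_gt0 : 0 < T0 by rewrite divr_gt0.
clearbody T0; have [n1 Hn1] := lz_lower T_gt0 e_gt0.
set l := size W.
have [n2 Hn2] := nat_ge ((`|a| * l%:R + lw W + ln N%:R) / e).
(* [l h] pays for the length added by [W], and 1 for the factor 1/2 in [tilt_main]. *)
have [n3 Hn3] := nat_ge ((l%:R * h + 1) / e).
pose n := (maxn L0 (n1 + n2 + n3)).+1.
have nL : (L0 <= n)%N by rewrite ltnW // ltnS leq_maxl.
have nn : (n1 + n2 + n3 <= n)%N by rewrite ltnW // ltnS leq_maxr.
have nn1 : (n1 <= n)%N by apply: leq_trans nn; rewrite -addnA leq_addr.
have nn2 : n2%:R <= n%:R :> R by rewrite ler_nat; apply: leq_trans nn; rewrite addnAC leq_addl.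
have nn3 : n3%:R <= n%:R :> R by rewrite ler_nat; apply: leq_trans nn; rewrite leq_addl.
have nR : 0 < n%:R :> R by rewrite ltr0n.
move: (le_trans Hn2 nn2) (le_trans Hn3 nn3); rewrite !ler_pdivrMr // => en1 en2.
move/(_ n nn1): Hn1 => Hn; move: n nL nR en1 en2 Hn {nn nn1 nn2 nn3 Hn2 Hn3} => n nL nR en1 en2 Hn.
pose y s := lw s - a * n%:R.
have phiE t : phi (words n) y t = expR (lz n t - t * (a * n%:R)).
  rewrite expRD lnK ?posrE ?zn_gt0 // zn_expR // mulr_suml; apply: eq_bigr => s _.
  by rewrite -expRD; congr expR; rewrite /y; ring.
have X0 : words n != [::].
  by rewrite -size_eq0 size_words expn_eq0.
have ends t : - T0 <= t -> phi (words n) y 0 < phi (words n) y t * expR (e * n%:R * T0).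
  rewrite !phiE -expRD ltr_expR lz0 // mul0r subr0.
  move=> /(Hn t) => k1; have := ler_wpM2l (ltW nR) (hP t).
  have : e * n%:R * T0 = 2 * n%:R by rewrite mulrAC eT.
  have : n%:R * e * 8 <= n%:R * 1 by rewrite -mulrA ler_wpM2l // ?(ltW nR) //; lra.
  have : n%:R * ln 2 <= n%:R * 1 :> R by rewrite ler_wpM2l ?ln2_le1 // ltW.
  have : 0 <= n%:R * h by rewrite mulr_ge0 // ltW.
  lra.
have [||||||K1 HK1] := @tilt_main R _ (words n) y (\sum_(s <- words n) `|y s|) T0 (e * n%:R)
   (n%:R * (h - 2 * e)) X0.
- move=> s sn; rewrite (bigD1_seq s) ?uniq_words //= lerDl; exact: sumr_ge0.
- by [].
- by rewrite mulr_gt0.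
- by apply: ends; lra.
- exact: ends.
- move=> t tT; rewrite phiE -expRD ler_expR.
  have k1 : - T0 <= t by move: tT; rewrite ler_norml => /andP[].
  have := Hn t k1; have := ler_wpM2l (ltW nR) (hP t).
  have : 0 <= e * n%:R * `|t| by rewrite !mulr_ge0 // ltW.
  lra.
pose K := K1.+1; have KK : (K1 <= K)%N by [].
have := HK1 K KK; have K_gt0 : 1 <= K%:R :> R by rewrite ler1n.
set G2 := fun l : seq _ => _ => cardG.
have GP x : x \in [seq x <- tups (words n) K | G2 x] ->
    [/\ size x = K, all (mem (words n)) x & G2 x].
  by rewrite mem_filter => /andP[h1 /tupsP[h2 h3]].
exists (K * (n + l))%N, (map glue [seq x <- tups (words n) K | G2 x]); split.
- by apply: (leq_trans nL); rewrite (leq_trans (leq_addr l n)) // leq_pmull.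
- rewrite map_inj_in_uniq ?filter_uniq ?uniq_tups ?uniq_words //.
  by move=> x x' /GP[x1 x2 _] /GP[x3 x4 _]; apply: (@glue_inj n) => //; rewrite x1.
- by move=> s /mapP[x /GP[x1 x2 _] ->]; rewrite mem_words (size_glue x2) x1.
- move=> s /mapP[x /GP[x1 x2 x3] ->].
  have := glue_lo x; have := glue_hi x; rewrite x1.
  move: x3; rewrite /G2 /ysum /y ler_norml big_split /= big_const_seq count_predT x1 iter_addr_0.
  rewrite -mulr_natr; move: (\sum_(x0 <- x) _) (lw (glue x)) => S g.
  move=> /andP[x3 x4] x5 x6; rewrite natrM natrD ler_norml.
  have K0 : 0 <= K%:R :> R by [].
  have := ler_wpM2l K0 en1.
  have h1 : - (`|a| * l%:R) <= a * l%:R <= `|a| * l%:R.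
    by rewrite -ler_norml normrM (@ger0_norm _ l%:R).
  case/andP: h1 => h1 h2; have := ler_wpM2l K0 h1; have := ler_wpM2l K0 h2.
  have lN : 0 <= ln N%:R :> R by rewrite -lw_nil lw_ge0.
  have : 1 * ln N%:R <= K%:R * ln N%:R :> R by rewrite ler_wpM2r.
  have : K%:R * n%:R * (8 * e) <= K%:R * n%:R * del.
    by rewrite ler_wpM2l // mulr_ge0 // ltW.
  have : 0 <= K%:R * n%:R * e by rewrite !mulr_ge0 // ltW.
  have : 0 <= K%:R * l%:R * del by rewrite !mulr_ge0 // ltW.
  lra.
- rewrite size_map size_filter; apply: le_trans cardG.
  rewrite ler_pdivlMr // -[2 in X in X <= _]lnK ?posrE // -expRD ler_expR natrM natrD.
  have K0 : 0 <= K%:R :> R by [].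
  have := ler_wpM2l K0 en2.
  have := ln2_le1 R.
  have : K%:R * n%:R * (8 * e) <= K%:R * n%:R * del.
    by rewrite ler_wpM2l // mulr_ge0 // ltW.
  have : 0 <= K%:R * n%:R * e by rewrite !mulr_ge0 // ltW.
  have : 0 <= K%:R * l%:R * del by rewrite !mulr_ge0 // ltW.
  lra.
Qed.

End Block.

(** * Sets of Hausdorff measure zero *)

Section Hausdorff.
Variable R : realType.
Implicit Types (A B U : set R) (s r e : R).
Local Notation diam := (@diam R R dist1).
Local Notation diam_pow := (@diam_pow R R dist1).

Lemma diam_ge0 U : U !=set0 -> (0 <= diam U)%E.
Proof.
move=> [x Ux]; apply: ereal_sup_ubound; exists x => //; exists x => //.
by rewrite /dist1 subrr normr0.
Qed.

Lemma diam_le U r : (forall x y, U x -> U y -> `|x - y| <= r) -> (diam U <= r%:E)%E.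
Proof.
by move=> H; apply: ge_ereal_sup => _ [x Ux] [y Uy] <-; rewrite lee_fin; exact: H.
Qed.

Lemma diamP U r x y : (diam U <= r%:E)%E -> U x -> U y -> `|x - y| <= r.
Proof.
move=> H Ux Uy; rewrite -lee_fin; apply: le_trans H.
by apply: ereal_sup_ubound; exists x => //; exists y.
Qed.

Lemma diam_fin U r : (diam U <= r%:E)%E -> U !=set0 ->
  exists2 d : R, 0 <= d & diam U = d%:E.
Proof.
move=> H /diam_ge0; case E : (diam U) H => [d||] // H d0; last first.
by exists d.
Qed.

Lemma diam_pow_ge0 s U : (0 <= diam_pow s U)%E.
Proof. by rewrite /Defs.diam_pow; case: ifP => // _; exact: poweR_ge0. Qed.

Lemma diam_powE s U (d : R) : U !=set0 -> diam U = d%:E -> 0 <= d ->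
  diam_pow s U = (d `^ s)%:E.
Proof.
move=> /set0P/negbTE U0 dE d0; rewrite /Defs.diam_pow U0 dE.
by rewrite poweR_EFin.
Qed.

Lemma diam_pow_le s U r : 0 <= s -> (diam U <= r%:E)%E -> (diam_pow s U <= (r `^ s)%:E)%E.
Proof.
move=> s0 H; have [->|/set0P U0] := eqVneq U set0.
  by rewrite /Defs.diam_pow eqxx lee_fin powR_ge0.
have [d d0 dE] := diam_fin H U0.
rewrite (diam_powE s U0 dE d0) lee_fin ge0_ler_powR ?nnegrE //; last by rewrite -lee_fin -dE.
by rewrite (le_trans d0) // -lee_fin -dE.
Qed.

(** The dimension is defined through exponents of measure zero, so it suffices to handle null sets,
    with real bounds in place of extended infima and suprema. *)
Definition hnull s A := forall r e, 0 < r -> 0 < e ->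
  exists U : nat -> set R, [/\ forall i, (diam (U i) <= r%:E)%E,
    A `<=` \bigcup_i U i & (\sum_(0 <= i <oo) diam_pow s (U i) <= e%:E)%E].

Lemma hnullP s A : hausdorff_measure dist1 s A = 0%E <-> hnull s A.
Proof.
have pre0 r : (0 <= hausdorff_premeasure dist1 r s A)%E.
  apply: le_ereal_inf_tmp => _ [U _ <-]; apply: nneseries_ge0 => i _ _; exact: diam_pow_ge0.
split=> [H r e r0 e0|H].
  have : hausdorff_premeasure dist1 r s A = 0%E.
    apply/le_anti; rewrite pre0 andbT -H; apply: ereal_sup_ubound; exists r => //.
  move=> pE; have : (hausdorff_premeasure dist1 r s A < e%:E)%E by rewrite pE lte_fin.
  by move=> /ereal_inf_lt[_ [U [U1 U2] <-] /ltW U3]; exists U.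
apply/le_anti/andP; split.
  apply: ge_ereal_sup => _ [r /= r0 <-].
  apply/lee_addgt0Pr => e e0; rewrite add0e.
  have [U [U1 U2 U3]] := H r e r0 e0; apply: le_trans U3.
  by apply: ereal_inf_lbound; exists U.
apply: le_trans (pre0 1) _; apply: ereal_sup_ubound; exists 1 => //=.
Qed.

Lemma hausdorff_dim_le A s : 0 <= s -> (forall s', s < s' -> hnull s' A) ->
  (hausdorff_dim dist1 A <= s%:E)%E.
Proof.
move=> s0 H; apply/lee_addgt0Pr => e e0; apply: ereal_inf_lbound.
exists (s + e) => //; split; first by rewrite addr_ge0 // ltW.
by apply/hnullP/H; rewrite ltrDl.
Qed.

Lemma hausdorff_dim_ge A s : (forall s', 0 <= s' -> hnull s' A -> s <= s') ->
  (s%:E <= hausdorff_dim dist1 A)%E.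
Proof.
move=> H; apply: le_ereal_inf_tmp => _ [s' [s0 /hnullP Hs'] <-].
by rewrite lee_fin; exact: H.
Qed.

Lemma hnullS s A B : A `<=` B -> hnull s B -> hnull s A.
Proof.
move=> AB H r e r0 e0; have [U [U1 U2 U3]] := H r e r0 e0.
by exists U; split => //; exact: subset_trans U2.
Qed.

Lemma hnull_mono s s' A : 0 <= s -> s <= s' -> hnull s A -> hnull s' A.
Proof.
move=> s0 ss H r e r0 e0; have r1 : 0 < Num.min r 1 by rewrite lt_min r0 ltr01.
have [U [U1 U2 U3]] := H _ e r1 e0; exists U; split => //.
  by move=> i; apply: le_trans (U1 i) _; rewrite lee_fin ge_min lexx.
apply: le_trans U3; apply: lee_nneseries => i _; first by move=> _; exact: diam_pow_ge0.
have [->|/set0P U0] := eqVneq (U i) set0; first by rewrite /Defs.diam_pow eqxx.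
have [d d0 dE] := diam_fin (U1 i) U0.
rewrite !(diam_powE _ U0 dE d0) lee_fin.
have d1 : d <= 1 by rewrite -lee_fin -dE; apply: le_trans (U1 i) _; rewrite lee_fin ge_min lexx orbT.
(* Sets of diameter 0 count 1 at exponent 0 and 0 at any other exponent; if [s' = 0] then [s = 0]
   too, and the two sides agree. *)
have [d00|dn0] := eqVneq d 0; last by apply: ger_powR => //; rewrite lt_def dn0 d0 d1.
rewrite d00 /powR eqxx ler_nat; case: (eqVneq s' 0) => [s'0|] //.
by rewrite (_ : s = 0) ?eqxx //; apply/le_anti; rewrite s0 -s'0 ss.
Qed.

Lemma hnull_bigcup s A (B : nat -> set R) : A `<=` \bigcup_k B k ->
  (forall k, hnull s (B k)) -> hnull s A.
Proof.
move=> AB H r e r0 e0.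
have /choice[V HV] : forall k, exists U : nat -> set R,
  [/\ forall i, (diam (U i) <= r%:E)%E, B k `<=` \bigcup_i U i &
   (\sum_(0 <= i <oo) diam_pow s (U i) <= (e / (2 ^ k.+1)%N%:R)%:E)%E].
  by move=> k; apply: H => //; rewrite divr_gt0 // ltr0n expn_gt0.
have /card_esym/ppcard_eqP[f] := card_nat2.
exists (uncurry V \o f); split.
- by move=> i /=; case: (f i) => k j /=; have [+ _ _] := HV k; exact.
- move=> x /AB[k _ Bx]; have [_ /(_ x Bx)[j _ Vx] _] := HV k.
  by exists (f^-1%FUN (k, j)) => //=; rewrite invK ?inE.
rewrite nneseries_esumT; last by move=> n; exact: diam_pow_ge0.
rewrite -(@reindex_esum R nat _ setT setT f (fun kj => diam_pow s (uncurry V kj))); last exact: bij.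
have -> : (\esum_(kj in [set: nat * nat]) diam_pow s (uncurry V kj) =
    \esum_(k in [set: nat]) \esum_(j in [set: nat]) diam_pow s (V k j))%E.
  rewrite esum_esum; last by move=> *; exact: diam_pow_ge0.
  rewrite (_ : [set: nat] `*`` (fun=> [set: nat]) = setT); last by apply/seteqP; split.
  by apply: eq_esum => -[k j].
rewrite -nneseries_esumT; last by move=> n; apply: esum_ge0 => *; exact: diam_pow_ge0.
apply: le_trans (epsilon_trick0 xpredT (ltW e0)).
apply: lee_nneseries => k _; first by move=> _; apply: esum_ge0 => *; exact: diam_pow_ge0.
rewrite -nneseries_esumT; last by move=> n; exact: diam_pow_ge0.
by have [_ _] := HV k.
Qed.

Lemma finite_sum_nneseries (m : nat) (u : nat -> \bar R) : (forall i, (0 <= u i)%E) ->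
  (forall i, (m <= i)%N -> u i = 0%E) ->
  (\sum_(0 <= i <oo) u i = \sum_(i < m) u i)%E.
Proof.
move=> u0 um; rewrite (@nneseries_split _ _ 0 m) // add0n big_mkord.
by rewrite eseries0 ?adde0 // => i mi _; exact: um.
Qed.

Lemma hnull_finite s A : 0 <= s ->
  (forall r e, 0 < r -> 0 < e -> exists (m : nat) (I : nat -> set R) (d : R),
     [/\ d <= r, forall i, (i < m)%N -> (diam (I i) <= d%:E)%E,
      A `<=` [set x | exists2 i, (i < m)%N & I i x] & m%:R * d `^ s <= e]) ->
  hnull s A.
Proof.
move=> s0 H r e r0 e0; have [m [I [d [dr Id AI md]]]] := H r e r0 e0.
pose U i := if (i < m)%N then I i else set0; exists U; split.
- move=> i; rewrite /U; case: ifP => im; first by rewrite (le_trans (Id i im)) ?lee_fin.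
  by apply: diam_le => x y.
- by move=> x /AI[i im Ix]; exists i => //; rewrite /U im.
rewrite (@finite_sum_nneseries m).
- apply: (@le_trans _ _ (\sum_(i < m) (d `^ s)%:E)%E).
    by apply: lee_sum => i _; rewrite /U ltn_ord; apply: diam_pow_le => //; exact: Id.
  by rewrite sumEFin lee_fin sumr_const card_ord -mulr_natl.
- by move=> i; exact: diam_pow_ge0.
- by move=> i mi; rewrite /U ltnNge mi /= /Defs.diam_pow eqxx.
Qed.

Lemma hnull_lipschitz s A (f : R -> R) (K : R) : 0 <= s -> 0 < K ->
  (forall x y, A x -> A y -> `|f x - f y| <= K * `|x - y|) ->
  hnull s A -> hnull s (f @` A).
Proof.
move=> s0 K0 fK H r e r0 e0.
have Ks : 0 < K `^ s by exact: powR_gt0.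
have [||U [U1 U2 U3]] := H (r / K) (e / K `^ s); try by rewrite divr_gt0.
exists (fun i => f @` (U i `&` A)); split.
- move=> i; apply: diam_le => _ _ [x [Ux Ax] <-] [y [Uy Ay] <-].
  apply: (le_trans (fK x y Ax Ay)); rewrite mulrC -ler_pdivlMr //.
  exact: (diamP (U1 i)).
- by move=> _ [x Ax <-]; have [i _ Ux] := U2 x Ax; exists i => //; exists x.
have -> : e%:E = ((K `^ s)%:E * (e / K `^ s)%:E)%E.
  by rewrite -EFinM mulrC divfK // gt_eqF.
have Kse : (0 <= (K `^ s)%:E :> \bar R)%E by rewrite lee_fin ltW.
apply: le_trans (lee_wpmul2l Kse U3).
rewrite -nneseriesZl; last by move=> i _; exact: diam_pow_ge0.
apply: lee_nneseries => i _; first by move=> _; exact: diam_pow_ge0.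
have [->|/set0P[x Ux]] := eqVneq (U i) set0.
  by rewrite set0I image_set0 /Defs.diam_pow eqxx mule0.
have [d d0 dE] := diam_fin (U1 i) (ex_intro _ x Ux).
rewrite (diam_powE s (ex_intro _ x Ux) dE d0) -EFinM -powRM ?(ltW K0) //.
apply: diam_pow_le => //; apply: diam_le => _ _ [y [Uy Ay] <-] [z [Uz Az] <-].
apply: (le_trans (fK y z Ay Az)); rewrite ler_pM2l //.
by apply: (diamP _ Uy Uz); rewrite dE.
Qed.

(* A mass distribution principle in which the mass is the normalised counting
   measure of finer and finer finite subsets of [Y]. *)
Lemma not_hnull (Y : set R) s (C r0 : R) (n : nat -> nat) (pt : forall K, 'I_(n K) -> R) :
  compact Y -> 0 < s -> 0 < C -> 0 < r0 -> (forall K, (0 < n K)%N) ->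
  (forall K i, Y (pt K i)) ->
  (forall x r, 0 < r -> r <= r0 -> exists K0, forall K, (K0 <= K)%N ->
     #|[pred i : 'I_(n K) | `|pt K i - x| < r]|%:R <= C * r `^ s * (n K)%:R) ->
  ~ hnull s Y.
Proof.
move=> cY s0 C0 r0_gt0 n_gt0 Ypt Hpt Hnull.
(* The first bound keeps the radii below [r0], the second makes the balls carry at most half of the
   points. *)
pose e := Num.min (r0 `^ s / 2) (1 / (4 * C)).
have e0 : 0 < e by rewrite lt_min !divr_gt0 ?powR_gt0 ?mulr_gt0.
have er : 2 * e <= r0 `^ s.
  have : e <= r0 `^ s / 2 by rewrite ge_min lexx.
  lra.
have eC : C * (2 * e) <= 1 / 2.
  have : e <= 1 / (4 * C) by rewrite ge_min lexx orbT.
  by rewrite ler_pdivlMr ?mulr_gt0 //; lra.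
have [U [U1 U2 U3]] := Hnull r0 e r0_gt0 e0.
have /choice[x Hx] i : exists x, U i !=set0 -> U i x.
  by have [->|/set0P[x Ux]] := eqVneq (U i) set0; [exists 0 => -[]|exists x].
have /choice[d Hd] i : exists d : R, [/\ 0 <= d, (U i !=set0 -> diam (U i) = d%:E) & (U i = set0 -> d = 0)].
  have [U0|/set0P U0] := eqVneq (U i) set0; first by rewrite U0; exists 0; split => // -[].
  by have [d d0 dE] := diam_fin (U1 i) U0; exists d; split => // U00; case: U0 => x0; rewrite U00.
pose h i : R := e / 2 ^+ i.+1.
have h0 i : 0 < h i by rewrite divr_gt0 // exprn_gt0.
(* Radii strictly larger than the diameters, so that open balls contain the covering sets, one-point
   sets included; the sum of their [s]-th powers grows by at most [e]. *)
pose rho i := (d i `^ s + h i) `^ s^-1.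
have ds0 i : 0 < d i `^ s + h i by rewrite ltr_wpDl // powR_ge0.
have rho0 i : 0 < rho i by rewrite powR_gt0.
have rhos i : rho i `^ s = d i `^ s + h i.
  by rewrite /rho -powRrM mulVf ?gt_eqF // powRr1 // ltW.
have drho i : d i < rho i.
  have [d0 _ _] := Hd i; rewrite ltNge; apply/negP => le.
  have : rho i `^ s <= d i `^ s by rewrite ge0_ler_powR ?nnegrE // ltW.
  by rewrite rhos; have := h0 i; lra.
have dpE i : diam_pow s (U i) = (d i `^ s)%:E.
  have [d0 dE d00] := Hd i; have [U0|/set0P U0] := eqVneq (U i) set0; last first.
    exact: diam_powE (dE U0) d0.
  by rewrite U0 /Defs.diam_pow eqxx d00 ?powR0 ?gt_eqF.
have sumd m : \sum_(i < m) d i `^ s <= e.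
  rewrite -lee_fin -sumEFin; apply: le_trans U3.
  rewrite (eq_bigr (fun i : 'I_m => diam_pow s (U i))); last by move=> i _; rewrite dpE.
  rewrite -(big_mkord xpredT (fun i => diam_pow s (U i))).
  by apply: nneseries_lim_ge => i _ _; exact: diam_pow_ge0.
have sumh m : \sum_(i < m) h i = e - e / 2 ^+ m.
  elim: m => [|m IH]; first by rewrite big_ord0 expr0 divr1 subrr.
  by rewrite big_ord_recr /= IH /h exprS; field; rewrite expf_neq0.
have sumrho m : \sum_(i < m) rho i `^ s <= 2 * e.
  rewrite (eq_bigr (fun i : 'I_m => d i `^ s + h i)) // big_split /= sumh.
  have : 0 < e / 2 ^+ m by rewrite divr_gt0 // exprn_gt0.
  by have := sumd m; lra.
have rhor i : rho i <= r0.
  rewrite leNgt; apply/negP => lt.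
  have := gt0_ltr_powR s0 (x := r0) (y := rho i).
  rewrite !nnegrE !ltW // => /(_ isT isT lt).
  have := sumrho i.+1; rewrite big_ord_recr /=.
  have : 0 <= \sum_(j < i) rho j `^ s by apply: sumr_ge0 => j _; exact: powR_ge0.
  lra.
have Ycov : Y `<=` \bigcup_i (ball (x i) (rho i)).
  move=> z /U2[i _ Uz]; exists i => //; rewrite /ball /=.
  have Ui : U i !=set0 by exists z.
  have [d0 dE _] := Hd i; apply: le_lt_trans (drho i).
  by apply: (@diamP (U i)); rewrite ?dE //; exact: Hx.
have [F FY] : exists F : {fset nat},
    Y `<=` \bigcup_(i in [set` F]) ball (x i) (rho i).
  move: cY; rewrite compact_cover => /(_ nat setT (fun i => ball (x i) (rho i))).
  by case=> [i _||F _ FY]; [exact: ball_open|by []|exists F].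
pose m := (\max_(i <- F) i).+1.
(* Compactness leaves finitely many balls, so one level [K1] serves all of them; counting the points
   of that level gives the contradiction. *)
have [K1 HK1] := @eventually_forall (fun i K =>
   #|[pred j : 'I_(n K) | `|pt K j - x i| < rho i]|%:R <= C * rho i `^ s * (n K)%:R) m
   (fun i => Hpt (x i) (rho i) (rho0 i) (rhor i)).
have := HK1 K1 (leqnn _) => HK.
have nK : 0 < (n K1)%:R :> R by rewrite ltr0n.
suff : (n K1)%:R <= \sum_(i < m) C * rho i `^ s * (n K1)%:R.
  rewrite -mulr_suml -mulr_sumr -[X in X <= _]mul1r ler_pM2r //.
  have := ler_wpM2l (ltW C0) (sumrho m); lra.
apply: (@le_trans _ _ (\sum_(i < m) #|[pred j : 'I_(n K1) | `|pt K1 j - x i| < rho i]|%:R)); last first.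
  by apply: ler_sum => i _; apply: HK; rewrite ltnW.
rewrite -natr_sum ler_nat -[X in (X <= _)%N](card_ord (n K1)) -sum1_card.
under [X in (_ <= X)%N]eq_bigr do rewrite -sum1_card big_mkcond /=.
rewrite exchange_big /=; apply: leq_sum => j _.
have [i /= iF ij] := FY _ (Ypt K1 j).
have im : (i < m)%N by rewrite ltnS; apply: leq_bigmax_seq.
rewrite (bigD1 (Ordinal im)) //= inE distrC.
by move: ij; rewrite /ball /= => ->.
Qed.

End Hausdorff.

(** * Upper bound for the dimension *)

Section Upper.
Variables (R : realType) (p q : nat).
Local Notation N := (p + q)%N.
Hypothesis p_gt0 : (0 < p)%N.
Hypothesis q_gt0 : (0 < q)%N.
Hypothesis pq : coprime p q.
Local Notation P := (@pressure R p q).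
Local Notation lw := (@lw R p q).
Local Notation lz := (@lz R p q).
Local Notation rn := (rn p q).

Definition fl (n : nat) (x : R) : int := Num.floor (2 ^+ n * x).
(** The asymmetric window from [M - 2] to [M + 1] is what [cw_le] requires. *)
Definition rsum n (M : int) : nat := (rn n (M - 2) + rn n (M - 1) + rn n M + rn n (M + 1))%N.

Lemma exp2E n : 2 ^+ n = expR (n%:R * ln 2) :> R.
Proof. by rewrite expRM_natl lnK // posrE. Qed.

Lemma exp2_gt n : n%:R < 2 ^+ n :> R.
Proof. by rewrite -natrX ltr_nat ltn_expl. Qed.

(** The cells of level [n] listed in [l] cover [X], and the exponential is the [s]-th power of their
    length. *)
Lemma hnull_floor s (X : set R) : 0 < s ->
  (forall d n0, 0 < d -> exists n (l : seq int), [/\ (n0 <= n)%N,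
     forall x, X x -> fl n x \in l & (size l)%:R * expR (- (n%:R * (s * ln 2))) <= d]) ->
  hnull s X.
Proof.
move=> s0 H; apply: hnull_finite; first exact: ltW.
move=> r e r0 e0; have [n0 Hn0] := nat_ge r^-1.
have [n [l [nn Hl le]]] := H e n0 e0.
exists (size l), (fun i => `[(nth 0 l i)%:~R / 2 ^+ n, ((nth 0 l i) + 1)%:~R / 2 ^+ n]%classic), (2 ^- n).
split.
- rewrite -[r]invrK lef_pV2 ?posrE ?invr_gt0 //; apply: (le_trans Hn0).
  by apply: (@le_trans _ _ n%:R); [rewrite ler_nat|exact/ltW/exp2_gt].
- move=> i _; apply: diam_le => x y; rewrite /= !in_itv /= intrD mulrDl mul1r => /andP[x1 x2] /andP[y1 y2].
  by rewrite ler_norml; lra.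
- move=> x Xx; have /(nthP 0)[i il iE] := Hl x Xx; exists i => //=.
  rewrite in_itv /= iE ler_pdivrMr // ler_pdivlMr // mulrC.
  by rewrite /fl floor_le ltW // floorD1_gt.
- apply: le_trans le; rewrite exp2E -expRN /powR gt_eqF ?expR_gt0 // expRK.
  by rewrite (_ : s * - (n%:R * ln 2) = - (n%:R * (s * ln 2))) //; ring.
Qed.

Lemma decay (c sg d : R) (k n0 : nat) : 0 <= c -> 0 < sg -> 0 < d ->
  exists n1, forall n, (n1 <= n)%N -> c * n.+1%:R ^+ k * expR (- (n%:R * sg)) <= d.
Proof.
move=> c0 sg0 d0; pose b := sg / k.+1%:R; have b0 : 0 < b by rewrite divr_gt0 // ltr0n.
have [n1 Hn1] := nat_ge (c * 2 ^+ k / (d * b ^+ k.+1)).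
exists n1.+1 => n nn; have n_gt0 : (0 < n)%N by exact: leq_trans nn.
have bk : 0 < b ^+ k.+1 by rewrite exprn_gt0.
have E1 : (n%:R * b) ^+ k.+1 <= expR (n%:R * sg).
  rewrite (_ : n%:R * sg = k.+1%:R * (n%:R * b)); last first.
    by rewrite mulrCA /b [k.+1%:R * _]mulrC divfK // pnatr_eq0.
  have nb0 : 0 <= n%:R * b by rewrite mulr_ge0 // ltW.
  have nb1 : n%:R * b <= expR (n%:R * b) by have := expR_ge1Dx (n%:R * b); lra.
  by rewrite expRM_natl lerXn2r // ?nnegrE ?expR_ge0.
have E2 : n.+1%:R ^+ k <= 2 ^+ k * n%:R ^+ k :> R.
  rewrite -exprMn lerXn2r ?nnegrE ?mulr_ge0 //; rewrite -natrM ler_nat mul2n -addnn -addn1 leq_add2l //.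
rewrite expRN ler_pdivrMr ?expR_gt0 //.
apply: (@le_trans _ _ (d * (n%:R * b) ^+ k.+1)); last by rewrite ler_pM2l.
apply: (@le_trans _ _ (c * (2 ^+ k * n%:R ^+ k))); first by rewrite ler_wpM2l.
rewrite exprMn [n%:R ^+ k.+1]exprS.
have : c * 2 ^+ k <= n%:R * (d * b ^+ k.+1).
  rewrite -ler_pdivrMr ?mulr_gt0 //; apply: (le_trans Hn1).
  by rewrite ler_nat ltnW.
have nk : 0 <= n%:R ^+ k :> R by rewrite exprn_ge0.
by move=> /(ler_wpM2r nk); lra.
Qed.

Lemma lz_upper t e : 0 < e -> exists n1, forall n, (n1 <= n)%N -> lz n t <= n%:R * (P t + e).
Proof.
move=> e0; have /cvgrPdist_le/(_ e e0)[n1 _ Hn1] := @pressure_cvg R p q p_gt0 q_gt0 t.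
exists n1.+1 => n nn; have n0 : (0 < n)%N by exact: leq_trans nn.
have nR : 0 < n%:R :> R by rewrite ltr0n.
have := Hn1 n (ltnW nn); rewrite ler_norml => /andP[h _].
by rewrite mulrC -ler_pdivrMr // mulrC; lra.
Qed.

Lemma fl_range n (x : R) : 0 <= x -> x < N%:R -> exists2 M : nat, fl n x = M%:Z & (M < 2 ^ n * N)%N.
Proof.
move=> x0 xN; have : 0 <= fl n x by rewrite floor_ge0 mulr_ge0 // exprn_ge0.
case E : (fl n x) => [M|//] _; exists M => //.
rewrite -(ltr_nat R) natrM natrX -[M%:R]/((Posz M)%:~R) -E.
by apply: le_lt_trans (floor_le _) _; rewrite ltr_pM2l // exprn_gt0.
Qed.

Lemma fl_word n (x : R) : 0 <= x -> x < N%:R ->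
  exists (i : 'I_N) (s : seq bool), size s = n /\ fl n x = (2 ^ n * i + bin s)%N%:Z.
Proof.
move=> x0 xN; have [M ME MN] := fl_range n x0 xN.
have iN : (M %/ 2 ^ n < N)%N by rewrite ltn_divLR ?expn_gt0 // mulnC.
have [s ss sM] := @words_binP n (M %% 2 ^ n) (ltn_pmod _ (expn_gt0 2 n)).
exists (Ordinal iN), s; split => //; rewrite ME sM; congr Posz.
by rewrite /= mulnC -divn_eq.
Qed.

Lemma fl_prefix n m (x : R) (M : nat) : fl n x = M%:Z ->
  exists s, size s = m /\ fl (n + m) x = (2 ^ m * M + bin s)%N%:Z.
Proof.
move=> E; have := floor_itv (2 ^+ n * x); rewrite -/(fl n x) E => /andP[h1 h2].
have l1 : (2 ^ m * M)%N%:Z <= fl (n + m) x.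
  by rewrite floor_ge_int exprD -mulrA mulrCA -pmulrn natrM natrX ler_pM2l //.
have l2 : fl (n + m) x < (2 ^ m * M.+1)%N%:Z.
  rewrite floor_lt_int exprD -mulrA mulrCA -pmulrn natrM natrX ltr_pM2l //.
  by move: h2; rewrite (_ : M%:Z + 1 = M.+1%:Z) -?pmulrn //; lia.
case F : (fl (n + m) x) l1 l2 => [M'|] l1 l2; last by lia.
have [|s ss sM] := @words_binP m (M' - 2 ^ m * M); first by lia.
by exists s; split=> //; rewrite sM; congr Posz; lia.
Qed.

Lemma rn_word (i : 'I_N) s : rn (size s) (2 ^ size s * i + bin s)%N%:Z = cnt p q s i%:Z.
Proof. by rewrite cnt_rn; congr (rn _ _); rewrite PoszD PoszM. Qed.

Lemma rn_supp n M : rn n M != 0%N -> 0 <= M < (2 ^ n * N)%N%:Z.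
Proof.
elim: n M => [|n IH] M /=; first by rewrite mul1n eqb0 negbK.
have d0 : 0 <= (2 ^ n)%N%:Z * q%:Z by [].
have dq : (2 ^ n)%N%:Z * q%:Z <= (2 ^ n * N)%N%:Z by rewrite -PoszM lez_nat leq_mul2l leq_addl orbT.
rewrite expnS -mulnA -PoszM in d0 dq *.
rewrite -!lt0n !addn_gt0 !lt0n => /orP[/orP[]|] /IH; lia.
Qed.

Lemma rn_supp_word n M : rn n M != 0%N ->
  exists (i : 'I_N) (s : seq bool), size s = n /\ M = (2 ^ n * i + bin s)%N%:Z.
Proof.
move=> /rn_supp; case: M => // M; rewrite /= ltz_nat => MN.
have iN : (M %/ 2 ^ n < N)%N by rewrite ltn_divLR ?expn_gt0 // mulnC.
have [s ss sM] := @words_binP n (M %% 2 ^ n) (ltn_pmod _ (expn_gt0 2 n)).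
exists (Ordinal iN), s; split => //; rewrite sM; congr Posz.
by rewrite /= mulnC -divn_eq.
Qed.

(* The multiplicity of the cell of [x] grows like [expR (n a)]; it may vanish,
   so that the lower bound involves the neighbouring cells. *)
Definition Xup (a : R) := [set x : R | 0 <= x <= N%:R /\ forall e, 0 < e -> exists n0,
  forall n, (n0 <= n)%N -> (rn n (fl n x))%:R <= expR (n%:R * (a + e)) /\
     expR (n%:R * (a - e)) <= (rsum n (fl n x))%:R].

Definition Xpos (b : R) n0 := [set x : R | forall n, (n0 <= n)%N ->
     expR (n%:R * b) <= (rsum n (fl n x))%:R].

Lemma count_wt_ge n t (B : R) : 0 <= t -> 0 < B ->
  (count (fun s => B <= (wt p q s)%:R) (words n))%:R <= expR (lz n t) * B `^ (- t).
Proof.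
move=> t0 B0; rewrite lnK ?posrE ?zn_gt0 // powRN ler_pdivlMr ?powR_gt0 //.
rewrite -sum1_count natr_sum mulr_suml big_mkcond /=; apply: ler_sum => s _.
case: ifP => Bs; last exact: powR_ge0.
by rewrite mul1r ge0_ler_powR ?nnegrE // ltW.
Qed.

(** Markov's inequality for [t]-th powers of weights bounds the number of words of large weight, and
    a row sum is at most the weight. *)
Lemma hnull_Xpos (b : R) n0 t s : 0 <= t -> 0 < s -> P t - t * b < s * ln 2 ->
  hnull s (Xpos b n0).
Proof.
move=> t0 s0 Hs; apply: hnull_floor => // d n1 d0.
pose g := (s * ln 2 - (P t - t * b)) / 2; have g0 : 0 < g by rewrite divr_gt0 // subr_gt0.
have [n2 Hn2] := lz_upper t g0.
have [n3 Hn3] := @decay (4 * N%:R * 4 `^ t) g d 0 0 (mulr_ge0 (mulr_ge0 (ler0n _ _) (ler0n _ _)) (powR_ge0 _ _)) g0 d0.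
have [n [nn0 nn1 nn2 nn3]] : exists n, [/\ (n0 <= n)%N, (n1 <= n)%N, (n2 <= n)%N & (n3 <= n)%N].
  by exists (n0 + n1 + n2 + n3)%N; split; lia.
(* One of the four cells in [rsum] carries at least a quarter of it; the list [l] undoes the four
   possible shifts. *)
pose B := expR (n%:R * b) / 4; have B0 : 0 < B by rewrite divr_gt0 ?expR_gt0.
pose L := [seq s <- words n | B <= (wt p q s)%:R].
pose l := [seq (2 ^ n * z.1 + bin z.2)%N%:Z + e | z <- [seq (i : nat, s) | i <- iota 0 N, s <- L],
   e <- [:: -1; 0; 1; 2]].
exists n, l; split => //.
- move=> x /(_ n nn0); set M := fl n x => HM.
  suff [e eP] : exists2 e, e \in [:: -1; 0; 1; 2 : int] & B <= (rn n (M - e))%:R.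
    move=> HB; have [|i [w [wn ME]]] := @rn_supp_word n (M - e).
      by rewrite -lt0n -(ltr_nat R); exact: lt_le_trans HB.
    apply/allpairsP; exists ((i : nat, w), e); split => //=; last first.
      by rewrite -ME subrK.
    apply/allpairsP; exists (i : nat, w); split => //=.
      by rewrite mem_iota /= add0n.
    rewrite mem_filter mem_words wn eqxx andbT; apply: (le_trans HB).
    rewrite ler_nat ME -wn rn_word; apply: leq_trans (cnt_le_wt p q w _) _.
    by rewrite cnt_ltN muln1.
  move: HM; rewrite /rsum !natrD => HM.
  have [h1|h1] := leP B (rn n (M - 2))%:R; first by exists 2.
  have [h2|h2] := leP B (rn n (M - 1))%:R; first by exists 1.
  have [h3|h3] := leP B (rn n (M - 0))%:R; first by exists 0.
  have [h4|h4] := leP B (rn n (M - (-1)))%:R; first by exists (-1).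
  move: h3 h4; rewrite subr0 opprK => h3 h4; move: h1 h2 h3 h4 HM; rewrite /B; clear -R; move=> *; exfalso; lra.
- rewrite size_allpairs size_allpairs size_iota /= size_filter.
  have := count_wt_ge n t0 B0; set c := count _ _ => Hc.
  apply: le_trans (Hn3 n nn3); rewrite expr0 mulr1 !natrM.
  have Bt : B `^ (- t) = 4 `^ t * expR (- (n%:R * (t * b))).
    rewrite /B powRM ?expR_ge0 ?invr_ge0 // mulrC -powR_inv1 // -powRrM mulN1r opprK.
    by congr (_ * _); rewrite /powR gt_eqF ?expR_gt0 // expRK; congr expR; ring.
  rewrite Bt in Hc; have lE := Hn2 n nn2; rewrite -ler_expR in lE.
  have : N%:R * c%:R * 4 <= N%:R * (expR (n%:R * (P t + g)) * (4 `^ t * expR (- (n%:R * (t * b))))) * 4.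
    rewrite ler_pM2r // ler_wpM2l //; apply: (le_trans Hc).
    by rewrite ler_wpM2r // mulr_ge0 ?powR_ge0 ?expR_ge0.
  move=> H; apply: (@le_trans _ _ _ _ _ (ler_wpM2r (expR_ge0 _) H)).
  apply: (@le_trans _ _ (4 * N%:R * 4 `^ t * (expR (n%:R * (P t + g)) *
     expR (- (n%:R * (t * b))) * expR (- (n%:R * (s * ln 2)))))).
    by rewrite le_eqVlt; apply/orP; left; apply/eqP; ring.
  rewrite ler_wpM2l ?mulr_ge0 ?powR_ge0 // -!expRD ler_expR.
  by rewrite /g le_eqVlt; apply/orP; left; apply/eqP; field.
Qed.

Definition Xneg (b : R) n0 := [set x : R | 0 <= x <= N%:R /\ forall n, (n0 <= n)%N ->
     (rn n (fl n x))%:R <= expR (n%:R * b)].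

Lemma hnull_point (z s : R) : 0 < s -> hnull s [set z].
Proof.
move=> s0; apply: hnull_floor => // d n0 d0.
have sl : 0 < s * ln 2 by rewrite mulr_gt0 // ln2_gt0.
have [n1 Hn1] := @decay 1 (s * ln 2) d 0 0 ler01 sl d0.
exists (n0 + n1)%N, [:: fl (n0 + n1)%N z]; split; first exact: leq_addr.
  by move=> x ->; rewrite inE.
by have := Hn1 _ (leq_addl n0 n1); rewrite expr0 mulr1.
Qed.

Definition Xbad := [set x : R | (0 <= x /\ x < N%:R) /\ forall (i : 'I_N) w,
  fl (size w) x = (2 ^ size w * i + bin w)%N%:Z -> ~~ rowfull p q w i%:Z].

(** At each level these points lie in cells of words that are not full, and polynomial growth loses
    against every exponential. *)
Lemma hnull_Xbad s : 0 < s -> hnull s Xbad.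
Proof.
move=> s0; apply: hnull_floor => // d n0 d0.
have sl : 0 < s * ln 2 by rewrite mulr_gt0 // ln2_gt0.
have NN : 0 <= N%:R * N%:R :> R by rewrite mulr_ge0.
have [n1 Hn1] := @decay (N%:R * N%:R) (s * ln 2) d N 0 NN sl d0.
pose n := (n0 + n1)%N.
pose L := [seq w <- words n | [exists i : 'I_N, ~~ rowfull p q w i%:Z]].
exists n, [seq (2 ^ n * i + bin w)%N%:Z | i <- iota 0 N, w <- L]; split; first exact: leq_addr.
- move=> x [[x0 xN] Hx]; have [i [w [wn wE]]] := fl_word n x0 xN.
  apply/allpairsP; exists (i : nat, w); split => //=.
    by rewrite mem_iota /= add0n.
  rewrite mem_filter mem_words wn eqxx andbT; apply/existsP; exists i.
  by apply: Hx; rewrite wn.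
- have := Hn1 n (leq_addl _ _); apply: le_trans.
  rewrite ler_wpM2r ?expR_ge0 // size_allpairs size_iota size_filter.
  rewrite -mulrA -natrX -!natrM ler_nat leq_mul2l; apply/orP; right.
  exact: nonfull_le.
Qed.

(** Behind a prefix with a positive row the multiplicity is at least the weight of the remaining
    word [v], by [rowfull_cat]. A small multiplicity thus forces a small weight, and such [v] are
    counted by Markov's inequality with [t <= 0]. *)
Lemma hnull_Xneg_prefix (i : 'I_N) w (b : R) n0 t s : rowfull p q w i%:Z -> t <= 0 -> 0 < s ->
  P t - t * b < s * ln 2 ->
  hnull s (Xneg b n0 `&` [set x | fl (size w) x = (2 ^ size w * i + bin w)%N%:Z]).
Proof.
move=> wf t0 s0 Hs; apply: hnull_floor => // d n1 d0.
pose g := (s * ln 2 - (P t - t * b)) / 2; have g0 : 0 < g by rewrite divr_gt0 // subr_gt0.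
have [n2 Hn2] := lz_upper t g0.
set k := size w.
have [n3 Hn3] := @decay (expR (- (k%:R * (P t + g)))) g d 0 0 (expR_ge0 _) g0 d0.
have [m [mn0 mn1 mn2 mn3]] : exists m, [/\ (n0 <= m)%N, (n1 <= m)%N, (n2 <= m)%N & (n3 <= m)%N].
  by exists (n0 + n1 + n2 + n3)%N; split; lia.
have le_n r : (r <= m -> r <= k + m)%N by move=> /leq_trans; apply; exact: leq_addl.
pose B : R := expR ((k + m)%N%:R * b).
pose L := [seq v <- words m | (wt p q v)%:R <= B].
exists (k + m)%N, [seq (2 ^ m * (2 ^ k * i + bin w) + bin v)%N%:Z | v <- L]; split.
- exact: le_n.
- move=> x [[/andP[x0 xN] Hx] /= wE]; have [v [vm vE]] := fl_prefix m wE.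
  apply/mapP; exists v => //; rewrite mem_filter mem_words vm eqxx andbT.
  apply: le_trans (Hx _ (le_n _ mn0)); rewrite ler_nat vE.
  have -> : (2 ^ m * (2 ^ k * i + bin w) + bin v = 2 ^ size (w ++ v) * i + bin (w ++ v))%N.
    by rewrite size_cat vm bin_cat vm expnD -/k; ring.
  by rewrite (_ : (k + m)%N = size (w ++ v)) ?rn_word ?rowfull_cat // size_cat vm.
- rewrite size_map size_filter.
  have Hc : (count (fun v => (wt p q v)%:R <= B) (words m))%:R <= expR (lz m t) * expR (- (t * ((k + m)%N%:R * b))).
    rewrite expRN ler_pdivlMr ?expR_gt0 // lnK ?posrE ?zn_gt0 // zn_expR //.
    rewrite -sum1_count natr_sum mulr_suml big_mkcond /=; apply: ler_sum => v _.
    case: ifP => Bv; last exact: expR_ge0.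
    rewrite mul1r ler_expR ler_wnM2l // -ler_expR expR_lw //.
  apply: le_trans (Hn3 _ (le_n _ mn3)); rewrite expr0 mulr1.
  apply: (@le_trans _ _ _ _ _ (ler_wpM2r (expR_ge0 _) Hc)).
  rewrite -!expRD ler_expR; have := Hn2 m mn2; rewrite /g natrD => lE.
  lra.
Qed.

Lemma hnull_Xneg (b : R) n0 t s : t <= 0 -> 0 < s -> P t - t * b < s * ln 2 ->
  hnull s (Xneg b n0).
Proof.
move=> t0 s0 Hs.
(* A countable union: the exceptional points, the right end [N], which lies in no cell of a row
   below [N], and one set per pair of a row and a prefix, enumerated by [pickle]. *)
pose B k := match k with 0%N => Xbad | 1%N => [set N%:R] | k'.+2 =>
  if @choice.unpickle ('I_N * seq bool)%type k' is Some (i, w) then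
    if rowfull p q w i%:Z then
      Xneg b n0 `&` [set x | fl (size w) x = (2 ^ size w * i + bin w)%N%:Z] else set0
  else set0 end.
have null0 : hnull s (set0 : set R).
  by apply: (hnullS _ (hnull_point 0 s0)) => x.
apply: (@hnull_bigcup _ s _ B).
- move=> x Xx; have [/andP[x0 xN] Hx] := Xx.
  have [->|xN'] := eqVneq x N%:R; first by exists 1%N.
  have xltN : x < N%:R by rewrite lt_neqAle xN' xN.
  have [[i [w [wf wE]]]|none] := pselect (exists (i : 'I_N) w, rowfull p q w i%:Z /\
     fl (size w) x = (2 ^ size w * i + bin w)%N%:Z).
    by exists (choice.pickle (i, w)).+2 => //=; rewrite choice.pickleK wf.
  exists 0%N => //=; split=> // i w wE; apply/negP => wf; apply: none.
  by exists i, w.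
- move=> [|[|k]] /=; [exact: hnull_Xbad|exact: hnull_point|].
  case: choice.unpickle => [[i w]|//]; case: ifP => // wf.
  exact: hnull_Xneg_prefix Hs.
Qed.

Lemma hnull_Xup (a t s : R) : 0 < s -> P t - t * a < s * ln 2 -> hnull s (Xup a).
Proof.
move=> s0 Hs; pose g := s * ln 2 - (P t - t * a); have g0 : 0 < g by rewrite subr_gt0.
(* Replacing [a] by [a - e] or [a + e] then costs less than the gap [g]. *)
pose e := g / (2 * (`|t| + 1)).
have e0 : 0 < e by rewrite divr_gt0 // mulr_gt0.
have te : `|t| * e < g.
  rewrite /e mulrA ltr_pdivrMr ?mulr_gt0 // [_ * g]mulrC ltr_pM2l //; have := normr_ge0 t; lra.
have [t0|t0] := leP 0 t.
  apply: (@hnull_bigcup _ s _ (Xpos (a - e))) => [x [_ /(_ e e0)[n0 Hn0]]|n0].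
    by exists n0 => // n nn; have [] := Hn0 n nn.
  apply: (hnull_Xpos _ t0) => //; move: te; rewrite ger0_norm // /g; lra.
apply: (@hnull_bigcup _ s _ (Xneg (a + e))) => [x [xN /(_ e e0)[n0 Hn0]]|n0].
  by exists n0 => //; split=> // n nn; have [] := Hn0 n nn.
apply: (hnull_Xneg _ (ltW t0)) => //; move: te; rewrite ltr0_norm // /g; lra.
Qed.

End Upper.

(** * Lower bound for the dimension *)

Lemma int_near (z M : int) : M - 2 < z -> z < M + 2 -> M - 1 <= z <= M + 1.
Proof. lia. Qed.

(** * Slowly growing stage lengths and averages *)

Section Slow.
Variables (bn : nat -> nat).

(* Advances the index [j] only once [bn j.+1] has become negligible. *)
Fixpoint slow (k : nat) : nat :=
  if k is k'.+1 then
    if (bn (slow k').+1 * (slow k').+1 <= k)%N then (slow k').+1 else slow k'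
  else 0%N.

(** Since at least [k] letters precede stage [k], its length is a vanishing fraction of what
    precedes. *)
Lemma slow_le k : (bn (slow k) * slow k <= k)%N.
Proof. by elim: k => [|k IH] /=; [rewrite muln0|case: ifP => // _; rewrite ltnW]. Qed.

Lemma slow_leS k : (slow k <= slow k.+1)%N.
Proof. by rewrite /=; case: ifP. Qed.

Lemma slow_mono k k' : (k <= k' -> slow k <= slow k')%N.
Proof.
by apply: (homo_leq (r := leq)) => // [? ? ?|i]; [exact: leq_trans|exact: slow_leS].
Qed.

Lemma slow_unbounded J : exists k, (J <= slow k)%N.
Proof.
elim: J => [|J [k Jk]]; first by exists 0%N.
have [|h] := leqP J.+1 (slow k); first by exists k.
have E : slow k = J by apply/eqP; rewrite eqn_leq Jk andbT -ltnS.
pose k' := (k + bn J.+1 * J.+1)%N; exists k'.+1.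
have [h'|h'] := leqP J.+1 (slow k'); first exact: leq_trans (slow_leS k').
have E' : slow k' = J.
  by apply/eqP; rewrite eqn_leq -ltnS h' -E slow_mono // leq_addr.
by rewrite /= E' ifT // /k' -addnS addnC leqW // leq_addr.
Qed.

End Slow.

Section Cesaro.
Variables (R : realType) (m : nat -> nat).
Hypothesis m_gt0 : forall k, (0 < m k)%N.

Definition tot k : nat := (\sum_(i < k) m i)%N.

Lemma tot_ge k : (k <= tot k)%N.
Proof.
rewrite /tot -[X in (X <= _)%N](card_ord k) -sum1_card; apply: leq_sum => i _; exact: m_gt0.
Qed.

Lemma totS k : tot k.+1 = (tot k + m k)%N.
Proof. by rewrite /tot big_ord_recr. Qed.

Lemma cesaro (b : nat -> R) :
  (forall e, 0 < e -> exists k0, forall k, (k0 <= k)%N -> b k <= e * (m k)%:R) ->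
  forall e, 0 < e -> exists k0, forall k, (k0 <= k)%N -> \sum_(i < k) b i <= e * (tot k)%:R.
Proof.
move=> H e e0; have [k1 Hk1] := H (e / 2) (divr_gt0 e0 (ltr0n R 2)).
pose C := \sum_(i < k1) `|b i|.
have B k : \sum_(i < k) b i <= C + e / 2 * (tot k)%:R.
  rewrite /tot natr_sum mulr_sumr.
  have [kk|kk] := leqP k1 k; last first.
    have -> : C = \sum_(i < k) `|b i| + \sum_(k <= i < k1) `|b i|.
      by rewrite /C -!(big_mkord xpredT (fun i => `|b i|)) -big_cat_nat //= ltnW.
    have h1 : \sum_(i < k) b i <= \sum_(i < k) `|b i|.
      by apply: ler_sum => i _; exact: ler_norm.
    have h2 : 0 <= \sum_(k <= i < k1) `|b i| by exact: sumr_ge0.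
    have h3 : 0 <= \sum_(i < k) e / 2 * (m i)%:R.
      by apply: sumr_ge0 => i _; rewrite mulr_ge0 // divr_ge0 // ltW.
    lra.
  rewrite -!(big_mkord xpredT b) -(big_mkord xpredT (fun i => e / 2 * (m i)%:R)).
  rewrite (@big_cat_nat _ _ _ k1) //= [X in _ <= _ + X](@big_cat_nat _ _ _ k1) //= addrA.
  apply: lerD; last first.
    rewrite !big_nat; apply: ler_sum => i /andP[ki _]; exact: Hk1.
  rewrite /C big_mkord; have h1 : \sum_(i < k1) b i <= \sum_(i < k1) `|b i|.
    by apply: ler_sum => i _; exact: ler_norm.
  have h3 : 0 <= \sum_(0 <= i < k1) e / 2 * (m i)%:R.
    by apply: sumr_ge0 => i _; rewrite mulr_ge0 // divr_ge0 // ltW.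
  lra.
have [k2 Hk2] := nat_ge (2 * C / e); exists k2 => k kk; apply: (le_trans (B k)).
have : k2%:R <= (tot k)%:R :> R by rewrite ler_nat (leq_trans kk) // tot_ge.
move=> /(le_trans Hk2); rewrite ler_pdivrMr //; lra.
Qed.

End Cesaro.

(** * The Moran set: growth of multiplicities and dimension *)

Section Moran.
Variables (R : realType) (p q : nat).
Local Notation N := (p + q)%N.
Hypothesis p_gt0 : (0 < p)%N.
Hypothesis q_gt0 : (0 < q)%N.
Hypothesis pq : coprime p q.
Local Notation P := (@pressure R p q).
Local Notation lw := (@lw R p q).
Local Notation rn := (rn p q).
Local Notation cnt := (cnt p q).

(* A strong form of [Xup a], in which the bounds trade places. *)
Definition Xlow (a : R) := [set x : R | 0 <= x <= N%:R /\ forall e, 0 < e -> exists n0,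
  forall n, (n0 <= n)%N -> expR (n%:R * (a - e)) <= (rn n (fl n x))%:R /\
     (rsum p q n (fl n x))%:R <= expR (n%:R * (a + e))].

Variable W0 : seq bool.
Local Notation W := (W0 ++ [:: true; false]).
Hypothesis Wfull : full p q W.
Local Notation l := (size W).

(** The digits 1, 0 inside the word keep its value at distance 2 from both ends of the range, enough
    for the window of [rsum] to stay inside the cell of any prefix that precedes [g]. *)
Lemma bin_W g t : (2 <= bin (g ++ W ++ t) /\ (bin (g ++ W ++ t)).+2 <= 2 ^ size (g ++ W ++ t))%N.
Proof.
rewrite !bin_cat !size_cat !expnD (_ : bin [:: true; false] = 2)%N // (_ : 2 ^ size [:: true; false] = 4)%N //.
have := bin_lt g; have := bin_lt W0; have := bin_lt t.
move: (bin g) (bin W0) (bin t) => bg b0 bt.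
have : (0 < 2 ^ size t)%N by rewrite expn_gt0.
have : (0 < 2 ^ size W0)%N by rewrite expn_gt0.
have : (0 < 2 ^ size g)%N by rewrite expn_gt0.
move: (2 ^ size g)%N (2 ^ size W0)%N (2 ^ size t)%N => x y z x0 y0 z0 h1 h2 h3.
split; first by nia.
have e2 : ((b0 * 4 + 2) * z + bt + 2 <= y * 4 * z)%N by nia.
nia.
Qed.

Lemma rsum_le n (X r L C : nat) : (2 <= r)%N -> (r.+2 <= L)%N ->
  (forall r', r' < L -> rn n (X + r')%N%:Z <= C)%N ->
  (rsum p q n (X + r)%N%:Z <= 4 * C)%N.
Proof.
move=> r2 rL H; rewrite /rsum.
have -> : (X + r)%N%:Z - 2 = (X + (r - 2))%N%:Z by lia.
have -> : (X + r)%N%:Z - 1 = (X + (r - 1))%N%:Z by lia.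
have -> : (X + r)%N%:Z + 1 = (X + (r + 1))%N%:Z by lia.
have h1 : (r - 2 < L)%N by lia.
have h2 : (r - 1 < L)%N by lia.
have h3 : (r < L)%N by lia.
have h4 : (r + 1 < L)%N by lia.
by have := H _ h1; have := H _ h2; have := H _ h3; have := H _ h4; lia.
Qed.

(* [m k], [G k]: length and list of the words used at the k-th stage. *)
Variables (m : nat -> nat) (G : nat -> seq (seq bool)).
Hypothesis m_gt0 : forall k, (0 < m k)%N.
Hypothesis G_uniq : forall k, uniq (G k).
Hypothesis G_words : forall k, {subset G k <= words (m k)}.
Hypothesis G_neq0 : forall k, (0 < size (G k))%N.

Definition lam k := (l + \sum_(i < k) (m i + l))%N.

(** Starting with [W] makes row 0 alone comparable to the weight; so all cells can be taken in row
    0, inside [[0, 1]]. *)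
Fixpoint lev (k : nat) : seq (seq bool) :=
  if k is k'.+1 then [seq s ++ (g ++ W) | s <- lev k', g <- G k'] else [:: W].

Lemma lamS k : lam k.+1 = (lam k + (m k + l))%N.
Proof. by rewrite /lam big_ord_recr /= addnA. Qed.

Lemma lam_mono k k' : (k <= k' -> lam k <= lam k')%N.
Proof.
by apply: (homo_leq (r := leq)) => // [? ? ?|i]; [exact: leq_trans|rewrite lamS leq_addr].
Qed.

Lemma lam_ge k : (k <= lam k)%N.
Proof.
elim: k => // k IH; rewrite lamS -addn1; apply: leq_add => //.
exact: leq_trans (m_gt0 k) (leq_addr _ _).
Qed.

Lemma lev_size k s : s \in lev k -> size s = lam k.
Proof.
elim: k s => [|k IH] s /=; first by rewrite inE => /eqP ->; rewrite /lam big_ord0 addn0.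
move=> /allpairsP[[s' g] /= [/IH ss /G_words + ->]]; rewrite mem_words => /eqP gm.
by rewrite lamS !size_cat ss gm.
Qed.

Lemma lev_uniq k : uniq (lev k).
Proof.
elim: k => //= k IH; apply: allpairs_uniq => // -[s g] [s' g'].
move=> /allpairsP[[u v] /= [uk vk [-> ->]]] /allpairsP[[u' v'] /= [uk' vk' [-> ->]]] /eqP.
rewrite eqseq_cat ?(lev_size uk) ?(lev_size uk') // => /andP[/eqP-> ].
rewrite eqseq_cat; first by move=> /andP[/eqP->].
by have := G_words vk; have := G_words vk'; rewrite !mem_words => /eqP-> /eqP->.
Qed.

Lemma lev_prefix k k' s : (k <= k')%N -> s \in lev k' -> exists2 t, take (lam k) s \in lev k & s = take (lam k) s ++ t.
Proof.
elim: k' s => [|k' IH] s.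
  by rewrite leqn0 => /eqP-> sk; exists [::]; rewrite ?cats0 take_oversize // (lev_size sk).
rewrite leq_eqVlt ltnS => /orP[/eqP-> sk|kk /=].
  by exists [::]; rewrite ?cats0 take_oversize // (lev_size sk).
move=> /allpairsP[[u g] /= [uk gk ->]]; have [t tk tE] := IH u kk uk.
have lu : (lam k <= size u)%N by rewrite (lev_size uk) lam_mono.
by rewrite takel_cat //; exists (t ++ (g ++ W)) => //; rewrite {1}tE -catA.
Qed.

Definition cell (s : seq bool) := `[(bin s)%:R / 2 ^+ size s, (bin s).+1%:R / 2 ^+ size s]%classic : set R.

Definition Ymoran : set R := \bigcap_k \big[setU/set0]_(s <- lev k) cell s.

Lemma cellP s x : cell s x <-> (bin s)%:R <= 2 ^+ size s * x <= (bin s).+1%:R.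
Proof.
by rewrite /cell /= in_itv /= ler_pdivrMr // ler_pdivlMr // ![_ * x]mulrC.
Qed.

Lemma cell_cat s t : cell (s ++ t) `<=` cell s.
Proof.
move=> x /cellP; rewrite bin_cat size_cat exprD => /andP[h1 h2]; apply/cellP.
have p2 : 0 < 2 ^+ size t :> R by rewrite exprn_gt0.
have bt : (bin t)%:R + 1 <= 2 ^+ size t :> R by rewrite -natrX natr1 ler_nat bin_lt.
have b0 : 0 <= (bin t)%:R :> R by [].
move: h1 h2; rewrite -[(bin s).+1%:R]natr1 -[(_ + bin t).+1%:R]natr1 natrD natrM natrX.
move: (2 ^+ size t) (2 ^+ size s) p2 bt => T S p2 bt h1 h2.
by apply/andP; split; rewrite -(ler_pM2l p2); lra.
Qed.

Lemma YP x : Ymoran x <-> forall k, exists2 s, s \in lev k & cell s x.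
Proof.
split=> [Yx k|H k _].
  by have := Yx k I; rewrite -bigcup_seq => -[s sk sx]; exists s.
by rewrite -bigcup_seq; have [s sk sx] := H k; exists s.
Qed.

Lemma compact_Y : compact Ymoran.
Proof.
apply: (subclosed_compact _ (@segment_compact R 0 1)).
  apply: closed_bigI => k _; rewrite -bigcup_seq.
  by apply: closed_bigcup => [|s _]; [exact: finite_seq|exact: itv_closed].
move=> x /YP/(_ 0%N)[s _ /cellP/andP[h1 h2]]; rewrite /= in_itv /=.
have p2 : 0 < 2 ^+ size s :> R by rewrite exprn_gt0.
rewrite -(pmulr_rge0 _ p2) (le_trans _ h1) // -(ler_pM2l p2) mulr1 (le_trans h2) //.
by rewrite -natrX ler_nat bin_lt.
Qed.

(** The cells are closed, for compactness, and may share end points; the next block contains [W],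
    which by [bin_W] keeps [x] off the ends, so the floor is exact. *)
Lemma Y_fl x k : Ymoran x -> exists2 s, s \in lev k & fl (lam k) x = (bin s)%:Z.
Proof.
move=> /YP/(_ k.+1)[_ /= /allpairsP[[s g] /= [sk gk ->]] /cellP xs].
exists s => //; apply: floor_def; rewrite intrD -!pmulrn -(lev_size sk).
have [h3 h4] := bin_W g [::]; rewrite cats0 in h3 h4.
have {}h3 : 2 <= (bin (g ++ W))%:R :> R by rewrite ler_nat.
have {}h4 : (bin (g ++ W))%:R + 1 + 1 <= 2 ^+ size (g ++ W) :> R.
  by rewrite -natrX !natr1 ler_nat.
move: xs h3 h4; rewrite bin_cat [size (s ++ _)]size_cat exprD.
rewrite -[(_ + bin (g ++ W)).+1%:R]natr1 natrD natrM natrX.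
have p2 : 0 < 2 ^+ size (g ++ W) :> R by rewrite exprn_gt0.
move: (2 ^+ size (g ++ W)) (2 ^+ size s) p2 => T S p2 /andP[h1 h2] h3 h4.
by apply/andP; split; [rewrite -(ler_pM2l p2)|rewrite -(ltr_pM2l p2)]; lra.
Qed.

(** Extending always by the first available block gives nested cells; the supremum of their left
    ends lies in all of them. *)
Lemma cell_point k s : s \in lev k -> exists2 x, Ymoran x & cell s x.
Proof.
move=> sk; pose sq := fix f i := if i is j.+1 then f j ++ (head [::] (G (k + j)%N) ++ W) else s.
have sqk i : sq i \in lev (k + i)%N.
  elim: i => [|i IH]; first by rewrite addn0.
  rewrite addnS /=; apply/allpairsP; exists (sq i, head [::] (G (k + i)%N)); split=> //=.
  by have := G_neq0 (k + i); case: (G _) => //= g ? _; rewrite inE eqxx.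
pose L i : R := (bin (sq i))%:R / 2 ^+ size (sq i).
have cellL i : cell (sq i) (L i).
  by rewrite /cell /L /= in_itv /= lexx ler_pM2r ?invr_gt0 // ler_nat leqnSn.
have nested i j : (i <= j)%N -> cell (sq j) `<=` cell (sq i).
  elim: j => [|j IH]; first by rewrite leqn0 => /eqP->.
  rewrite leq_eqVlt ltnS => /orP[/eqP->//|/IH h] x /cell_cat; exact: h.
have LU i j : L j <= (bin (sq i)).+1%:R / 2 ^+ size (sq i).
  have [ij|ij] := leqP i j.
    by have := nested i j ij _ (cellL j); rewrite /cell /= in_itv /= => /andP[].
  have := nested j i (ltnW ij) _ (cellL i); rewrite {1}/cell /= in_itv /= => /andP[h _].
  by apply: (le_trans h); have := cellL i; rewrite /cell /= in_itv /= => /andP[].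
pose A := range L.
have Aub : has_ubound A by exists ((bin (sq 0%N)).+1%:R / 2 ^+ size (sq 0%N)) => _ [j _ <-].
have A0 : A !=set0 by exists (L 0%N), 0%N.
have cellx i : cell (sq i) (sup A).
  rewrite /cell /= in_itv /=; apply/andP; split; first by apply: ub_le_sup => //; exists i.
  by apply: ge_sup => // _ [j _ <-].
exists (sup A); last exact: (cellx 0%N).
apply/YP => K; have [kK|Kk] := leqP k K.
  by exists (sq (K - k)%N); rewrite // -{2}(subnKC kK).
have [t tk tE] := lev_prefix (ltnW Kk) sk; exists (take (lam K) s) => //.
by apply: (@cell_cat _ t); rewrite -tE; exact: (cellx 0%N).
Qed.

Lemma count_allpairs (Q : pred (seq bool)) (Q' : pred (seq bool)) (A : seq (seq bool))
    (B : seq (seq bool)) : (forall u g, u \in A -> Q (u ++ (g ++ W)) = Q' u) ->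
  count Q [seq u ++ (g ++ W) | u <- A, g <- B] = (count Q' A * size B)%N.
Proof.
elim: A => //= u A IH H; rewrite count_cat IH; last first.
  by move=> v g vA; apply: H; rewrite inE vA orbT.
rewrite mulnDl; congr (_ + _)%N; rewrite count_map.
rewrite (eq_count (a2 := fun=> Q' u)); last by move=> g /=; rewrite H // inE eqxx.
by case: (Q' u); rewrite ?count_predT ?mul1n ?count_pred0.
Qed.

Lemma size_levS k : size (lev k.+1) = (size (lev k) * size (G k))%N.
Proof. by rewrite /= size_allpairs. Qed.

(** All words of level [k] have equally many descendants, so proportions at level [k] persist at
    level [K]. *)
Lemma count_lev (Q : pred (seq bool)) k K : (k <= K)%N ->
  (count (fun s => Q (take (lam k) s)) (lev K) * size (lev k) = count Q (lev k) * size (lev K))%N.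
Proof.
elim: K => [|K IH].
  rewrite leqn0 => /eqP ->; congr (_ * _)%N; apply: eq_in_count => s /lev_size sk.
  by rewrite take_oversize // sk.
rewrite leq_eqVlt ltnS => /orP[/eqP<-|kK].
  congr (_ * _)%N; apply: eq_in_count => s /lev_size sk.
  by rewrite take_oversize // sk.
rewrite size_levS mulnA -IH //= (@count_allpairs _ (fun s => Q (take (lam k) s))); first by rewrite mulnAC.
by move=> u g uK; rewrite takel_cat // (lev_size uK) lam_mono.
Qed.

Lemma count_near k (M : int) :
  (count (fun s => (M - 1 <= (bin s)%:Z <= M + 1)%R) (lev k) <= 3)%N.
Proof.
rewrite -size_filter -(size_map (fun s => (bin s)%:Z)).
apply: (@uniq_leq_size _ _ [:: M - 1; M; M + 1]).
  rewrite map_inj_in_uniq ?filter_uniq ?lev_uniq // => s t.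
  rewrite !mem_filter => /andP[_ /lev_size ss] /andP[_ /lev_size st] [/bin_inj]; apply.
  by rewrite ss st.
move=> z /mapP[s]; rewrite mem_filter => /andP[+ _] ->; rewrite !inE; lia.
Qed.

Variables (a h : R) (dl : nat -> R).
Hypothesis dl_to0 : forall e, 0 < e -> exists k0, forall k, (k0 <= k)%N -> dl k <= e.
Hypothesis m_large : forall B : R, exists k0, forall k, (k0 <= k)%N -> B <= (m k)%:R.
Hypothesis m_slow : forall e, 0 < e -> exists k0, forall k, (k0 <= k)%N -> (m k)%:R <= e * (tot m k)%:R :> R.
Hypothesis G_lw : forall k, {in G k, forall g, `|lw g - a * (m k)%:R| <= dl k * (m k)%:R}.
Hypothesis G_size : forall k, expR ((m k)%:R * (h - dl k)) <= (size (G k))%:R :> R.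

Let D k := \sum_(i < k) dl i * (m i)%:R.

Lemma D_small e : 0 < e -> exists k0, forall k, (k0 <= k)%N -> D k <= e * (tot m k)%:R.
Proof.
move=> e0; apply: (@cesaro R m m_gt0 (fun i => dl i * (m i)%:R) _ e e0) => e' e0'.
have [k0 Hk0] := dl_to0 e0'.
by exists k0 => k kk; rewrite ler_wpM2r // Hk0.
Qed.

Lemma lin_small (B C e : R) : 0 < e -> exists k0, forall k, (k0 <= k)%N ->
  k%:R * B + C <= e * (tot m k)%:R.
Proof.
move=> e0; have [|k1 Hk1] := @cesaro R m m_gt0 (fun=> `|B| + `|C|) _ e e0.
  move=> e' e0'; have [k0 H] := m_large ((`|B| + `|C|) / e').
  by exists k0 => k kk; rewrite mulrC -ler_pdivrMr //; exact: H.
exists k1.+1 => k kk; apply: le_trans (Hk1 k (ltnW kk)).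
rewrite sumr_const card_ord -[(_ + _) *+ _]mulr_natl mulrDr lerD //.
  by rewrite ler_wpM2l // ler_norm.
apply: (le_trans (ler_norm C)); rewrite -[X in X <= _]mul1r ler_wpM2r // ler1n.
exact: leq_trans kk.
Qed.

Lemma lamE k : lam k = (l + tot m k + k * l)%N.
Proof. by rewrite /lam /tot big_split /= sum_nat_const card_ord addnA. Qed.

(** [m_slow] makes one further stage negligible and [m_large] the copies of [W]; hence consecutive
    stages have comparable length and scales between them can be interpolated. *)
Lemma lam_small e : 0 < e -> exists k0, forall k, (k0 <= k)%N ->
  (lam k.+1)%:R <= (1 + e) * (tot m k)%:R :> R.
Proof.
move=> e0; have e2 : 0 < e / 2 by rewrite divr_gt0.
have [k1 H1] := m_slow e2; have [k2 H2] := lin_small l%:R (2 * l%:R) e2.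
exists (k1 + k2)%N => k kk.
have := H1 k (leq_trans (leq_addr _ _) kk); have := H2 k (leq_trans (leq_addl _ _) kk).
rewrite lamE mulSn totS !natrD natrM; lra.
Qed.

Lemma size_lev_ge k : expR (h * (tot m k)%:R - D k) <= (size (lev k))%:R.
Proof.
elim: k => [|k IH]; first by rewrite /D /tot !big_ord0 mulr0 subrr expR0.
rewrite size_levS natrM; have := ler_pM (expR_ge0 _) (expR_ge0 _) IH (G_size k).
rewrite -expRD; apply: le_trans; rewrite ler_expR /D totS big_ord_recr /= natrD; lra.
Qed.

(** The continuation [v] in the lower bound is what lets the induction insert the next block: [W]
    must stand between two words for their weights to multiply. *)
Lemma lev_weight k s : s \in lev k -> exists t, [/\ s = W ++ t,
  forall v, expR (a * (tot m k)%:R - D k) * (wt p q v)%:R <= (wt p q (t ++ v))%:R &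
  (wt p q t)%:R <= expR (a * (tot m k)%:R + D k + k%:R * lw W + ln N%:R)].
Proof.
have N0 : 0 < N%:R :> R by rewrite ltr0n addn_gt0 p_gt0.
elim: k s => [|k IH] s /=.
  rewrite inE => /eqP ->; exists [::]; rewrite /D /tot !big_ord0 mulr0 subrr addr0 mul0r !add0r.
  split; [by rewrite cats0|by move=> v; rewrite expR0 mul1r|].
  rewrite lnK ?posrE // ler_nat; have := wt_bounds p q [::]; by rewrite mul1n => /andP[].
move=> /allpairsP[[u g] /= [/IH[t [-> lo hi]] gG ->]].
have := G_lw gG; rewrite ler_norml => /andP[g1 g2].
exists (t ++ (g ++ W)); split; first by rewrite -!catA.
- move=> v; have -> : (t ++ g ++ W) ++ v = t ++ (g ++ (W ++ v)) by rewrite !catA.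
  apply: le_trans (lo _).
  have : (wt p q g * wt p q v)%N%:R <= (wt p q (g ++ W ++ v))%:R :> R.
    by rewrite ler_nat full_cat_wt.
  move=> /(ler_wpM2l (expR_ge0 (a * (tot m k)%:R - D k))); apply: le_trans.
  rewrite natrM mulrA ler_wpM2r // -[(wt p q g)%:R](expR_lw R p_gt0 q_gt0) -expRD ler_expR.
  rewrite /D totS big_ord_recr /= natrD; lra.
- have : (wt p q (t ++ (g ++ W)))%:R <= (wt p q t)%:R * ((wt p q g)%:R * (wt p q W)%:R) :> R.
    rewrite -!natrM ler_nat; apply: leq_trans (wt_cat_le _ _ _ _) _.
    by rewrite leq_mul2l wt_cat_le orbT.
  move=> h1; apply: (le_trans h1).
  rewrite -[(wt p q g)%:R](expR_lw R p_gt0 q_gt0) -[(wt p q W)%:R](expR_lw R p_gt0 q_gt0) -expRD.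
  apply: (@le_trans _ _ _ _ _ (ler_wpM2r (expR_ge0 _) hi)).
  rewrite -expRD ler_expR /D totS big_ord_recr /= natrD -natr1; lra.
Qed.

Lemma lev_cnt k s : s \in lev k ->
  expR (a * (tot m k)%:R - D k) <= (cnt s 0)%:R /\
  (cnt s 0)%:R <= expR (a * (tot m k)%:R + D k + k%:R * lw W + (ln N%:R + lw W)).
Proof.
move=> /lev_weight[t [-> lo hi]].
have N0 : (0 < N)%N by rewrite addn_gt0 p_gt0.
split.
  have := lo [::]; rewrite cats0 => h1.
  apply: (@le_trans _ _ (wt p q t)%:R).
    by apply: le_trans h1; rewrite ler_peMr ?expR_ge0 // ler1n wt_gt0.
  by rewrite ler_nat; apply: rowfull_cat; exact: (forallP Wfull (Ordinal N0)).
apply: (@le_trans _ _ ((wt p q t)%:R * (wt p q W)%:R)).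
  rewrite -natrM ler_nat; apply: leq_trans (cnt_le_wt p q _ _) _.
  by rewrite (cnt_ltN (Ordinal N0)) muln1 mulnC wt_cat_le.
rewrite -[(wt p q W)%:R](expR_lw R p_gt0 q_gt0).
apply: (@le_trans _ _ _ _ _ (ler_wpM2r (expR_ge0 _) hi)).
by rewrite -expRD ler_expR; lra.
Qed.

Lemma lam_index n k0 : (lam k0 <= n)%N -> exists k, [/\ (k0 <= k)%N, (lam k <= n)%N & (n < lam k.+1)%N].
Proof.
move=> kn; have ex : exists k, (n < lam k)%N by exists n.+1; exact: lam_ge.
case: (ex_minnP ex) => k nk kmin; have k0k : (k0 < k)%N.
  by rewrite ltnNge; apply/negP => /lam_mono h1; move: nk; rewrite ltnNge (leq_trans h1).
case: k nk kmin k0k => // k nk kmin k0k; exists k; split => //.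
by rewrite leqNgt; apply/negP => /kmin; rewrite ltnn.
Qed.

Lemma rn_prefix s (r : nat) len : (r < 2 ^ len)%N ->
  (rn (size s + len) (bin s * 2 ^ len + r)%N%:Z <= 2 ^ len * cnt s 0)%N.
Proof.
move=> rlen; have [t tl <-] := words_binP rlen.
have N0 : (0 < N)%N by rewrite addn_gt0 p_gt0.
have := @rn_word p q (Ordinal N0) (s ++ t); rewrite /= muln0 add0n size_cat bin_cat tl => ->.
by have := cnt_cat_bounds p q s t 0; rewrite tl => /andP[].
Qed.

Lemma rn_cnt s : rn (size s) (bin s)%:Z = cnt s 0.
Proof.
have N0 : (0 < N)%N by rewrite addn_gt0 p_gt0.
by have := @rn_word p q (Ordinal N0) s; rewrite /= muln0 add0n.
Qed.

Lemma Y_low : Ymoran `<=` Xlow a.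
Proof.
move=> x Yx; have N0 : (0 < N)%N by rewrite addn_gt0 p_gt0.
split.
  move: (Yx) => /YP/(_ 0%N)[s _ /cellP/andP[h1 h2]].
  have p2 : 0 < 2 ^+ size s :> R by rewrite exprn_gt0.
  apply/andP; split; first by rewrite -(pmulr_rge0 _ p2) (le_trans _ h1).
  apply: (@le_trans _ _ 1); last by rewrite ler1n.
  by rewrite -(ler_pM2l p2) mulr1 (le_trans h2) // -natrX ler_nat bin_lt.
(* [3 |a|] accounts for the relative difference [3 e] between [n] and [tot m k]. The 5 is 1 for
   [D k], 1 for the copies of [W] and the constants, and 3 for the digits after level [k]. *)
move=> e0 e0_gt0; pose e := Num.min 1 (e0 / (3 * `|a| + 5)).
have e_gt0 : 0 < e by rewrite lt_min ltr01 divr_gt0.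
have e1 : e <= 1 by rewrite ge_min lexx.
have ee : (3 * `|a| + 5) * e <= e0.
  by rewrite mulrC -ler_pdivlMr // ge_min lexx orbT.
move: e e_gt0 e1 ee => e e_gt0 e1 ee.
have [k1 H1] := D_small e_gt0.
have [k2 H2] := lin_small (lw W) (ln N%:R + lw W + ln 4) e_gt0.
have [k3 H3] := lam_small e_gt0.
pose k0 := (k1 + k2 + k3)%N.
exists (lam k0.+1) => n /lam_index[k [k0k kn nk]].
case: k k0k kn nk => // k; rewrite ltnS => k0k kn nk.
have kk1 : (k1 <= k)%N by rewrite (leq_trans _ k0k) // /k0 -addnA leq_addr.
have kk2 : (k2 <= k)%N by rewrite (leq_trans _ k0k) // /k0 addnAC leq_addl.
have kk3 : (k3 <= k)%N by rewrite (leq_trans _ k0k) // /k0 leq_addl.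
have [s sK sE] := @Y_fl x k.+1 Yx.
have [t tl tE] : exists2 t, size t = (n - lam k.+1)%N & fl n x = (bin (s ++ t))%:Z.
  have [t [tl]] := fl_prefix p_gt0 q_gt0 pq (n - lam k.+1)%N sE; rewrite subnKC // => tE.
  by exists t; rewrite // tE bin_cat tl mulnC.
have stn : size (s ++ t) = n by rewrite size_cat (lev_size sK) tl subnKC.
have Tn k' : (lam k' <= n)%N -> (tot m k')%:R <= n%:R :> R.
  move=> h1; rewrite ler_nat (leq_trans _ h1) // lamE.
  by rewrite -addnA addnCA leq_addr.
have T0 k' : 0 <= (tot m k')%:R :> R by [].
have absE (z : R) : - (`|a| * `|z|) <= a * z <= `|a| * `|z|.
  by rewrite -ler_norml normrM.
have tlow (T nn : R) : 0 <= T -> T <= nn -> nn <= (1 + 3 * e) * T ->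
    nn * (a - e0) <= (a - e) * T /\ (a + 5 * e) * T <= nn * (a + e0).
  move=> T_0 Tnn nT; have nT0 : 0 <= nn - T by lra.
  have nT1 : nn - T <= 3 * e * T by lra.
  have : 0 <= nn * e0 - T * e0 by rewrite -mulrBl mulr_ge0 // ltW.
  have := absE (nn - T); rewrite (ger0_norm nT0) => /andP[h1 h2].
  have := ler_wpM2l (normr_ge0 a) nT1; have := ler_wpM2r T_0 ee.
  have : 0 <= e * T by rewrite mulr_ge0 // ltW.
  by split; lra.
have Tk := Tn k (leq_trans (lam_mono (leqnSn k)) kn).
have TK := Tn k.+1 kn.
have nK : n%:R <= (1 + e) * (tot m k.+1)%:R :> R.
  by apply: le_trans (H3 _ (leqW kk3)); rewrite ler_nat ltnW.
have Kk : (tot m k.+1)%:R <= (1 + e) * (tot m k)%:R :> R.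
  apply: le_trans (H3 _ kk3); rewrite ler_nat lamE.
  by rewrite -addnA addnCA leq_addr.
have eT z : 0 <= z -> 0 <= e * z by move=> z0; rewrite mulr_ge0 // ltW.
have nk3 : n%:R <= (1 + 3 * e) * (tot m k)%:R :> R.
  apply: (le_trans nK).
  have e1' : 0 <= 1 + e by lra.
  have := ler_wpM2l e1' Kk; have := ler_wpM2r (eT _ (T0 k)) e1; lra.
split.
  (* Lower bound: row sums never decrease when letters are appended. *)
  have [lo _] := lev_cnt sK.
  apply: (@le_trans _ _ (cnt s 0)%:R); last first.
    rewrite ler_nat tE -stn rn_cnt.
    by have /andP[] := cnt_cat_bounds p q s t 0.
  apply: le_trans lo; rewrite ler_expR.
  have nK3 : n%:R <= (1 + 3 * e) * (tot m k.+1)%:R by have := eT _ (T0 k.+1); lra.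
  have [h1 _] := tlow _ _ (T0 _) TK nK3.
  have := H1 _ (leqW kk1); lra.
(* Upper bound: one stage further back, at [u], the block [g ++ W] separates [u] from level [n], so
   all four cells of [rsum] extend [u]. The [len] later digits cost at most [2 ^ len], with [len]
   small compared to [n]. *)
move: sK => /allpairsP[[u g] /= [uk gk sug]].
pose len := (n - lam k)%N.
have lamkn : (lam k <= n)%N by exact: leq_trans (lam_mono (leqnSn k)) kn.
have stE : s ++ t = u ++ (g ++ (W ++ t)) by rewrite sug !catA.
have lenE : size (g ++ (W ++ t)) = len.
  by have := stn; rewrite stE size_cat (lev_size uk) /len => <-; rewrite addKn.
have binE : bin (s ++ t) = (bin u * 2 ^ len + bin (g ++ W ++ t))%N.
  by rewrite stE bin_cat lenE.
have [r2 rl] := bin_W g t.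
rewrite lenE in rl; move: (bin _) r2 rl binE => r r2 rl binE.
have un : (size u + len)%N = n by rewrite (lev_size uk) subnKC.
have rnle r' : (r' < 2 ^ len)%N -> (rn n (bin u * 2 ^ len + r')%N%:Z <= 2 ^ len * cnt u 0)%N.
  by move=> /(rn_prefix u); rewrite un.
have rs : (rsum p q n (fl n x) <= 4 * (2 ^ len * cnt u 0))%N.
  by rewrite tE binE; apply: (rsum_le (L := (2 ^ len)%N)).
have [_ hi] := lev_cnt uk.
apply: (@le_trans _ _ (4 * (2 ^+ len * (cnt u 0)%:R))).
  by rewrite -natrX -!natrM ler_nat.
have four : 4 = expR (ln 4) :> R by rewrite lnK // posrE.
rewrite {1}four exp2E.
apply: (@le_trans _ _ (expR (ln 4) * (expR (len%:R * ln 2) * expR (a * (tot m k)%:R + D k + k%:R * lw W + (ln N%:R + lw W))))).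
  by rewrite ler_wpM2l ?expR_ge0 // ler_wpM2l ?expR_ge0.
rewrite -!expRD ler_expR.
have [_ h1] := tlow _ _ (T0 _) Tk nk3; apply: le_trans h1.
have := H1 _ kk1; have := H2 _ kk2.
have lenle : len%:R <= 3 * e * (tot m k)%:R :> R.
  rewrite /len natrB //; have : (tot m k)%:R <= (lam k)%:R :> R.
    by rewrite ler_nat lamE -addnA addnCA leq_addr.
  lra.
have : len%:R * ln 2 <= len%:R * 1 :> R by rewrite ler_wpM2l // ln2_le1.
lra.
Qed.

(** One point of [Ymoran] is chosen in each cell of level [K]. A ball of radius between the cell
    lengths of levels [k] and [k + 1] meets at most three cells of level [k], whence the constant 3
    in [not_hnull]. *)
Lemma Y_dim s : 0 < s -> s * ln 2 < h -> ~ hnull s Ymoran.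
Proof.
move=> s0 sh; have [k0 Hk0] : exists k0, forall k, (k0 <= k)%N ->
    expR (s * ln 2 * (lam k.+1)%:R) <= (size (lev k))%:R.
  have sl : 0 < s * ln 2 by rewrite mulr_gt0 // ln2_gt0.
  (* The solution of [h - e = s ln 2 (1 + e)]: it balances the loss in the number of words against
     the gain in length up to the next stage. *)
  pose e := (h - s * ln 2) / (1 + s * ln 2).
  have e0 : 0 < e by rewrite divr_gt0 ?subr_gt0 // addr_gt0.
  have eE : e * (1 + s * ln 2) = h - s * ln 2 by rewrite /e divfK // gt_eqF // addr_gt0.
  have [k1 H1] := D_small e0; have [k2 H2] := lam_small e0.
  exists (k1 + k2)%N => k kk; apply: le_trans (size_lev_ge k); rewrite ler_expR.
  have := H1 k (leq_trans (leq_addr _ _) kk).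
  have := ler_wpM2l (ltW sl) (H2 k (leq_trans (leq_addl _ _) kk)).
  have : e * (1 + s * ln 2) * (tot m k)%:R = (h - s * ln 2) * (tot m k)%:R by rewrite eE.
  lra.
have /choice[y Hy] : forall ks : nat * seq bool, exists x, ks.2 \in lev ks.1 -> Ymoran x /\ cell ks.2 x.
  move=> [k w]; have [wk|wk] := boolP (w \in lev k); last by exists 0.
  by have [x Yx cx] := cell_point wk; exists x.
have lev_gt0 k : (0 < size (lev k))%N.
  by elim: k => // k IH; rewrite size_levS muln_gt0 IH G_neq0.
pose r0 : R := 2 ^- lam k0.
apply: (@not_hnull R Ymoran s 3 r0 (fun k => size (lev k)) (fun k i => y (k, nth [::] (lev k) i))) => //.
- exact: compact_Y.
- by rewrite invr_gt0 exprn_gt0.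
- by move=> K i; have [] := Hy (K, nth [::] (lev K) i) (mem_nth _ (ltn_ord i)).
move=> x r r_gt0 rr0.
have [n1 Hn1] := nat_ge r^-1.
have ex : exists k, 2 ^- lam k < r.
  exists n1; rewrite -[r]invrK ltf_pV2 ?posrE ?invr_gt0 ?exprn_gt0 //.
  apply: (le_lt_trans Hn1); apply: le_lt_trans (exp2_gt _ _).
  by rewrite ler_nat lam_ge.
case: (ex_minnP ex) => k rk kmin.
have k0k : (k0 < k)%N.
  rewrite ltnNge; apply/negP => /lam_mono h1; move: rk; apply/negP; rewrite -leNgt.
  apply: (le_trans rr0); rewrite /r0 lef_pV2 ?posrE ?exprn_gt0 // ler_weXn2l //.
  by rewrite ler1n.
case: k rk kmin k0k => // k rk kmin k0k.
have rk' : r <= 2 ^- lam k by rewrite leNgt; apply/negP => /kmin; rewrite ltnn.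
exists k => K kK.
pose M := fl (lam k) x.
pose Q (w : seq bool) := M - 1 <= (bin w)%:Z <= M + 1.
have near i : `|y (K, nth [::] (lev K) i) - x| < r -> (i < size (lev K))%N -> Q (take (lam k) (nth [::] (lev K) i)).
  move=> yr iK; set w := nth _ _ _ in yr *; have wK : w \in lev K by exact: mem_nth.
  have [_ cw] := Hy (K, w) wK; have [t tk tE] := lev_prefix kK wK.
  move: cw; rewrite /= {1}tE => /cell_cat/cellP; rewrite (lev_size tk).
  set z := y _ in yr *; set u := take _ _ => /andP[u1 u2].
  have p2 : 0 < 2 ^+ lam k :> R by rewrite exprn_gt0.
  have : `|2 ^+ lam k * z - 2 ^+ lam k * x| < 1.
    rewrite -mulrBr normrM (gtr0_norm p2) mulrC -ltr_pdivlMr // mul1r.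
    exact: lt_le_trans rk'.
  rewrite ltr_norml => /andP[d1 d2].
  have /andP[f1 f2] := floor_itv (2 ^+ lam k * x); rewrite -/(fl (lam k) x) -/M intrD in f1 f2.
  have b1 : M%:~R - 2 < ((bin u)%:Z)%:~R :> R.
    by rewrite -pmulrn; move: u2; rewrite -natr1; lra.
  have b2 : ((bin u)%:Z)%:~R < M%:~R + 2 :> R by rewrite -pmulrn; lra.
  rewrite -[2]/((2 : int)%:~R) -intrB ltr_int in b1.
  rewrite -[2]/((2 : int)%:~R) -intrD ltr_int in b2.
  exact: int_near.
have cardle : (#|[pred i : 'I_(size (lev K)) | (`|y (K, nth [::] (lev K) i) - x| < r)%R]|
    <= count (fun w => Q (take (lam k) w)) (lev K))%N.
  rewrite -sum1_card -sum1_count (big_nth [::]) big_mkord.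
  rewrite big_mkcond [X in (_ <= X)%N]big_mkcond /=; apply: leq_sum => i _.
  by rewrite inE; case: ifP => // hi; rewrite near.
have := count_lev Q kK; have := count_near k M; rewrite -/Q.
set c := count (fun w => Q (take (lam k) w)) (lev K) in cardle *.
move=> c3 cE.
have nk0 : 0 < (size (lev k))%:R :> R by rewrite ltr0n.
have cle : c%:R * (size (lev k))%:R <= 3 * (size (lev K))%:R :> R.
  by rewrite -!natrM ler_nat cE leq_mul2r c3 orbT.
have rs : 1 <= (size (lev k))%:R * r `^ s.
  have lamr : expR (- (s * ln 2 * (lam k.+1)%:R)) <= r `^ s.
    rewrite (_ : expR _ = (2 ^- lam k.+1) `^ s); last first.
      rewrite exp2E -expRN /powR gt_eqF ?expR_gt0 // expRK; congr expR; ring.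
    by rewrite ge0_ler_powR ?nnegrE ?invr_ge0 ?exprn_ge0 ?(ltW s0) ?(ltW r_gt0) ?(ltW rk).
  have := ler_pM (expR_ge0 _) (expR_ge0 _) (Hk0 k _) lamr.
  by rewrite -expRD subrr expR0; apply.
have cR : #|[pred i : 'I_(size (lev K)) | (`|y (K, nth [::] (lev K) i) - x| < r)%R]|%:R <= c%:R :> R.
  by rewrite ler_nat.
apply: (le_trans cR); rewrite -(ler_pM2r nk0); apply: (le_trans cle).
have K0 : 0 <= 3 * (size (lev K))%:R :> R by rewrite mulr_ge0.
have := ler_wpM2l K0 rs; lra.
Qed.

End Moran.

Section LowerSet.
Variables (R : realType) (p q : nat).
Hypothesis p_gt0 : (0 < p)%N.
Hypothesis q_gt0 : (0 < q)%N.
Hypothesis pq : coprime p q.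

Lemma lower_set (a h : R) : 0 <= h -> (forall t, h <= pressure p q t - a * t) ->
  exists2 Y : set R, Y `<=` Xlow p q a & forall s, 0 <= s -> hnull s Y -> h <= s * ln 2.
Proof.
move=> h0 hP; have l2 := ln2_gt0 R.
have [h_eq0|h_neq0] := eqVneq h 0.
  by exists set0 => [x //|s s0 _]; rewrite h_eq0 mulr_ge0 // ltW.
have [W0 Wf] := exists_full p_gt0 q_gt0 pq.
have /choice[bl Hbl] : forall j : nat, exists nG : nat * seq (seq bool),
   [/\ (j < nG.1)%N, uniq nG.2, {subset nG.2 <= words nG.1},
    {in nG.2, forall s, `|lw R p q s - a * nG.1%:R| <= j.+1%:R^-1 * nG.1%:R} &
    expR (nG.1%:R * (h - j.+1%:R^-1)) <= (size nG.2)%:R].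
  move=> j; have d0 : 0 < j.+1%:R^-1 :> R by rewrite invr_gt0.
  by have [n [G HG]] := block p_gt0 q_gt0 Wf j.+1 h0 hP d0; exists (n, G).
pose bn j := (bl j).1; pose jj := slow bn.
pose m k := bn (jj k); pose G k := (bl (jj k)).2; pose dl k : R := (jj k).+1%:R^-1.
have jj_ge J : exists k0, forall k, (k0 <= k)%N -> (J <= jj k)%N.
  have [k0 Hk0] := slow_unbounded bn J; exists k0 => k kk.
  exact: leq_trans (slow_mono _ kk).
have m_gt k : (jj k < m k)%N by have [] := Hbl (jj k).
have m_gt0 k : (0 < m k)%N by exact: leq_trans (m_gt k).
have G_uniq k : uniq (G k) by have [] := Hbl (jj k).
have G_words k : {subset G k <= words (m k)} by have [] := Hbl (jj k).
have G_size k : expR ((m k)%:R * (h - dl k)) <= (size (G k))%:R by have [] := Hbl (jj k).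
have G_neq0 k : (0 < size (G k))%N.
  by rewrite -(ltr_nat R); exact: lt_le_trans (expR_gt0 _) (G_size k).
have dl_to0 e : 0 < e -> exists k0, forall k, (k0 <= k)%N -> dl k <= e.
  move=> e0; have [J HJ] := nat_ge e^-1; have [k0 Hk0] := jj_ge J; exists k0 => k kk.
  rewrite /dl -[e]invrK lef_pV2 ?posrE ?invr_gt0 //; apply: (le_trans HJ).
  by rewrite ler_nat leqW // Hk0.
have m_large (B : R) : exists k0, forall k, (k0 <= k)%N -> B <= (m k)%:R.
  have [J HJ] := nat_ge B; have [k0 Hk0] := jj_ge J; exists k0 => k kk.
  by apply: (le_trans HJ); rewrite ler_nat (leq_trans (Hk0 k kk)) // ltnW.
have m_slow e : 0 < e -> exists k0, forall k, (k0 <= k)%N -> (m k)%:R <= e * (tot m k)%:R :> R.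
  move=> e0; have [J HJ] := nat_ge e^-1; have [k0 Hk0] := jj_ge J; exists k0 => k kk.
  rewrite -ler_pdivrMl //; apply: (@le_trans _ _ (m k * jj k)%N%:R); last first.
    by rewrite ler_nat (leq_trans (slow_le bn k)) // tot_ge.
  rewrite natrM mulrC ler_wpM2l //; apply: (le_trans HJ).
  by rewrite ler_nat Hk0.
have G_lw k : {in G k, forall g, `|lw R p q g - a * (m k)%:R| <= dl k * (m k)%:R}.
  by have [] := Hbl (jj k).
exists (@Ymoran R W0 G).
  exact: (Y_low p_gt0 q_gt0 pq Wf m_gt0 G_words dl_to0 m_large m_slow G_lw).
move=> s s0 Hs; rewrite leNgt; apply/negP => sh.
(* [Y_dim] wants a positive exponent, while [s] may be 0. *)
pose s' := (s + h / ln 2) / 2.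
have sl : s < h / ln 2 by rewrite ltr_pdivlMr.
have s'0 : 0 < s' by rewrite /s'; lra.
have ss' : s <= s' by rewrite /s'; lra.
have s'h : s' * ln 2 < h by rewrite -ltr_pdivlMr // /s'; lra.
have := Y_dim p_gt0 q_gt0 pq Wf m_gt0 G_uniq G_words G_neq0 dl_to0 m_large m_slow G_size s'0 s'h.
by apply; exact: hnull_mono Hs.
Qed.

End LowerSet.

(** * Slices of the gasket *)

Section Counts.
Variables (R : realType) (p q : nat).
Local Notation N := (p + q)%N.
Hypothesis p_gt0 : (0 < p)%N.
Hypothesis q_gt0 : (0 < q)%N.
Local Notation rn := (rn p q).

(* Number of level-[n] triangles met by the slice, resp. by its neighbourhood
   of relative width 1. *)
Fixpoint cn (n : nat) (x : R) : nat :=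
  if n is m.+1 then (cn m (2 * x) + cn m (2 * x - q%:R) + cn m (2 * x - N%:R))%N
  else nat_of_bool (0 <= x <= N%:R)%R.

Fixpoint cw (n : nat) (x : R) : nat :=
  if n is m.+1 then (cw m (2 * x) + cw m (2 * x - q%:R) + cw m (2 * x - N%:R))%N
  else nat_of_bool (- 1 <= x <= N%:R + 1)%R.

Lemma flB n (x : R) (d : nat) : fl n (2 * x - d%:R) = fl n.+1 x - (2 ^ n)%N%:Z * d%:Z :> int.
Proof.
have E : 2 ^+ n * (2 * x - d%:R) = 2 ^+ n.+1 * x + (- (2 ^ n * d)%N%:Z)%:~R.
  by rewrite intrN -pmulrn natrM natrX exprS; ring.
by rewrite /fl E floorDrz ?intr_int // intrKfloor PoszM.
Qed.

Lemma fl2 n (x : R) : fl n (2 * x) = fl n.+1 x.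
Proof. by rewrite -[2 * x]subr0 (flB n x 0) mulr0 subr0. Qed.

Lemma inb_int (z : int) : inb p q z = (0 <= z < N%:Z)%R. Proof. by []. Qed.

Lemma rn_le_cn n x : (rn n (fl n x) <= cn n x)%N.
Proof.
elim: n x => [|n IH] x /=; last first.
  by rewrite -(flB n x q) -(flB n x N) -fl2 !leq_add.
rewrite /fl expr0 mul1r inb_int floor_ge0.
case: (0 <= x) => //=; case: ltP => //; rewrite floor_lt_int -pmulrn => h.
by rewrite (ltW h).
Qed.

(** At level 0 the floor of [x] lies in [[-1, N + 1]], and one of the shifts by -2, -1, 0, 1 brings
    it into [[0, N)]. Above that, [cw] and each shifted [rn] obey the same recursion. *)
Lemma cw_le n x : (cw n x <= rsum p q n (fl n x))%N.
Proof.
rewrite /rsum; elim: n x => [|n IH] x /=.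
  rewrite /fl expr0 mul1r !inb_int; case: (boolP (-1 <= x <= N%:R + 1)) => // /andP[x0 xN].
  have f0 : -1 <= Num.floor x by rewrite floor_ge_int.
  have f1 : Num.floor x < N%:Z + 2.
    by rewrite floor_lt_int intrD -pmulrn; lra.
  by move: f0 f1; lia.
have := IH (2 * x); have := IH (2 * x - q%:R); have := IH (2 * x - N%:R).
rewrite !flB fl2 ![_ - _ - 1]addrAC ![_ - _ - 2]addrAC ![_ - _ + 1]addrAC.
move: (rn n _) (rn n _) (rn n _) (rn n _) (rn n _) (rn n _).
move: (rn n _) (rn n _) (rn n _) (rn n _) (rn n _) (rn n _).
move: (cw n _) (cw n _) (cw n _).
by clear; lia.
Qed.

Lemma cn_gt0 n x : 0 <= x <= N%:R -> (0 < cn n x)%N.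
Proof.
elim: n x => [|n IH] x /=; first by move=> ->.
move=> /andP[x0 xN]; have [h|h] := leP (2 * x) N%:R.
  by rewrite !addn_gt0 IH //; apply/andP; split; lra.
by rewrite !addn_gt0 (IH (2 * x - N%:R)) ?orbT //; apply/andP; split; lra.
Qed.

End Counts.

(** * Geometry of the slices: covers and separated corners *)

Section Gasket.
Variables (R : realType) (p q : nat).
Local Notation N := (p + q)%N.
Hypothesis p_gt0 : (0 < p)%N.
Hypothesis q_gt0 : (0 < q)%N.
Variable Delta : set (R * R).
Hypothesis Dgasket : is_gasket Delta.
Local Notation cn := (@cn R p q).
Local Notation diam2 := (@diam R (R * R) dist2).

Definition kap : R := Num.sqrt 3 / (2 * q%:R + p%:R).

(* The projection of [z], normalised so that [Delta] projects onto [[0, p + q]]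
   with the top vertex at 0. *)
Definition xi (z : R * R) : R := q%:R + p%:R * z.1 - z.2 / kap.

Lemma sqrt3 : (Num.sqrt 3 : R) ^+ 2 = 3.
Proof. by rewrite sqr_sqrtr. Qed.

Lemma sqrt3_gt0 : 0 < Num.sqrt 3 :> R. Proof. by rewrite sqrtr_gt0. Qed.

Lemma sqrt3_bounds : 4 / 3 < Num.sqrt 3 :> R /\ Num.sqrt 3 <= 2 :> R.
Proof.
have := sqrt3; have := sqrt3_gt0; set y := Num.sqrt 3 => y0 y2.
by split; rewrite ?ltNge ?leNgt; apply/negP => h; move: y2; rewrite expr2; nra.
Qed.

Lemma den_gt0 : 0 < 2 * q%:R + p%:R :> R.
Proof. by rewrite ltr_pwDl // mulr_gt0 // ltr0n. Qed.

Lemma kap_gt0 : 0 < kap.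
Proof. by rewrite divr_gt0 ?sqrt3_gt0 ?den_gt0. Qed.

Definition gsh (i : 'I_3) : nat :=
  match val i with 0%N => q | 1%N => N | _ => 0%N end.

Lemma xi_map (i : 'I_3) z : xi (gasket_map i z) = (xi z + (gsh i)%:R) / 2.
Proof.
have k0 := gt_eqF kap_gt0; have kE : kap * (2 * q%:R + p%:R) = Num.sqrt 3.
  by rewrite /kap divfK // gt_eqF // den_gt0.
rewrite /xi /gasket_map /gsh; case: i => -[|[|[|//]]] /= _.
- by field; rewrite k0.
- by rewrite natrD; field; rewrite k0.
- rewrite -kE; field; rewrite k0 //.
Qed.

Lemma DeltaP z : Delta z <-> exists i w, Delta w /\ z = gasket_map i w.
Proof.
have [_ _ DE] := Dgasket; rewrite {1}DE; split=> [[i _ [w Dw <-]]|[i [w [Dw ->]]]].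
  by exists i, w.
by exists i => //; exists w.
Qed.

Lemma Delta_map i w : Delta w -> Delta (gasket_map i w).
Proof. by move=> Dw; apply/DeltaP; exists i, w. Qed.

Lemma Delta_bounded : exists M : R, forall z, Delta z -> `|z.1| <= M /\ `|z.2| <= M.
Proof.
have [_ cD _] := Dgasket; have [M [Mr HM]] := compact_bounded cD.
exists (M + 1) => z Dz; have := HM (M + 1) _ z Dz.
rewrite ltrDl ltr01 => /(_ isT) /=; rewrite prod_normE /= => h.
by split; apply: le_trans h; rewrite le_max lexx ?orbT.
Qed.

(** Iteration bounds [f z] by [|B| / 2 ^ n]. It applies to affine functions which the gasket maps
    halve up to a term of good sign, and so yields linear inequalities valid on [Delta]. *)
Lemma halving (f : R * R -> R) (B : R) : (forall z, Delta z -> f z <= B) ->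
  (forall z, Delta z -> exists2 w, Delta w & f z <= f w / 2) ->
  forall z, Delta z -> f z <= 0.
Proof.
move=> fB fh z Dz; rewrite leNgt; apply/negP => fz.
have H n : forall w, Delta w -> f w <= `|B| / 2 ^+ n.
  elim: n => [|n IH] w Dw; first by rewrite expr0 divr1 (le_trans (fB w Dw)) // ler_norm.
  have [v Dv /le_trans] := fh w Dw; apply; rewrite exprSr invfM mulrA ler_pM2r //.
  exact: IH.
have [n Hn] := nat_ge (`|B| / f z).
have := H n z Dz; rewrite ler_pdivlMr ?exprn_gt0 // mulrC -ler_pdivlMr //.
by rewrite leNgt (le_lt_trans Hn (exp2_gt R n)).
Qed.

Lemma Delta_box z : Delta z -> [/\ 0 <= z.1, z.1 <= 1, 0 <= z.2 & z.2 <= 1].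
Proof.
have [M HM] := Delta_bounded; have [s1 s2] := sqrt3_bounds; move=> Dz.
have B w : Delta w -> - M <= w.1 <= M /\ - M <= w.2 <= M.
  by move=> /HM; rewrite !ler_norml => -[].
have step (f : R * R -> R) (C : R) : (forall z, Delta z -> f z <= C) ->
   (forall i w, f (gasket_map i w) <= f w / 2) -> f z <= 0.
  move=> h1 h2; apply: (halving h1) Dz => u /DeltaP[i [w [Dw ->]]].
  by exists w.
split.
- rewrite -oppr_le0; apply: (step (fun z => - z.1) M); first by move=> w /B[]; lra.
  by move=> [[|[|[|//]]] ?] w; rewrite /gasket_map /=; lra.
- rewrite -subr_le0; apply: (step (fun z => z.1 - 1) M); first by move=> w /B[]; lra.
  by move=> [[|[|[|//]]] ?] w; rewrite /gasket_map /=; lra.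
- rewrite -oppr_le0; apply: (step (fun z => - z.2) M); first by move=> w /B[]; lra.
  by move=> [[|[|[|//]]] ?] w; rewrite /gasket_map /=; lra.
- rewrite -subr_le0; apply: (step (fun z => z.2 - 1) M); first by move=> w /B[]; lra.
  by move=> [[|[|[|//]]] ?] w; rewrite /gasket_map /=; lra.
Qed.

Lemma xi_range z : Delta z -> 0 <= xi z <= N%:R.
Proof.
move=> Dz; have k0 := kap_gt0; have ik : 0 < kap^-1 by rewrite invr_gt0.
have p0 : 0 <= p%:R :> R by []. have q0 : 0 <= q%:R :> R by [].
have bd w : Delta w -> - kap^-1 <= xi w <= N%:R.
  move=> /Delta_box[h1 h2 h3 h4]; rewrite /xi natrD.
  have := ler_wpM2l p0 h1; have := ler_wpM2l p0 h2.
  have := ler_wpM2r (ltW ik) h3; have := ler_wpM2r (ltW ik) h4; lra.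
have gN i : 0 <= ((gsh i)%:R : R) <= N%:R.
  by rewrite ler0n ler_nat /gsh; case: i => -[|[|[|//]]] /= _; rewrite ?leq_addl.
apply/andP; split.
  rewrite -oppr_le0; apply: (@halving (fun z => - xi z) (kap^-1)) Dz.
    by move=> w /bd/andP[]; lra.
  move=> _ /DeltaP[i [w [Dw ->]]]; exists w => //; rewrite xi_map.
  by have /andP[] := gN i; lra.
rewrite -subr_le0; apply: (@halving (fun z => xi z - N%:R) 0) Dz.
  by move=> w /bd/andP[]; lra.
move=> _ /DeltaP[i [w [Dw ->]]]; exists w => //; rewrite xi_map.
by have /andP[] := gN i; lra.
Qed.

Lemma xi_continuous : continuous xi.
Proof.
move=> z; rewrite /xi; apply: cvgB; last by apply: cvgM; [exact: cvg_snd|exact: cvg_cst].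
apply: cvgD; first exact: cvg_cst.
by apply: cvgM; [exact: cvg_cst|exact: cvg_fst].
Qed.

(** The maps with digits 0 and [N] already cover [[0, p + q]]; following them backwards approximates
    [x] by values of [xi], and the image of [Delta] is closed. *)
Lemma xi_onto x : 0 <= x <= N%:R -> exists2 z, Delta z & xi z = x.
Proof.
move=> xN; have [[z0 Dz0] cD _] := Dgasket.
have cK : closed (xi @` Delta).
  apply: compact_closed; first exact: Rhausdorff.
  apply: continuous_compact => //; apply: continuous_subspaceT; exact: xi_continuous.
have approx n : forall y, 0 <= y <= N%:R -> exists2 z, Delta z & `|xi z - y| <= N%:R / 2 ^+ n.
  elim: n => [|n IH] y /andP[y0 yN].
    exists z0 => //; have /andP[h1 h2] := xi_range Dz0.
    by rewrite expr0 divr1 ler_norml; lra.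
  have halve i : 0 <= 2 * y - (gsh i)%:R <= N%:R ->
      exists2 z, Delta z & `|xi z - y| <= N%:R / 2 ^+ n.+1.
    move=> /IH[z Dz zy]; exists (gasket_map i z); first exact: Delta_map.
    rewrite xi_map (_ : _ - y = (xi z - (2 * y - (gsh i)%:R)) / 2); last by field.
    by rewrite normrM (@gtr0_norm _ 2^-1) // exprSr invfM mulrA ler_pM2r.
  have [h|h] := leP (2 * y) N%:R.
    by apply: (halve (Ordinal (isT : (2 < 3)%N))); rewrite /gsh /= subr0; lra.
  by apply: (halve (Ordinal (isT : (1 < 3)%N))); rewrite /gsh /=; lra.
have [//|nK] := pselect ((xi @` Delta) x).
have : nbhs x (~` (xi @` Delta)) by apply: open_nbhs_nbhs; split => //; exact: closed_openC.
move=> /nbhs_ballP[e /= e0 He]; exfalso.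
have [n Hn] := nat_ge (N%:R / e).
have [z Dz zx] := approx n x xN; apply: (He (xi z)); last by exists z.
rewrite /ball /= distrC; apply: (le_lt_trans zx).
rewrite ltr_pdivrMr ?exprn_gt0 // mulrC -ltr_pdivrMr //.
exact: le_lt_trans (exp2_gt R n).
Qed.

Definition slx (x : R) : set (R * R) := [set z | Delta z /\ xi z = x].

Lemma slx_range x z : slx x z -> 0 <= x <= N%:R.
Proof. by move=> [/xi_range + <-]. Qed.

Definition o0 : 'I_3 := @Ordinal 3 0 isT.
Definition o1 : 'I_3 := @Ordinal 3 1 isT.
Definition o2 : 'I_3 := @Ordinal 3 2 isT.

Lemma slx_step x z : slx x z -> exists i w, slx (2 * x - (gsh i)%:R) w /\ z = gasket_map i w.
Proof.
move=> [/DeltaP[i [w [Dw ->]]]]; rewrite xi_map => xE.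
by exists i, w; split => //; split => //; rewrite -xE; field.
Qed.

Lemma slx_map i x w : slx (2 * x - (gsh i)%:R) w -> slx x (gasket_map i w).
Proof. by move=> [Dw wE]; split; [exact: Delta_map|rewrite xi_map wE; field]. Qed.

Lemma dist2_map i u v : dist2 (gasket_map i u) (gasket_map i v) = dist2 u v / 2 :> R.
Proof.
rewrite /dist2 (_ : _ + _ = ((u.1 - v.1) ^+ 2 + (u.2 - v.2) ^+ 2) * (2^-1) ^+ 2); last first.
  by rewrite /gasket_map; case: i => -[|[|[|//]]] /= _; field.
by rewrite sqrtrM ?addr_ge0 ?sqr_ge0 // sqrtr_sqr ger0_norm.
Qed.

Lemma dist2_ge (u v : R * R) : `|u.1 - v.1| <= dist2 u v /\ `|u.2 - v.2| <= dist2 u v.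
Proof.
by split; rewrite -sqrtr_sqr /dist2 ler_wsqrtr // ?lerDl ?lerDr sqr_ge0.
Qed.

Lemma dist2_le (u v : R * R) r : `|u.1 - v.1| <= r -> `|u.2 - v.2| <= r -> dist2 u v <= 2 * r.
Proof.
move=> h1 h2; have r0 : 0 <= r by exact: le_trans h1.
have r20 : 0 <= 2 * r by rewrite mulr_ge0.
rewrite -(ger0_norm r20) -sqrtr_sqr /dist2 ler_sqrt ?sqr_ge0 //.
have : (u.1 - v.1) ^+ 2 <= r ^+ 2 by rewrite -real_normK ?num_real // lerXn2r ?nnegrE.
have : (u.2 - v.2) ^+ 2 <= r ^+ 2 by rewrite -real_normK ?num_real // lerXn2r ?nnegrE.
have := sqr_ge0 r; rewrite exprMn; lra.
Qed.

Fixpoint cov (n : nat) (x : R) : seq (set (R * R)) :=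
  if n is m.+1 then
    [seq gasket_map o2 @` A | A <- cov m (2 * x)] ++
    [seq gasket_map o0 @` A | A <- cov m (2 * x - q%:R)] ++
    [seq gasket_map o1 @` A | A <- cov m (2 * x - N%:R)]
  else if 0 <= x <= N%:R then [:: Delta] else [::].

Lemma size_cov n x : size (cov n x) = cn n x.
Proof.
elim: n x => [|n IH] x /=; first by case: ifP.
by rewrite !size_cat !size_map !IH addnA.
Qed.

Lemma cov_cover n x z : slx x z -> exists2 A, A \in cov n x & A z.
Proof.
elim: n x z => [|n IH] x z /= Hz.
  rewrite (slx_range Hz); exists Delta; first by rewrite inE.
  by case: Hz.
have [i [w [/IH[A An Aw] ->]]] := slx_step Hz.
exists (gasket_map i @` A); last by exists w.
rewrite !mem_cat; case: i An => -[|[|[|//]]] i3; rewrite /gsh /= => An.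
- have -> : Ordinal i3 = o0 by exact: val_inj.
  by rewrite (map_f (fun A => gasket_map o0 @` A) An) orbT.
- have -> : Ordinal i3 = o1 by exact: val_inj.
  by rewrite (map_f (fun A => gasket_map o1 @` A) An) !orbT.
- have -> : Ordinal i3 = o2 by exact: val_inj.
  by rewrite subr0 in An; rewrite (map_f (fun A => gasket_map o2 @` A) An).
Qed.

Lemma cov_small n x A : A \in cov n x -> forall u v, A u -> A v -> dist2 u v <= 2 / 2 ^+ n.
Proof.
elim: n x A => [|n IH] x A /=.
  case: ifP => // _; rewrite inE => /eqP-> u v /Delta_box[u1 u2 u3 u4] /Delta_box[v1 v2 v3 v4].
  by rewrite expr0; apply: dist2_le; rewrite invr1 ler_norml; lra.
have key i y B : B \in cov n y -> forall u v, (gasket_map i @` B) u -> (gasket_map i @` B) v ->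
    dist2 u v <= 2 / 2 ^+ n.+1.
  move=> By _ _ [u Bu <-] [v Bv <-]; rewrite dist2_map exprSr invfM mulrA ler_pM2r //.
  exact: IH By _ _ Bu Bv.
by rewrite !mem_cat => /or3P[] /mapP[B By ->]; exact: key By.
Qed.

(* Corners of the level-[n] triangles met by the slice, in lattice coordinates:
   the lattice points being distinct, a small set meets few of the triangles. *)
Fixpoint pts (n : nat) (x : R) : seq (nat * nat) :=
  if n is m.+1 then
    [seq (k.1, k.2 + 2 ^ m)%N | k <- pts m (2 * x)] ++
    pts m (2 * x - q%:R) ++
    [seq (k.1 + 2 ^ m, k.2)%N | k <- pts m (2 * x - N%:R)]
  else if 0 <= x <= N%:R then [:: (0, 0)%N] else [::].

Lemma size_pts n x : size (pts n x) = cn n x.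
Proof.
elim: n x => [|n IH] x /=; first by case: ifP.
by rewrite !size_cat !size_map !IH addnA.
Qed.

Lemma pts_lt n x k : k \in pts n x -> (k.1 < 2 ^ n)%N /\ (k.2 < 2 ^ n)%N.
Proof.
elim: n x k => [|n IH] x [a b] /=; first by case: ifP => // _; rewrite inE => /eqP[-> ->].
rewrite !mem_cat expnS => /or3P[/mapP[[c d] /IH /= + [-> ->]]|/IH|/mapP[[c d] /IH /= + [-> ->]]] /=;
  clear; move: (2 ^ n)%N => j; lia.
Qed.

Lemma uniq_pts n x : uniq (pts n x).
Proof.
elim: n x => [|n IH] x /=; first by case: ifP.
rewrite !cat_uniq !map_inj_uniq ?IH /=; try by move=> [? ?] [? ?] /= [] *; congr (_, _); lia.
rewrite andbT; apply/andP; split; apply/hasPn => -[a b]; last first.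
  move=> /mapP[[c d] /pts_lt[h1 h2] [-> ->]]; apply/negP => /pts_lt /= []; lia.
rewrite mem_cat => /orP[/pts_lt[h1 h2]|/mapP[[c d] /pts_lt[h1 h2] [-> ->]]];
  apply/negP => /mapP[[e f] /pts_lt[/= h3 h4]] [E1 E2]; move: h1 h2 => /=; lia.
Qed.

(** Every triangle counted by [cn] really meets the slice, because [xi_onto] provides a point at the
    bottom of the recursion. *)
Lemma pts_point n x k : k \in pts n x -> exists z w, [/\ slx x z, Delta w,
  z.1 = (w.1 + k.1%:R + k.2%:R / 2) / 2 ^+ n &
  z.2 = (w.2 + k.2%:R * Num.sqrt 3 / 2) / 2 ^+ n].
Proof.
elim: n x k => [|n IH] x k /=.
  case: ifP => // xN; rewrite inE => /eqP-> /=; have [z Dz zx] := xi_onto xN.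
  by exists z, z; split => //; rewrite expr0 divr1 ?mul0r ?addr0.
rewrite !mem_cat => /or3P[/mapP[k' /IH[z [w [zx Dw z1 z2]]] ->]|/IH[z [w [zx Dw z1 z2]]]
  |/mapP[k' /IH[z [w [zx Dw z1 z2]]] ->]] /=.
- exists (gasket_map o2 z), w; split => //; first by apply: slx_map; rewrite /gsh /= subr0.
    by rewrite /gasket_map /= z1 natrD natrX exprSr; field.
  by rewrite /gasket_map /= z2 natrD natrX exprSr; field.
- exists (gasket_map o0 z), w; split => //; first exact: slx_map.
    by rewrite /gasket_map /= z1 exprSr; field.
  by rewrite /gasket_map /= z2 exprSr; field.
- exists (gasket_map o1 z), w; split => //; first exact: slx_map.
    by rewrite /gasket_map /= z1 natrD natrX exprSr; field.
  by rewrite /gasket_map /= z2 exprSr; field.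
Qed.

Lemma near_nat (a b : nat) (c : R) : `|a%:R - b%:R| <= c -> c < 4 -> (a < b + 4)%N.
Proof.
rewrite ler_norml => /andP[_ h1] h2; rewrite -(ltr_nat R) natrD; lra.
Qed.

(** Corners of triangles met by one set of diameter [2 ^- n] differ by less than 4 in both lattice
    coordinates, so residues modulo 4 tell them apart: at most 16 for each set. *)
Lemma cn_le_cover n x m (U : nat -> set (R * R)) :
  (forall i, (i < m)%N -> forall u v, U i u -> U i v -> dist2 u v <= 2 ^- n) ->
  slx x `<=` [set z | exists2 i, (i < m)%N & U i z] -> (cn n x <= m * 16)%N.
Proof.
move=> Us xU; have p2 : 0 < 2 ^+ n :> R by rewrite exprn_gt0.
have [s1 s2] := sqrt3_bounds.
have /choice[f Hf] : forall k : nat * nat, exists i, k \in pts n x -> (i < m)%N /\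
   exists z w, [/\ U i z, Delta w, z.1 = (w.1 + k.1%:R + k.2%:R / 2) / 2 ^+ n &
     z.2 = (w.2 + k.2%:R * Num.sqrt 3 / 2) / 2 ^+ n].
  move=> k; have [kx|kx] := boolP (k \in pts n x); last by exists 0%N.
  have [z [w [zx Dw z1 z2]]] := pts_point kx; have [i im Uz] := xU z zx.
  by exists i => _; split => //; exists z, w.
pose g (k : nat * nat) := (f k, (k.1 %% 4, k.2 %% 4))%N.
have ginj : {in pts n x &, injective g}.
  have key k k' : k \in pts n x -> k' \in pts n x -> f k = f k' -> (k.1 < k'.1 + 4)%N /\ (k.2 < k'.2 + 4)%N.
    move=> /Hf[im [z [w [Uz /Delta_box[w1 w2 w3 w4] z1 z2]]]].
    move=> /Hf[im' [z' [w' [Uz' /Delta_box[w1' w2' w3' w4'] z1' z2']]]] fE.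
    rewrite -fE in Uz'; have [d1 d2] := dist2_ge z z'.
    have dn : dist2 z z' * 2 ^+ n <= 1 by rewrite -ler_pdivlMr // mul1r; exact: Us Uz Uz'.
    have e1 : `|z.1 - z'.1| * 2 ^+ n <= 1 by apply: le_trans dn; rewrite ler_pM2r.
    have e2 : `|z.2 - z'.2| * 2 ^+ n <= 1 by apply: le_trans dn; rewrite ler_pM2r.
    rewrite -(gtr0_norm p2) -normrM z2 z2' -mulrBl divfK ?gt_eqF // in e2.
    rewrite -(gtr0_norm p2) -normrM z1 z1' -mulrBl divfK ?gt_eqF // in e1.
    have k2 : `|k.2%:R - k'.2%:R| <= 3 :> R.
      move: e2; rewrite !ler_norml => /andP[e3 e4].
      have s0 : 0 < Num.sqrt 3 :> R by exact: sqrt3_gt0.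
      rewrite -[X in X && _](ler_pM2r s0) -[X in _ && X](ler_pM2r s0); lra.
    have k1 : `|k.1%:R - k'.1%:R| <= 7 / 2 :> R.
      move: e1 k2; rewrite !ler_norml => /andP[e3 e4] /andP[e5 e6]; lra.
    by split; [apply: (near_nat k1)|apply: (near_nat k2)]; lra.
  move=> k k' kx kx' [fE m1 m2]; have [a1 a2] := key k k' kx kx' fE.
  have [b1 b2] := key k' k kx' kx (esym fE).
  by case: k k' {kx kx' fE} m1 m2 a1 a2 b1 b2 => [x1 x2] [y1 y2] /=; clear; move=> *; congr (_, _); lia.
rewrite -size_pts -(size_map g).
have -> : (m * 16 = size [seq (i, k) | i <- iota 0 m, k <- [seq (a, b) | a <- iota 0 4, b <- iota 0 4]])%N.
  by rewrite !size_allpairs !size_iota.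
apply: uniq_leq_size; first by rewrite map_inj_in_uniq ?uniq_pts.
move=> _ /mapP[k /Hf[im _] ->]; rewrite /g; apply: allpairs_f; first by rewrite mem_iota.
by apply: allpairs_f; rewrite mem_iota /= add0n ltn_mod.
Qed.

End Gasket.

(** * The projected measure of small balls *)

Section Measure.
Variables (R : realType) (p q : nat).
Local Notation N := (p + q)%N.
Hypothesis p_gt0 : (0 < p)%N.
Hypothesis q_gt0 : (0 < q)%N.
Variable nu : probability (measurableTypeR R * measurableTypeR R)%type R.
Hypothesis nuE : is_gasket_measure nu.
Local Notation xi := (@xi R p q).
Local Notation gsh := (@gsh p q).

Lemma measurable_xi : measurable_fun [set: (measurableTypeR R * measurableTypeR R)%type]
  (xi : _ -> measurableTypeR R).
Proof.
rewrite /xi; apply: measurable_funB.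
  apply: measurable_funD; first exact: measurable_cst.
  by apply: measurable_funM; [exact: measurable_cst|exact: measurable_fst].
by apply: measurable_funM; [exact: measurable_snd|exact: measurable_cst].
Qed.

Definition mu (B : set (measurableTypeR R)) : R := fine (nu (xi @^-1` B)).

Lemma measurable_xi_pre B : measurable B -> measurable (xi @^-1` B : set (measurableTypeR R * measurableTypeR R)%type).
Proof. by move=> mB; rewrite -[X in measurable X]setTI; apply: measurable_xi. Qed.

Lemma muE B : measurable B -> nu (xi @^-1` B) = (mu B)%:E.
Proof.
move=> mB; rewrite fineK // fin_num_measure //; exact: measurable_xi_pre.
Qed.

Lemma mu_ge0 B : 0 <= mu B. Proof. by rewrite fine_ge0. Qed.

Lemma mu_le B C : measurable B -> measurable C -> B `<=` C -> mu B <= mu C.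
Proof.
move=> mB mC BC; rewrite -lee_fin -!muE //.
by apply: le_measure; rewrite ?inE; [exact: measurable_xi_pre|exact: measurable_xi_pre|move=> z /BC].
Qed.

Lemma muC B : measurable B -> mu (~` B) = 1 - mu B.
Proof.
move=> mB; apply: EFin_inj; rewrite EFinB -!muE //; last exact: measurableC.
by rewrite preimage_setC probability_setC //; exact: measurable_xi_pre.
Qed.

Lemma measurable_shift (d : R) B : measurable B ->
  measurable [set t : measurableTypeR R | B ((t + d) / 2)].
Proof.
move=> mB; rewrite -[X in measurable X]setTI.
have mf : measurable_fun [set: measurableTypeR R] (fun t => (t + d) / 2 : measurableTypeR R).
  apply: measurable_funM; last exact: measurable_cst.
  by apply: measurable_funD; [exact: measurable_id|exact: measurable_cst].
exact: mf.
Qed.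

Lemma mu_step B : measurable B ->
  mu B = 3^-1 * (mu [set t | B (t / 2)] + mu [set t | B ((t + q%:R) / 2)] +
                 mu [set t | B ((t + N%:R) / 2)]).
Proof.
move=> mB; have mh d := measurable_shift d mB.
have E (i : 'I_3) : gasket_map i @^-1` (xi @^-1` B) = xi @^-1` [set t | B ((t + (gsh i)%:R) / 2)].
  by apply/seteqP; split=> z /=; rewrite xi_map.
apply: EFin_inj; rewrite -muE // nuE; last exact: measurable_xi_pre.
rewrite !big_ord_recl big_ord0 !E !muE; try exact: mh.
rewrite /gsh /= addr0 -!EFinM -!EFinD.
rewrite (_ : [set t | B ((t + 0) / 2)] = [set t | B (t / 2)]); last first.
  by apply/seteqP; split=> t /=; rewrite addr0.
by congr (_%:E); ring.
Qed.

(* [mu (out r)] vanishes since [out r] can only be reached from [out (2 r)] by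
   the self-similarity. *)
Definition out (r : R) : set (measurableTypeR R) := ~` `[- r, N%:R + r].

Lemma measurable_out r : measurable (out r).
Proof. by apply: measurableC; exact: measurable_itv. Qed.

Lemma outE r t : out r t <-> t < - r \/ N%:R + r < t.
Proof.
rewrite /out /= in_itv /=; split.
  by move/negP; rewrite negb_and -!ltNge => /orP[]; [left|right].
by move=> [h|h] /andP[h1 h2]; move: h; rewrite ltNge ?h1 ?h2.
Qed.

Lemma mu_out_le r : mu (out r) <= mu (out (2 * r)).
Proof.
have q0 : 0 <= q%:R :> R by []. have p0 : 0 <= p%:R :> R by [].
have mh d := measurable_shift d (measurable_out r).
have H (d : R) : 0 <= d <= N%:R -> mu [set t | out r ((t + d) / 2)] <= mu (out (2 * r)).
  move=> dN; apply: mu_le => //; first exact: measurable_out.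
  by move=> t /outE; move=> h; apply/outE; case: h => h; [left|right]; lra.
rewrite [X in X <= _]mu_step; last exact: measurable_out.
have := H 0; have := H q%:R; have := H N%:R; rewrite !lexx /= !ler0n ler_nat leq_addl.
move=> /(_ isT) h1 /(_ isT) h2 /(_ isT).
rewrite (_ : [set t | out r ((t + 0) / 2)] = [set t | out r (t / 2)]); last first.
  by apply/seteqP; split=> t /=; rewrite addr0.
move=> h3; lra.
Qed.

Lemma mu_out_pos r : 0 < r -> mu (out r) = 0.
Proof.
move=> r0; apply/eqP; rewrite eq_le mu_ge0 andbT.
have H n : mu (out r) <= mu (out (r * 2 ^+ n)).
  elim: n => [|n IH]; first by rewrite expr0 mulr1.
  by apply: le_trans IH _; rewrite exprS mulrCA mu_out_le.
have out_decr : {homo (fun n => out (r * 2 ^+ n)) : n m / (n <= m)%N >-> (m <= n)%O}.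
  move=> n m nm; apply/subsetPset => t /outE h; apply/outE.
  have : r * 2 ^+ n <= r * 2 ^+ m by rewrite ler_pM2l // ler_eXn2l // ltr1n.
  by case: h => h; [left|right]; lra.
have out0 : \bigcap_n (out (r * 2 ^+ n)) = set0.
  apply/seteqP; split => // t Ht; have [n Hn] := nat_ge ((`|t| + N%:R) / r).
  have := Ht n I; move=> /outE; rewrite ler_pdivrMr // in Hn.
  have h2 : n%:R * r < r * 2 ^+ n by rewrite mulrC ltr_pM2l // exp2_gt.
  have := ler_norm t; have := ler_norm (- t); rewrite normrN.
  have : 0 <= N%:R :> R by []. lra.
have cv : nu (xi @^-1` out (r * 2 ^+ n)) @[n --> \oo] --> 0%E.
  have <- : nu (\bigcap_n (xi @^-1` out (r * 2 ^+ n))) = 0%E.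
    by rewrite -preimage_bigcap out0 preimage_set0 measure0.
  apply: nonincreasing_cvg_mu => [|i||n m nm].
  - by rewrite /= muE ?ltry //; exact: measurable_out.
  - by apply: measurable_xi_pre; exact: measurable_out.
  - by apply: bigcapT_measurable => i; apply: measurable_xi_pre; exact: measurable_out.
  - by have /subsetPset h := out_decr n m nm; apply/subsetPset => z /h.
suff : ((mu (out r))%:E <= 0)%E by rewrite lee_fin.
rewrite -(cvg_lim _ cv) //; apply: lime_ge; first by apply/cvg_ex; exists 0%E.
by apply: nearW => n; rewrite muE ?lee_fin //; exact: measurable_out.
Qed.

Lemma mu_ball_step x r : mu (ball x r) = 3^-1 * (mu (ball (2 * x) (2 * r)) +
  mu (ball (2 * x - q%:R) (2 * r)) + mu (ball (2 * x - N%:R) (2 * r))).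
Proof.
rewrite mu_step; last exact: measurable_ball.
have E (d : R) : [set t | ball x r ((t + d) / 2)] = ball (2 * x - d) (2 * r).
  apply/seteqP; split=> t; rewrite /ball /= => h.
    rewrite (_ : _ - t = 2 * (x - (t + d) / 2)); last by field.
    by rewrite normrM gtr0_norm // ltr_pM2l.
  rewrite (_ : _ - t = 2 * (x - (t + d) / 2)) in h; last by field.
  by rewrite normrM gtr0_norm // ltr_pM2l in h.
have E0 : [set t | ball x r (t / 2)] = ball (2 * x) (2 * r).
  by rewrite -[X in _ = ball X _]subr0 -E; apply/seteqP; split=> t /=; rewrite addr0.
by rewrite E0 !E.
Qed.

(** The recursion of [mu_ball_step] is that of [cn]. At its bottom the radius exceeds [N], so a ball
    about a point of [[0, N]] contains that interval with a margin and has full mass. *)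
Lemma mu_ball_ge n x r : N%:R < r * 2 ^+ n -> (cn p q n x)%:R <= 3 ^+ n * mu (ball x r).
Proof.
elim: n x r => [|n IH] x r.
  rewrite !expr0 mulr1 mul1r /= => rN; case: (boolP (0 <= x <= N%:R)) => [/andP[x0 xN]|_]; last exact: mu_ge0.
  have d0 : 0 < (r - N%:R) / 2 by rewrite divr_gt0 ?subr_gt0.
  have := mu_out_pos d0; rewrite /out muC; last exact: measurable_itv.
  move/eqP; rewrite subr_eq0 => /eqP ->; apply: mu_le; [exact: measurable_itv|exact: measurable_ball|].
  move=> t /=; rewrite in_itv /= /ball /= ltr_norml => /andP[h1 h2]; lra.
rewrite exprS => h; have h' : N%:R < 2 * r * 2 ^+ n by rewrite -mulrA mulrCA.
rewrite mu_ball_step /= !natrD mulrA exprSr mulfK // !mulrDr.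
by rewrite !lerD ?IH.
Qed.

(** At the bottom of the recursion the radius is at most 1, so a ball about a point outside
    [[-1, N + 1]] has no mass, and any other has mass at most 1. *)
Lemma mu_ball_le n x r : r * 2 ^+ n <= 1 -> 3 ^+ n * mu (ball x r) <= (cw p q n x)%:R.
Proof.
elim: n x r => [|n IH] x r.
  rewrite !expr0 mulr1 mul1r /= => r1; case: (boolP (-1 <= x <= N%:R + 1)) => [_|].
    rewrite -lee_fin -muE; last exact: measurable_ball.
    by apply: probability_le1; apply: measurable_xi_pre; exact: measurable_ball.
  rewrite negb_and -!ltNge => xN.
  have key d : 0 < d -> ball x r `<=` out d -> mu (ball x r) <= 0.
    move=> d0 h; rewrite -(mu_out_pos d0); apply: mu_le => //; [exact: measurable_ball|exact: measurable_out].
  case/orP: xN => h; [apply: (key (-1 - x)); first lra|apply: (key (x - N%:R - 1)); first lra];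
    move=> t; rewrite /ball /= ltr_norml => /andP[h1 h2]; apply/outE; [left|right]; lra.
rewrite exprS => h; have h' : 2 * r * 2 ^+ n <= 1 by rewrite -mulrA mulrCA.
rewrite mu_ball_step /= !natrD mulrA exprSr mulfK // !mulrDr.
by rewrite !lerD ?IH.
Qed.

End Measure.

(** * Limits at scale zero *)

Section Limits.
Variable R : realType.
Implicit Types (g : R -> \bar R) (l e r : R).

(** A common form for the two box dimensions being equal to [l] and for the convergence in the local
    dimension. *)
Definition dlim g l := forall e, 0 < e ->
  exists2 d, 0 < d & forall r, 0 < r < d -> ((l - e)%:E <= g r <= (l + e)%:E)%E.

Lemma near0P (P : set R) : (\forall r \near 0^'+, P r) <-> exists2 d, 0 < d & forall r, 0 < r < d -> P r.
Proof.
split=> [|[d d0 H]].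
  rewrite near_withinE => /nbhs_ballP[d /= d0 H]; exists d => // r /andP[r0 rd].
  by apply: H => //; rewrite /ball /= sub0r normrN gtr0_norm.
rewrite near_withinE; apply/nbhs_ballP; exists d => //= r; rewrite /ball /= sub0r normrN => rd r0.
by apply: H; rewrite r0 (le_lt_trans (ler_norm r)).
Qed.

Lemma dlim_limf g l :
  (limf_einf g 0^'+ = l%:E /\ limf_esup g 0^'+ = l%:E) <-> dlim g l.
Proof.
split=> [[li ls] e e0|H].
  have [V FV Vi] : exists2 V, 0^'+ V & ((l - e)%:E < ereal_inf (g @` V))%E.
    have : ((l - e)%:E < limf_einf g 0^'+)%E by rewrite li lte_fin ltrBlDr ltrDl.
    by rewrite limf_einfE => /ereal_sup_gt[_ [V FV <-] h]; exists V.
  have [W FW Ws] : exists2 W, 0^'+ W & (ereal_sup (g @` W) < (l + e)%:E)%E.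
    have : (limf_esup g 0^'+ < (l + e)%:E)%E by rewrite ls lte_fin ltrDl.
    by rewrite limf_esupE => /ereal_inf_lt[_ [U FU <-] h]; exists U.
  have /near0P[d d0 Hd] : 0^'+ (V `&` W) by exact: filterI.
  exists d => // r /Hd[Vr Wr]; apply/andP; split.
    by apply: le_trans (ltW Vi) _; apply: ereal_inf_lbound; exists r.
  by apply: le_trans (ltW Ws); apply: ereal_sup_ubound; exists r.
have near_ge V e : 0^'+ V -> 0 < e -> exists2 r, V r & ((l - e)%:E <= g r <= (l + e)%:E)%E.
  move=> /near0P[d d0 Vd] /H[c c0 Hc]; have m0 : 0 < Num.min c d by rewrite lt_min c0.
  have m1 : 0 < Num.min c d / 2 < Num.min c d by apply/andP; split; lra.
  move: m1; rewrite lt_min => /and3P[h1 h2 h3].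
  by exists (Num.min c d / 2); [apply: Vd|apply: Hc]; rewrite h1.
have nearH e : 0 < e -> exists2 V, 0^'+ V & forall r, V r -> ((l - e)%:E <= g r <= (l + e)%:E)%E.
  move=> /H[d d0 Hd]; exists [set r | 0 < r < d] => //.
  by apply/near0P; exists d.
split; apply/eqP; rewrite eq_le; apply/andP; split.
- rewrite limf_einfE; apply: ge_ereal_sup => _ [V FV <-].
  apply/lee_addgt0Pr => e e0; have [r Vr /andP[_ h]] := near_ge V e FV e0.
  by rewrite -EFinD; apply: le_trans h; apply: ereal_inf_lbound; exists r.
- apply/lee_subgt0Pr => e e0; have [V FV HV] := nearH e e0.
  rewrite limf_einfE; apply: le_trans (ereal_sup_ubound _); last by exists V.
  by apply: le_ereal_inf_tmp => _ [r Vr <-]; have /andP[] := HV r Vr.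
- apply/lee_addgt0Pr => e e0; have [V FV HV] := nearH e e0.
  rewrite limf_esupE; apply: le_trans (ereal_inf_lbound _) _; first by exists V.
  by apply: ge_ereal_sup => _ [r Vr <-]; have /andP[] := HV r Vr.
- rewrite limf_esupE; apply: le_ereal_inf_tmp => _ [V FV <-].
  apply/lee_subgt0Pr => e e0; have [r Vr /andP[h _]] := near_ge V e FV e0.
  by apply: le_trans h _; apply: ereal_sup_ubound; exists r.
Qed.

Lemma dlim_cvg g l : (g @ 0^'+ --> l%:E) <-> dlim g l.
Proof.
split=> [/fine_cvgP[gf /cvgrPdist_le gl] e e0|H].
  have /near0P[d d0 Hd] : \forall r \near 0^'+, g r \is a fin_num /\ `|l - fine (g r)| <= e.
    by apply: filterI => //; exact: gl.
  exists d => // r /Hd[gr h]; rewrite -(fineK gr) !lee_fin.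
  by move: h; rewrite ler_norml => /andP[h1 h2]; apply/andP; split; lra.
have fin e : 0 < e -> \forall r \near 0^'+, g r \is a fin_num /\ `|l - fine (g r)| <= e.
  move=> /H[d d0 Hd]; apply/near0P; exists d => // r /Hd /andP[]; case: (g r) => [y| |] //=.
  by rewrite !lee_fin => h1 h2; split => //; rewrite ler_norml; lra.
apply/fine_cvgP; split; first by apply: filterS (fin 1 ltr01) => r [].
by apply/cvgrPdist_le => e e0; apply: filterS (fin e e0) => r [].
Qed.

Lemma dlim_ext g g' l : (exists2 d, 0 < d & forall r, 0 < r < d -> g r = g' r) -> dlim g l -> dlim g' l.
Proof.
move=> [c c0 gg'] H e /H[d d0 Hd]; exists (Num.min c d); first by rewrite lt_min c0.
by move=> r /andP[r0]; rewrite lt_min => /andP[rc rd]; rewrite -gg' ?r0 ?rc // Hd // r0.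
Qed.

Definition rate (L : nat -> R) (a : R) := forall e, 0 < e ->
  exists n0, forall n, (n0 <= n)%N -> `|L n - n%:R * a| <= n%:R * e.

Lemma rate_close L L' a C : rate L a -> (forall n, `|L' n - L n| <= C) -> rate L' a.
Proof.
move=> H LL e e0; have e2 : 0 < e / 2 by rewrite divr_gt0.
have [n0 Hn] := H _ e2; have [m Hm] := nat_ge (C / (e / 2)).
exists (maxn n0 m) => n; rewrite geq_max => /andP[h1 h2].
have := Hn n h1; have := LL n; move: Hm; rewrite ler_pdivrMr //.
have : m%:R * (e / 2) <= n%:R * (e / 2) by rewrite ler_pM2r // ler_nat.
rewrite !ler_norml => h3 h4 /andP[h5 h6] /andP[h7 h8]; apply/andP; split; lra.
Qed.

Lemma rate_shift L a k : rate (fun n => L (n + k)%N) a <-> rate L a.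
Proof.
split=> H e e0; have e2 : 0 < e / 2 by rewrite divr_gt0.
  have [n0 Hn] := H _ e2; have [m Hm] := nat_ge (k%:R * `|a| / (e / 2)).
  exists (maxn (n0 + k) m) => n; rewrite geq_max => /andP[h1 h2].
  move: Hm; rewrite ler_pdivrMr // => Hm.
  have h3 : m%:R * (e / 2) <= n%:R * (e / 2) by rewrite ler_pM2r // ler_nat.
  have kn : (k <= n)%N by rewrite (leq_trans _ h1) // leq_addl.
  have := Hn (n - k)%N; rewrite leq_subRL // addnC => /(_ h1); rewrite subnK // natrB //.
  have h4 : `|k%:R * a| <= k%:R * `|a| by rewrite normrM ger0_norm.
  have h5 : 0 <= k%:R * (e / 2) by rewrite mulr_ge0 // ltW.
  move: h4; rewrite !ler_norml !mulrBl => /andP[h6 h7] /andP[h8 h9]; apply/andP; split; lra.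
have [n0 Hn] := H _ e2; have [m Hm] := nat_ge ((k%:R * (e / 2) + k%:R * `|a|) / (e / 2)).
exists (maxn n0 m) => n; rewrite geq_max => /andP[h1 h2].
move: Hm; rewrite ler_pdivrMr // => Hm.
have h3 : m%:R * (e / 2) <= n%:R * (e / 2) by rewrite ler_pM2r // ler_nat.
have := Hn (n + k)%N (leq_trans h1 (leq_addr _ _)); rewrite natrD.
have h4 : `|k%:R * a| <= k%:R * `|a| by rewrite normrM ger0_norm.
move: h4; rewrite !ler_norml !mulrDl => /andP[h6 h7] /andP[h8 h9]; apply/andP; split; lra.
Qed.

Lemma rate_lin L a c : rate L a -> rate (fun n => n%:R * c - L n) (c - a).
Proof.
move=> H e /H[n0 Hn]; exists n0 => n /Hn.
by rewrite !ler_norml mulrBr => /andP[h1 h2]; apply/andP; split; lra.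
Qed.

Lemma ln_exp2 n : ln (2 ^- n : R) = - (n%:R * ln 2).
Proof. by rewrite lnV ?posrE ?exprn_gt0 // lnXn // mulr_natl. Qed.

Lemma rate_of_dlim (h : R -> R) k b : 0 < k ->
  dlim (fun r => (h r / - ln r)%:E) b -> rate (fun n => h (k * 2 ^- n)) (b * ln 2).
Proof.
move=> k0 H e e0.
have l1 : ln 2 <= 1 :> R := ln2_le1 R.
have e2 : 0 < e / 2 by rewrite divr_gt0.
have [d d0 Hd] := H _ e2.
have m0 : 0 < Num.min d 1 by rewrite lt_min d0 ltr01.
have [n1 Hn1] := nat_ge (k / Num.min d 1).
have [n2 Hn2] := nat_ge (((e / 2) * `|ln k| + `|b * ln k|) / (e / 2)).
exists (maxn n1 n2) => n; rewrite geq_max => /andP[h1 h2].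
have r0 : 0 < k * 2 ^- n by rewrite mulr_gt0 // invr_gt0 exprn_gt0.
have rm : k * 2 ^- n < Num.min d 1.
  rewrite ltr_pdivrMr ?exprn_gt0 // mulrC -ltr_pdivrMr //.
  by apply: (le_lt_trans Hn1); apply: le_lt_trans (exp2_gt R n); rewrite ler_nat.
move: (rm); rewrite lt_min => /andP[rd r1].
have lr : ln (k * 2 ^- n) = ln k - n%:R * ln 2.
  by rewrite lnM ?posrE ?invr_gt0 ?exprn_gt0 // ln_exp2.
have lrn : 0 < - ln (k * 2 ^- n) by rewrite oppr_gt0 ln_lt0 // r0.
have := Hd _ (introT andP (conj r0 rd)); rewrite !lee_fin ler_pdivlMr // ler_pdivrMr //.
move: lrn; rewrite lr => lrn.
move: Hn2; rewrite ler_pdivrMr // => Hn2.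
have h3 : n2%:R * (e / 2) <= n%:R * (e / 2) by rewrite ler_pM2r // ler_nat.
have h4 : `|e / 2 * ln k| <= e / 2 * `|ln k| by rewrite normrM ger0_norm // ltW.
have h5 : n%:R * ln 2 * (e / 2) <= n%:R * (e / 2).
  by rewrite -mulrA ler_wpM2l // ler_piMl // ltW.
have h6 := lexx `|b * ln k|.
move: h4 h6; rewrite !ler_norml => /andP[h7 h8] /andP[h9 h10] /andP[h11 h12].
apply/andP; split; lra.
Qed.

Lemma dlim_of_rate (h : R -> R) lo hi k a : 0 < k -> rate lo a -> rate hi a ->
  (forall n r, k * 2 ^- n.+1 < r -> r <= k * 2 ^- n -> lo n <= h r <= hi n) ->
  dlim (fun r => (h r / - ln r)%:E) (a / ln 2).
Proof.
move=> k0 Hlo Hhi H e e0.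
have l0 : 0 < ln 2 :> R by exact: ln2_gt0.
have l1 : ln 2 <= 1 :> R := ln2_le1 R.
(* From [expR (1 / 2) <= 1 + 1 / 2 + 2 / 4 = 2]. *)
have lh : 1 / 2 <= ln 2 :> R.
  rewrite -ler_expR lnK ?posrE //; apply: le_trans (expR_le_quad _) _; rewrite ?ger0_norm //; lra.
set b := a / ln 2; have ab : a = b * ln 2 by rewrite /b divfK // gt_eqF.
have e8 : 0 < e / 8 by rewrite divr_gt0.
have [n1 Hn1] := Hlo _ e8; have [n2 Hn2] := Hhi _ e8.
set C := `|b| * (1 + `|ln k|).
have [n3 Hn3] := nat_ge (4 * `|ln k|); have [n4 Hn4] := nat_ge (C / (e / 8)).
have [n0 [i1 i2 i3 i4]] : exists n0, [/\ (n1 <= n0)%N, (n2 <= n0)%N, (n3 <= n0)%N & (n4 <= n0)%N].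
  by exists (n1 + n2 + n3 + n4)%N; clear; split; lia.
exists (Num.min 1 (k * 2 ^- n0.+1)); first by rewrite lt_min ltr01 mulr_gt0 // invr_gt0 exprn_gt0.
move=> r /andP[r0]; rewrite lt_min => /andP[r1 rn0].
have ex : exists n, k / r < 2 ^+ n.+1.
  have [n hn] := nat_ge (k / r); exists n; apply: (le_lt_trans hn).
  by apply: lt_trans (exp2_gt R n) _; rewrite ltr_eXn2l // ltr1n.
have [n kn nmin] := ex_minnP ex.
have n0n : (n0 < n.+1)%N.
  rewrite ltnS leqNgt; apply/negP => nn0.
  have : k / r < 2 ^+ n0.+1.
    by apply: (lt_le_trans kn); rewrite ler_eXn2l ?ltr1n // leqW.
  by rewrite ltr_pdivrMr // mulrC -ltr_pdivrMr ?exprn_gt0 // ltNge (ltW rn0).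
have rlo : k * 2 ^- n.+1 < r by rewrite ltr_pdivrMr ?exprn_gt0 // mulrC -ltr_pdivrMr.
have rhi : r <= k * 2 ^- n.
  rewrite ler_pdivlMr ?exprn_gt0 // mulrC -ler_pdivlMr //.
  case: (n) nmin n0n => [_ _|m nmin _]; last first.
    by rewrite leNgt; apply/negP => /nmin; rewrite ltnn.
  rewrite expr0 ler_pdivlMr // mul1r.
  apply: (le_trans (ltW rn0)); rewrite ler_piMr ?(ltW k0) // invf_le1 ?exprn_gt0 //.
  by rewrite exprn_ege1 // ler1n.
have lnr : ln k - n.+1%:R * ln 2 <= ln r <= ln k - n%:R * ln 2.
  have i n' : ln (k * 2 ^- n') = ln k - n'%:R * ln 2.
    by rewrite lnM ?posrE ?invr_gt0 ?exprn_gt0 // ln_exp2.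
  rewrite -!i !ler_ln ?posrE ?mulr_gt0 ?invr_gt0 ?exprn_gt0 //.
  by rewrite rhi (ltW rlo).
have u0 : 0 < - ln r by rewrite oppr_gt0 ln_lt0 // r0.
rewrite !lee_fin ler_pdivlMr // ler_pdivrMr //.
have nn i : (i <= n0)%N -> (i <= n)%N by move=> i0; rewrite (leq_trans i0).
have g3 : n3%:R <= n%:R :> R by rewrite ler_nat nn.
have g4 : n4%:R <= n%:R :> R by rewrite ler_nat nn.
have g5 : C <= n%:R * (e / 8).
  by rewrite -ler_pdivrMr //; exact: le_trans g4.
have g6 : `|b * (- ln r - n%:R * ln 2)| <= C.
  rewrite normrM ler_wpM2l //; have := lexx `|ln k|; rewrite ler_norml => /andP[f1 f2].
  move: lnr; rewrite -natr1 mulrDl mul1r => /andP[f3 f4].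
  rewrite ler_norml; move: f1 f2 f3 f4 l1; clear; move=> *; apply/andP; split; lra.
have g7 : n%:R * (e / 4) <= e * (- ln r).
  rewrite (_ : n%:R * (e / 4) = e * (n%:R / 4)); last by ring.
  rewrite ler_pM2l //; have := ler_norm (ln k); have : n%:R * (1 / 2) <= n%:R * ln 2 :> R by rewrite ler_wpM2l.
  case/andP: lnr => _; move: Hn3 g3; clear; lra.
move: (H n r rlo rhi) (Hn1 n (nn _ i1)) (Hn2 n (nn _ i2)) g5 g6 g7.
rewrite ab; clear; move: (ln 2) (ln r) (h r) (lo n) (hi n) => x y z u v.
rewrite !ler_norml => /andP[f7 f8] /andP[f5 f6] /andP[f3 f4] g5 /andP[f1 f2] g7.
by apply/andP; split; lra.
Qed.

End Limits.

(** * Box dimension and local dimension as growth rates *)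

Section Slices.
Variables (R : realType) (p q : nat).
Local Notation N := (p + q)%N.
Hypothesis p_gt0 : (0 < p)%N.
Hypothesis q_gt0 : (0 < q)%N.
Variable Delta : set (R * R).
Hypothesis Dgasket : is_gasket Delta.
Variable nu : probability (measurableTypeR R * measurableTypeR R)%type R.
Hypothesis nuE : is_gasket_measure nu.
Local Notation cn := (@cn R p q).
Local Notation cw := (@cw R p q).
Local Notation rn := (rn p q).
Local Notation rsum := (rsum p q).
Local Notation slx := (@slx R p q Delta).
Local Notation mu := (@mu R p q nu).
Local Notation Xlow := (@Xlow R p q).
Local Notation Xup := (@Xup R p q).

Lemma cn_le_cw n x : (cn n x <= cw n x)%N.
Proof.
elim: n x => [|n IH] x /=; last by rewrite !leq_add.
case: (boolP (0 <= x <= N%:R)) => // /andP[x0 xN].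
by rewrite (_ : -1 <= x <= N%:R + 1) //; apply/andP; split; lra.
Qed.

Lemma cn_le_rsum n x : (cn n x <= rsum n (fl n x))%N.
Proof. by rewrite (leq_trans (cn_le_cw n x)) // cw_le. Qed.

Lemma Xlow_rate a x : Xlow a x ->
  rate (fun n => ln (cn n x)%:R) a /\ rate (fun n => ln (cw n x)%:R) a.
Proof.
move=> [xN H].
have key (c : nat -> nat) : (forall n, (rn n (fl n x) <= c n <= rsum n (fl n x))%N) ->
    rate (fun n => ln (c n)%:R) a.
  move=> cE e /H[n0 Hn]; exists n0 => n /Hn[h1 h2]; have /andP[c1 c2] := cE n.
  have h3 : expR (n%:R * (a - e)) <= (c n)%:R by apply: le_trans h1 _; rewrite ler_nat.
  have h4 : (c n)%:R <= expR (n%:R * (a + e)) by apply: le_trans h2; rewrite ler_nat.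
  have c0 : 0 < (c n)%:R :> R by apply: lt_le_trans h3; exact: expR_gt0.
  rewrite -(lnK (c0 : _ \is Num.pos)) !ler_expR in h3 h4.
  by rewrite ler_norml; move: h3 h4; rewrite mulrBr mulrDr => h3 h4; apply/andP; split; lra.
have rc n : (rn n (fl n x) <= cn n x)%N by exact: rn_le_cn.
split; apply: key => n; first by rewrite rc cn_le_rsum.
by rewrite (leq_trans (rc n) (cn_le_cw n x)) cw_le.
Qed.

Lemma Xup_of_rate a x (L U : nat -> R) k : 0 <= x <= N%:R -> rate L a -> rate U a ->
  (forall n, (k <= n)%N -> ln (cn n x)%:R <= U n /\ L n <= ln (rsum n (fl n x))%:R) ->
  Xup a x.
Proof.
move=> xN rL rU H; split=> // e e0; have [n1 H1] := rL e e0; have [n2 H2] := rU e e0.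
exists (maxn k (maxn n1 n2)) => n; rewrite !geq_max => /and3P[/H[h1 h2] /H1 h3 /H2 h4].
have c0 : 0 < (cn n x)%:R :> R by rewrite ltr0n cn_gt0.
have s0 : 0 < (rsum n (fl n x))%:R :> R by apply: lt_le_trans c0 _; rewrite ler_nat cn_le_rsum.
move: h3 h4; rewrite !ler_norml => /andP[h3 h4] /andP[h5 h6].
split; last by rewrite -(lnK (s0 : _ \is Num.pos)) ler_expR mulrBr; lra.
apply: (@le_trans _ _ (cn n x)%:R); first by rewrite ler_nat rn_le_cn.
by rewrite -(lnK (c0 : _ \is Num.pos)) ler_expR mulrDr; lra.
Qed.

Lemma rate_unshift (L : nat -> R) a k : rate L a -> rate (fun n => L (n - k)%N) a.
Proof.
move=> H; apply/(rate_shift _ _ k); apply: (rate_close (C := 0) H) => n.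
by rewrite addnK subrr normr0.
Qed.

Local Notation cov_num r x := (covering_number dist2 r (slx x)).

Lemma diam2P (U : set (R * R)) r : (diam dist2 U <= r%:E)%E <->
  (forall u v, U u -> U v -> dist2 u v <= r).
Proof.
split=> [H u v Uu Uv|H].
  by rewrite -lee_fin; apply: le_trans H; apply: ereal_sup_ubound; exists u => //; exists v.
by apply: ge_ereal_sup => _ [x Ux] [y Uy] <-; rewrite lee_fin; exact: H.
Qed.

Lemma cov_num_ge n x r : r <= 2 ^- n -> (((cn n x)%:R / 16)%:E <= cov_num r x)%E.
Proof.
move=> rn; apply: le_ereal_inf_tmp => _ [m [U [HU xU]] <-]; rewrite lee_fin ler_pdivrMr //.
rewrite -natrM ler_nat.
pose V i := if insub i is Some j then U j else set0.
apply: (cn_le_cover p_gt0 q_gt0 Dgasket (U := V)).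
  move=> i im u v; rewrite /V insubT /= => Uu Uv.
  by apply: le_trans rn; exact: (proj1 (diam2P _ _) (HU _)) Uu Uv.
by move=> z /xU[i _ Uz]; exists i => //; rewrite /V valK.
Qed.

Lemma cov_num_le n x r : 2 * 2 ^- n <= r -> (cov_num r x <= (cn n x)%:R%:E)%E.
Proof.
move=> rn; apply: ereal_inf_lbound; exists (cn n x) => //.
exists (fun i : 'I_(cn n x) => nth set0 (cov p q Delta n x) i); split.
  move=> i; apply/diam2P => u v Uu Uv; apply: le_trans rn.
  have An : nth set0 (cov p q Delta n x) i \in cov p q Delta n x.
    by apply: mem_nth; rewrite size_cov.
  exact: (cov_small Dgasket An Uu Uv).
move=> z /(cov_cover q_gt0 Dgasket n)[A An Az].
have iA : (index A (cov p q Delta n x) < cn n x)%N by rewrite -(size_cov p q Delta) index_mem.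
by exists (Ordinal iA) => //=; rewrite nth_index.
Qed.

Definition hbox x r := ln (fine (cov_num r x)).

Lemma cov_num_fin x r : 0 <= x <= N%:R -> 0 < r <= 1 ->
  exists2 v, 0 < v & cov_num r x = v%:E.
Proof.
move=> xN /andP[r0 r1]; have [m Hm] := nat_ge (2 / r).
have h1 : (cov_num r x <= (cn m x)%:R%:E)%E.
  apply: cov_num_le; rewrite ler_pdivrMr ?exprn_gt0 // mulrC -ler_pdivrMr //.
  by apply: (le_trans Hm); apply: ltW; exact: exp2_gt.
have h0 : (((cn 0 x)%:R / 16)%:E <= cov_num r x)%E by apply: cov_num_ge; rewrite expr0 invr1.
have c0 : 0 < (cn 0 x)%:R / 16 :> R by rewrite divr_gt0 // ltr0n cn_gt0.
case E : (covering_number _ _ _) h0 h1 => [v| |] //; rewrite !lee_fin => h0 _.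
by exists v => //; exact: lt_le_trans h0.
Qed.

Lemma box_dlim x al : 0 <= x <= N%:R ->
  has_box_dim dist2 (slx x) al <-> dlim (fun r => (hbox x r / - ln r)%:E) al.
Proof.
move=> xN; rewrite /has_box_dim dlim_limf.
have E r : 0 < r < 1 -> (lne (cov_num r x) * ((- ln r)^-1)%:E)%E = (hbox x r / - ln r)%:E.
  move=> /andP[r0 /ltW r1]; have [|v v0 vE] := @cov_num_fin x r xN; first by rewrite r0.
  by rewrite /hbox vE lne_EFin.
by split; apply: dlim_ext; exists 1 => // r /E ->.
Qed.

Lemma hbox_bounds x n r : 0 <= x <= N%:R -> 0 < r <= 1 ->
  (r <= 2 ^- n -> ln (cn n x)%:R - ln 16 <= hbox x r) /\
  (2 * 2 ^- n <= r -> hbox x r <= ln (cn n x)%:R).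
Proof.
move=> xN r01; have [v v0 vE] := cov_num_fin xN r01; rewrite /hbox vE /=.
have c0 : 0 < (cn n x)%:R :> R by rewrite ltr0n cn_gt0.
split=> [/(@cov_num_ge n x)|/(@cov_num_le n x)]; rewrite vE lee_fin => h.
  rewrite -ln_div ?posrE //; by rewrite ler_ln ?posrE // divr_gt0.
by rewrite ler_ln ?posrE.
Qed.

Lemma box_Xup x al : 0 <= x <= N%:R -> has_box_dim dist2 (slx x) al -> Xup (al * ln 2) x.
Proof.
move=> xN /(box_dlim _ xN)/(rate_of_dlim ltr01) H.
have H1 : rate (fun n => hbox x (1 * 2 ^- n) + ln 16) (al * ln 2).
  by apply: (rate_close (C := `|ln 16|) H) => n; rewrite addrAC subrr add0r.
(* The lower rate is sampled one level earlier: pieces of level [n] have diameter up to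
   [2 * 2 ^- n], so they bound the covering number at the scale of level [n - 1]. *)
apply: (Xup_of_rate (k := 2) xN (rate_unshift 1 H) H1) => -[|[|n]] // _.
have b01 m : 0 < (2 ^- m.+1 : R) <= 1.
  by rewrite invr_gt0 exprn_gt0 //= invf_le1 ?exprn_gt0 // exprn_ege1 // ler1n.
rewrite !mul1r subn1 /=; have [h1 _] := hbox_bounds n.+2 xN (b01 n.+1).
have [_ h2] := hbox_bounds n.+2 xN (b01 n); split; first by have := h1 (lexx _); lra.
apply: le_trans (h2 _) _.
  by rewrite exprS invfM mulrA divff ?mul1r.
by rewrite ler_ln ?posrE ?ltr0n ?ler_nat ?cn_le_rsum ?cn_gt0 // (leq_trans _ (cn_le_rsum _ _)) ?cn_gt0.
Qed.

Lemma Xlow_box x al : Xlow (al * ln 2) x -> has_box_dim dist2 (slx x) al.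
Proof.
move=> Hx; have [xN _] := Hx; have [rc _] := Xlow_rate Hx.
apply/(box_dlim _ xN); rewrite -[X in dlim _ X](mulfK (lt0r_neq0 (ln2_gt0 R))).
have rlo : rate (fun n => ln (cn n x)%:R - ln 16) (al * ln 2).
  by apply: (rate_close (C := `|ln 16|) rc) => n; rewrite addrAC subrr add0r normrN.
have rhi : rate (fun n => ln (cn (n + 2)%N x)%:R) (al * ln 2) by apply/(rate_shift (fun n => ln (cn n x)%:R) _ 2).
apply: (dlim_of_rate ltr01 rlo rhi) => n r; rewrite !mul1r => rn1 rn.
have r0 : 0 < r by apply: lt_trans rn1; rewrite invr_gt0 exprn_gt0.
have r01 : 0 < r <= 1 by rewrite r0 (le_trans rn) // invf_le1 ?exprn_gt0 // exprn_ege1 // ler1n.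
have [/(_ rn) h1 _] := hbox_bounds n xN r01; rewrite h1 /=.
have [_ h2] := hbox_bounds (n + 2) xN r01; apply: h2.
by rewrite addn2 exprS invfM mulrA divff ?mul1r // ltW.
Qed.

Local Notation kap := (kap R p q).

Definition hmu x r := - ln (mu (ball x (r / kap))).

Lemma mu_gt0 (x r : R) : 0 <= x <= N%:R -> 0 < r -> 0 < mu (ball x r).
Proof.
move=> xN r0; have [m Hm] := nat_ge (N%:R / r).
have h : N%:R < r * 2 ^+ m.
  by rewrite mulrC -ltr_pdivrMr //; apply: (le_lt_trans Hm); exact: exp2_gt.
rewrite -(@pmulr_rgt0 _ (3 ^+ m)) ?exprn_gt0 //.
by apply: lt_le_trans (mu_ball_ge q_gt0 nuE x h); rewrite ltr0n cn_gt0.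
Qed.

Lemma ln_mu_bounds (x : R) n r : 0 <= x <= N%:R -> 0 < r ->
  (r * 2 ^+ n <= 1 -> n%:R * ln 3 + ln (mu (ball x r)) <= ln (cw n x)%:R) /\
  (N%:R < r * 2 ^+ n -> ln (cn n x)%:R <= n%:R * ln 3 + ln (mu (ball x r))).
Proof.
move=> xN r0; have m0 := mu_gt0 xN r0.
have c0 : 0 < (cn n x)%:R :> R by rewrite ltr0n cn_gt0.
have w0 : 0 < (cw n x)%:R :> R by apply: lt_le_trans c0 _; rewrite ler_nat cn_le_cw.
have -> : n%:R * ln 3 + ln (mu (ball x r)) = ln (3 ^+ n * mu (ball x r)).
  by rewrite lnM ?posrE ?exprn_gt0 // lnXn // mulr_natl.
have m3 : 0 < 3 ^+ n * mu (ball x r) by rewrite mulr_gt0 // exprn_gt0.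
by split=> h; rewrite ler_ln ?posrE //; [exact: mu_ball_le|exact: mu_ball_ge].
Qed.

Lemma mu_Xup x be : 0 <= x <= N%:R -> dlim (fun r => (hmu x r / - ln r)%:E) be ->
  Xup (ln 3 - be * ln 2) x.
Proof.
move=> xN /(rate_of_dlim (kap_gt0 R p q_gt0)) H.
have HE n : hmu x (kap * 2 ^- n) = - ln (mu (ball x (2 ^- n))).
  by rewrite /hmu mulrAC divff ?mul1r // gt_eqF // kap_gt0.
have pn m : 0 < 2 ^- m :> R by rewrite invr_gt0 exprn_gt0.
(* [mu_ball_ge] needs [N < r * 2 ^ n]; the radius [2 ^- (n - N)] will do because [N < 2 ^ N], and a
   fixed shift leaves the rate unchanged. *)
have H1 : rate (fun n => n%:R * ln 3 - hmu x (kap * 2 ^- (n - N))) (ln 3 - be * ln 2).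
  exact: (rate_lin (ln 3) (rate_unshift N H)).
apply: (Xup_of_rate (k := N) xN (rate_lin (ln 3) H) H1) => n Nn; rewrite !HE !opprK; split.
  have [_ h] := ln_mu_bounds n xN (pn (n - N)%N); apply: h.
  by rewrite -{2}(subnK Nn) exprD mulrA mulVf ?mul1r ?expf_neq0 // exp2_gt.
have [h _] := ln_mu_bounds n xN (pn n); apply: (le_trans (h _)).
  by rewrite mulVf ?expf_neq0.
have c0 : (0 < cw n x)%N by rewrite (leq_trans _ (cn_le_cw n x)) ?cn_gt0.
by rewrite ler_ln ?posrE ?ltr0n ?ler_nat ?cw_le // (leq_trans c0) ?cw_le.
Qed.

Lemma Xlow_mu x be : Xlow (ln 3 - be * ln 2) x -> dlim (fun r => (hmu x r / - ln r)%:E) be.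
Proof.
move=> Hx; have [xN _] := Hx; have [rc rw] := Xlow_rate Hx.
have k0 := kap_gt0 R p q_gt0.
have -> : be = (ln 3 - (ln 3 - be * ln 2)) / ln 2.
  by rewrite subKr mulfK // gt_eqF // ln2_gt0.
have rhi := (proj2 (rate_shift _ _ N.+1)) (rate_lin (ln 3) rc).
apply: (dlim_of_rate k0 (rate_lin (ln 3) rw) rhi) => n r rn1 rn.
have r0 : 0 < r by apply: lt_trans rn1; rewrite mulr_gt0 // invr_gt0 exprn_gt0.
have rk : 0 < r / kap by rewrite divr_gt0.
have [h1 _] := ln_mu_bounds n xN rk; have [_ h2] := ln_mu_bounds (n + N.+1)%N xN rk.
have e1 : r / kap * 2 ^+ n <= 1.
  by rewrite mulrAC ler_pdivrMr // mul1r -ler_pdivlMr ?exprn_gt0.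
have e2 : N%:R < r / kap * 2 ^+ (n + N.+1)%N.
  rewrite -addSnnS exprD mulrA; apply: (lt_le_trans (exp2_gt R N)).
  rewrite ler_peMl ?exprn_ge0 // mulrAC ler_pdivlMr // mul1r.
  by rewrite -ler_pdivrMr ?exprn_gt0 // ltW.
by move: (h1 e1) (h2 e2); rewrite /hmu; lra.
Qed.

End Slices.

(** * The spectrum *)

Section Envelope.
Variable R : realType.
Variables (a b M : R) (c d f : R -> R).
Hypothesis cd_ge0 : forall x t, a <= x <= b -> 0 <= c t * x + d t.
Hypothesis leM : forall x, a <= x <= b -> f x <= M.
Hypothesis fE : forall x, a <= x <= b -> f x = inf (range (fun t => c t * x + d t)).

Lemma env_le x t : a <= x <= b -> f x <= c t * x + d t.
Proof.
move=> xab; rewrite fE //; apply: ge_inf; last by exists t.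
by exists 0 => _ [u _ <-]; exact: cd_ge0.
Qed.

Lemma env_ge x v : a <= x <= b -> (forall t, v <= c t * x + d t) -> v <= f x.
Proof.
move=> xab H; rewrite fE //; apply: lb_le_inf; first by exists (c 0 * x + d 0), 0.
by move=> _ [t _ <-].
Qed.

Lemma env_lt x v : a <= x <= b -> f x < v -> exists t, c t * x + d t < v.
Proof.
move=> xab xv; have [//|H] := pselect (exists t, c t * x + d t < v); exfalso.
have : v <= f x; last by rewrite leNgt xv.
by apply: env_ge => // t; rewrite leNgt; apply/negP => h; apply: H; exists t.
Qed.

Lemma env_f_ge0 x : a <= x <= b -> 0 <= f x.
Proof. by move=> xab; apply: env_ge => // t; exact: cd_ge0. Qed.

Lemma env_combo x y l : a <= x <= b -> a <= y <= b -> 0 <= l <= 1 ->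
  l * f x + (1 - l) * f y <= f (l * x + (1 - l) * y).
Proof.
move=> xab yab /andP[l0 l1]; have l1' : 0 <= 1 - l by rewrite subr_ge0.
apply: env_ge.
  move: xab yab => /andP[x1 x2] /andP[y1 y2].
  have := ler_wpM2l l0 x1; have := ler_wpM2l l0 x2.
  have := ler_wpM2l l1' y1; have := ler_wpM2l l1' y2.
  by clear; move=> *; apply/andP; split; lra.
move=> t; have h1 := ler_wpM2l l0 (env_le t xab); have h2 := ler_wpM2l l1' (env_le t yab).
rewrite (_ : c t * _ + d t = l * (c t * x + d t) + (1 - l) * (c t * y + d t)); last by ring.
exact: lerD.
Qed.

Lemma env_concave : concave_on `[a, b] f.
Proof.
move=> t x y; rewrite !inE /= !in_itv /= => xab yab.
rewrite !convRE /unstable.onem !mulrN -opprD lerN2.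
apply: env_combo => //; apply/andP; split; [exact: ge0|exact: le1].
Qed.

(** Above, [f] stays under one affine function that is almost optimal at [x]. Below, concavity on
    the segment from [x] to an end point loses at most [M] times the relative distance; being
    one-sided, this works at the end points too. *)
Lemma env_continuous : {within `[a, b], continuous f}.
Proof.
apply/subspace_continuousP => x; rewrite /= in_itv /= => xab; have /andP[ax xb] := xab.
have M0 : 0 <= M := le_trans (env_f_ge0 xab) (leM xab).
apply/cvgrPdist_le => e e0; rewrite near_withinE.
have [t Ht] : exists t, c t * x + d t < f x + e / 2 by apply: env_lt => //; rewrite ltrDl divr_gt0.
have side z y : a <= z <= b -> a <= y <= b -> (x < y <= z) || (z <= y < x) ->
    (M + 1) * `|y - x| <= e * `|z - x| -> f x - e <= f y.
  move=> zab yab xyz h.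
  have zx0 : 0 < `|z - x| by rewrite normr_gt0 subr_eq0; case/orP: xyz => /andP[h1 h2]; apply/eqP; lra.
  pose l := `|y - x| / `|z - x|.
  have l0 : 0 <= l by rewrite divr_ge0.
  have l1 : l <= 1.
    rewrite ler_pdivrMr // mul1r; case/orP: xyz => /andP[h1 h2].
      by rewrite !ger0_norm ?subr_ge0; lra.
    by rewrite !ler0_norm ?subr_le0; lra.
  have yE : y = l * z + (1 - l) * x.
    rewrite (_ : _ + _ = x + l * (z - x)); last by ring.
    have lz : l * `|z - x| = `|y - x| by rewrite /l divfK // gt_eqF.
    case/orP: xyz lz => /andP[h1 h2].
      by rewrite !ger0_norm ?subr_ge0; lra.
    by rewrite !ler0_norm ?subr_le0; lra.
  have le : l * M <= e.
    rewrite /l mulrAC ler_pdivrMr //; apply: le_trans h.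
    by rewrite mulrC ler_wpM2r // lerDl.
  have := env_combo zab xab (introT andP (conj l0 l1)); rewrite -yE.
  have := mulr_ge0 l0 (env_f_ge0 zab); have := ler_wpM2l l0 (leM xab).
  move: le; rewrite mulrBl mul1r; lra.
have M1 : 0 < M + 1 by rewrite ltr_wpDl.
(* At an end point one side is empty, and any positive radius, here 1, is allowed for it. *)
pose da := if x == a then 1 else e * (x - a) / (M + 1).
pose db := if x == b then 1 else e * (b - x) / (M + 1).
have da0 : 0 < da.
  rewrite /da; case: eqVneq => // xa; rewrite divr_gt0 // mulr_gt0 // subr_gt0.
  by rewrite lt_neqAle eq_sym xa.
have db0 : 0 < db.
  rewrite /db; case: eqVneq => // xb'; rewrite divr_gt0 // mulr_gt0 // subr_gt0.
  by rewrite lt_neqAle xb'.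
pose dc := e / (2 * (`|c t| + 1)).
have dc0 : 0 < dc by rewrite divr_gt0 // mulr_gt0.
apply/nbhs_ballP; exists (Num.min da (Num.min db dc)); first by rewrite /= !lt_min da0 db0.
move=> y; rewrite /ball /= !lt_min distrC => /and3P[yda ydb ydc]; rewrite in_itv /= => yab.
have /andP[ay yb] := yab.
have up : f y <= f x + e.
  apply: (le_trans (env_le t yab)).
  have h1 : c t * (y - x) <= e / 2.
    apply: le_trans (ler_norm _) _; rewrite normrM.
    have : (`|c t| + 1) * `|y - x| <= (`|c t| + 1) * dc by rewrite ler_pM2l // ltW.
    rewrite (_ : _ * dc = e / 2); last by rewrite /dc; field; rewrite gt_eqF.
    by apply: le_trans; rewrite ler_wpM2r // lerDl.
  by move: Ht h1; lra.
have lo : f x - e <= f y.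
  have [yx|xy|->] := ltgtP y x; last by lra.
    apply: (side a) => //; first by rewrite lexx (le_trans ax).
      by rewrite ay yx orbT.
    move: yda; rewrite /da; case: eqVneq => [xa|xa]; first by exfalso; move: ay; rewrite leNgt -xa yx.
    rewrite ltr_pdivlMr // => /ltW; rewrite mulrC => h.
    by rewrite (distrC a) (@ger0_norm _ (x - a)) // subr_ge0.
  apply: (side b) => //; first by rewrite lexx andbT (le_trans ax).
    by rewrite yb xy.
  move: ydb; rewrite /db; case: eqVneq => [xb'|xb']; first by exfalso; move: yb; rewrite leNgt -xb' xy.
  rewrite ltr_pdivlMr // => /ltW; rewrite mulrC => h.
  by rewrite (@ger0_norm _ (b - x)) // subr_ge0.
by rewrite ler_distlC lo up.
Qed.

End Envelope.

(** * Dimension of the level sets *)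

Section Spectrum.
Variables (R : realType) (p q : nat).
Local Notation N := (p + q)%N.
Hypothesis p_gt0 : (0 < p)%N.
Hypothesis q_gt0 : (0 < q)%N.
Hypothesis pq : coprime p q.
Local Notation P := (@pressure R p q).
Local Notation kap := (kap R p q).

Definition spectrum (al : R) : R := inf (range (fun t : R => - al * t + P t / ln 2)).

Lemma spectrum_ge0 al t : bmin R p q <= al <= bmax R p q -> 0 <= - al * t + P t / ln 2.
Proof.
move=> /andP[al0 al1]; have l0 := ln2_gt0 R.
suff : t * al * ln 2 <= P t by rewrite -ler_pdivlMr //; lra.
have [t0|t0|->] := ltgtP t 0.
- apply: le_trans (bmin_le p_gt0 q_gt0 t0); rewrite [leRHS]mulrAC ler_pM2r //.
  by rewrite ler_nM2l.
- apply: le_trans (bmax_le p_gt0 q_gt0 t0); rewrite [leRHS]mulrAC ler_pM2r //.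
  by rewrite ler_pM2l.
- by rewrite !mul0r pressure0 // ltW.
Qed.

Lemma spectrum_lbound al : bmin R p q <= al <= bmax R p q ->
  has_lbound (range (fun t : R => - al * t + P t / ln 2)).
Proof. by move=> h; exists 0 => _ [t _ <-]; exact: spectrum_ge0. Qed.

Lemma spectrum_le al t : bmin R p q <= al <= bmax R p q ->
  spectrum al <= - al * t + P t / ln 2.
Proof. by move=> h; apply: ge_inf; [exact: spectrum_lbound|exists t]. Qed.

Lemma spectrum_le1 al : bmin R p q <= al <= bmax R p q -> spectrum al <= 1.
Proof.
move=> h; have := spectrum_le 0 h; rewrite mulr0 add0r pressure0 // divff // gt_eqF //.
exact: ln2_gt0.
Qed.

Lemma spectrumE al : bmin R p q <= al <= bmax R p q ->
  ereal_inf (range (fun t : R => (- al * t + P t / ln 2)%:E)) = (spectrum al)%:E.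
Proof.
move=> h; rewrite -ereal_inf_EFin; [|exact: spectrum_lbound|by exists (- al * 0 + P 0 / ln 2), 0].
by rewrite image_comp.
Qed.

(** The change of variable between [a] and [x] is Lipschitz in both directions, so null sets pass
    through it. Above, any [t] whose value is below [s'] makes [Xup] null; below, [lower_set] is
    used with the largest admissible [h], the infimum itself. *)
Lemma dim_spectrum al (S : set R) : bmin R p q <= al <= bmax R p q ->
  (forall x, Xlow p q (al * ln 2) x -> S (kap * (q%:R - x))) ->
  (forall a, S a -> Xup p q (al * ln 2) (q%:R - a / kap)) ->
  hausdorff_dim dist1 S = (spectrum al)%:E.
Proof.
move=> hal lowS Sup; have l0 := ln2_gt0 R; have k0 := kap_gt0 R p q_gt0.
have sp0 : 0 <= spectrum al.
  apply: lb_le_inf; first by exists (- al * 0 + P 0 / ln 2), 0.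
  by move=> _ [t _ <-]; exact: spectrum_ge0.
apply/eqP; rewrite eq_le; apply/andP; split.
  apply: hausdorff_dim_le => // s' hs; have s0 : 0 < s' by exact: le_lt_trans hs.
  have [_ [t _ <-] ht] : exists2 y, range (fun t : R => - al * t + P t / ln 2) y & y < s'.
    by apply: inf_lt hs; exists (- al * 0 + P 0 / ln 2), 0.
  have hP : P t - t * (al * ln 2) < s' * ln 2.
    have -> : P t - t * (al * ln 2) = (- al * t + P t / ln 2) * ln 2.
      by field; rewrite gt_eqF.
    by rewrite ltr_pM2r.
  have Xn := hnull_Xup p_gt0 q_gt0 pq s0 hP.
  apply: hnullS (hnull_lipschitz (f := fun x => kap * (q%:R - x)) (ltW s0) k0 _ Xn).
    move=> a /Sup Xa; exists (q%:R - a / kap) => //.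
    by rewrite subKr mulrC divfK // gt_eqF.
  move=> x y _ _; rewrite -mulrBr normrM gtr0_norm // distrC.
  by rewrite (_ : _ - (q%:R - x) = x - y) //; ring.
have h0 : 0 <= spectrum al * ln 2 by rewrite mulr_ge0 // ltW.
have [|Y YX Ynull] := lower_set p_gt0 q_gt0 pq (a := al * ln 2) h0.
  move=> t; have -> : P t - al * ln 2 * t = (- al * t + P t / ln 2) * ln 2.
    by field; rewrite gt_eqF.
  by rewrite ler_pM2r //; exact: spectrum_le.
apply: hausdorff_dim_ge => s' s0 Sn; rewrite -(ler_pM2r l0); apply: Ynull => //.
have k1 : 0 < kap^-1 by rewrite invr_gt0.
apply: hnullS (hnull_lipschitz (f := fun a => q%:R - a / kap) s0 k1 _ Sn).
  move=> x Yx; exists (kap * (q%:R - x)); first exact: lowS (YX _ Yx).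
  by rewrite mulrAC divff ?gt_eqF // mul1r subKr.
move=> a b _ _; rewrite (_ : _ - (q%:R - b / kap) = kap^-1 * (b - a)); last by ring.
by rewrite normrM (gtr0_norm k1) distrC.
Qed.

End Spectrum.

Theorem proposition1p8 (R : realType) (p q : nat) (theta : R)
    (Delta : set (R * R))
    (nu : probability (measurableTypeR R * measurableTypeR R)%type R) :
  (0 < p)%N -> (0 < q)%N -> gcdn p q = 1%N ->
  0 < theta < pi / 3 ->
  tan theta = Num.sqrt 3 * p%:R / (2 * q%:R + p%:R) ->
  is_gasket Delta -> is_gasket_measure nu ->
  let s : R := gasket_dim in
  let b_min := bmin R p q in
  let b_max := bmax R p q in
  let Delta_theta := gasket_proj theta @` Delta in
  let nu_theta := proj_measure nu theta in
  let F1 (alpha : R) := hausdorff_dim dist1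
    [set a | Delta_theta a /\ has_box_dim dist2 (slice Delta theta a) alpha] in
  let F2 (alpha : R) := hausdorff_dim dist1
    [set a | Delta_theta a /\ has_local_dim nu_theta a alpha] in
  [/\ forall alpha : R, b_min <= alpha <= b_max ->
        F1 alpha =
        ereal_inf (range (fun t : R =>
          (- alpha * t + pressure p q t / ln 2)%:E)),
      forall alpha : R, s - b_max <= alpha <= s - b_min ->
        F2 alpha =
        ereal_inf (range (fun t : R =>
          (- (s - alpha) * t + pressure p q t / ln 2)%:E)),
      concave_on `[b_min, b_max] (fine \o F1) /\
        {within `[b_min, b_max], continuous (fine \o F1)} &
      concave_on `[s - b_max, s - b_min] (fine \o F2) /\
        {within `[s - b_max, s - b_min], continuous (fine \o F2)}].
Proof.
have subC (x y z w : R) : x - y <= w <= x - z -> z <= x - w <= y.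
  by move=> /andP[h1 h2]; apply/andP; split; lra.
move=> p_gt0 q_gt0 /eqP pq _ tanE Dg nuE s b_min b_max Delta_theta nu_theta F1 F2.
have k0 := kap_gt0 R p q_gt0; have l0 := ln2_gt0 R.
have kn : kap R p q != 0 by rewrite gt_eqF.
(* The hypothesis on [theta] enters here only: the projection becomes an affine function of [xi],
   slices become fibres of [xi], and radii are rescaled by [kap]. *)
have tan_kap : tan theta = kap R p q * p%:R by rewrite tanE mulrAC.
have projE z : gasket_proj theta z = kap R p q * (q%:R - xi p q z).
  by rewrite /gasket_proj tan_kap /xi; field.
have xproj z : xi p q z = q%:R - gasket_proj theta z / kap R p q.
  by rewrite projE mulrAC divff // mul1r subKr.
have DP a : Delta_theta a <-> 0 <= q%:R - a / kap R p q <= (p + q)%:R.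
  split=> [[z Dz <-]|/(xi_onto q_gt0 Dg)[z Dz xz]].
    by rewrite -xproj; exact: (xi_range p q_gt0 Dg Dz).
  by exists z => //; rewrite projE xz subKr mulrC divfK.
have sliceE a : slice Delta theta a = slx p q Delta (q%:R - a / kap R p q).
  apply/seteqP; split=> [z [[x ->] Dz]|z [Dz xz]]; split => //.
    by rewrite xproj /gasket_proj /= addrK.
  exists z.1; have : gasket_proj theta z = a by rewrite projE xz subKr mulrC divfK.
  by rewrite /gasket_proj => <-; rewrite subrK; case: (z).
have ballE a r : nu_theta (ball a r) =
    (mu p q nu (ball (q%:R - a / kap R p q) (r / kap R p q)))%:E.
  rewrite -muE; last exact: measurable_ball.
  rewrite /nu_theta /proj_measure /pushforward; congr (nu _).
  have normE z : `|q%:R - a / kap R p q - xi p q z| = `|a - gasket_proj theta z| / kap R p q.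
    rewrite xproj (_ : _ - _ = (gasket_proj theta z - a) / kap R p q); last by ring.
    by rewrite normrM distrC (@gtr0_norm _ (_^-1)) ?invr_gt0.
  by apply/seteqP; split=> z; rewrite /ball /= normE ltr_pM2r ?invr_gt0.
have localE a be : 0 <= q%:R - a / kap R p q <= (p + q)%:R -> has_local_dim nu_theta a be <->
    dlim (fun r => (hmu p q nu (q%:R - a / kap R p q) r / - ln r)%:E) be.
  move=> xN; rewrite /has_local_dim dlim_cvg.
  have E r : 0 < r -> (lne (nu_theta (ball a r)) * ((ln r)^-1)%:E)%E =
      (hmu p q nu (q%:R - a / kap R p q) r / - ln r)%:E.
    move=> r0; rewrite ballE lne_EFin /hmu ?invrN ?mulrNN //.
    by rewrite (mu_gt0 q_gt0 nuE) // divr_gt0.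
  by split; apply: dlim_ext; exists 1 => // r /andP[r0 _]; rewrite E.
have xinv (x : R) : q%:R - kap R p q * (q%:R - x) / kap R p q = x.
  by rewrite mulrAC divff // mul1r subKr.
have F1E al : b_min <= al <= b_max -> F1 al = (spectrum p q al)%:E.
  move=> hal; apply: dim_spectrum => //.
    move=> x Xx; have [xN _] := Xx.
    split; first by apply/DP; rewrite xinv.
    by rewrite sliceE xinv; exact: (Xlow_box p_gt0 q_gt0 Dg).
  by move=> a [/DP aN]; rewrite sliceE; exact: (box_Xup p_gt0 q_gt0 Dg).
(* Since [3 ^ n] times the mass is the multiplicity, local dimension [be] means growth of exponent
   [s - be] in base 2, as box dimension [s - be] does; the second spectrum is the reflection of the
   first. *)
have sl2 be : (s - be) * ln 2 = ln 3 - be * ln 2.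
  by rewrite mulrBl /s /gasket_dim divfK // gt_eqF.
have F2E be : s - b_max <= be <= s - b_min -> F2 be = (spectrum p q (s - be))%:E.
  move=> hbe; apply: dim_spectrum => //.
  - exact: subC.
  - rewrite sl2 => x Xx; have [xN _] := Xx.
    split; first by apply/DP; rewrite xinv.
    by apply/localE; rewrite xinv //; exact: (Xlow_mu p_gt0 q_gt0 nuE).
  - by move=> a [/DP aN /(localE _ _ aN)]; rewrite sl2; exact: (mu_Xup p_gt0 q_gt0 nuE).
have flip be : s - b_max <= be <= s - b_min -> b_min <= s - be <= b_max.
  exact: subC.
have E1 t x : - t * x + pressure p q t / ln 2 = - x * t + pressure p q t / ln 2.
  by rewrite !mulNr mulrC.
have E2 t x : t * x + (pressure p q t / ln 2 - s * t) = - (s - x) * t + pressure p q t / ln 2.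
  by ring.
have ge1 x t : b_min <= x <= b_max -> 0 <= - t * x + pressure p q t / ln 2.
  by rewrite E1; exact: spectrum_ge0.
have le1 x : b_min <= x <= b_max -> (fine \o F1) x <= 1.
  by move=> h; rewrite /= F1E //; exact: spectrum_le1.
have f1 x : b_min <= x <= b_max ->
    (fine \o F1) x = inf (range (fun t => - t * x + pressure p q t / ln 2)).
  by move=> /F1E /= ->; congr inf; apply: eq_imagel => t _; rewrite E1.
have ge2 x t : s - b_max <= x <= s - b_min -> 0 <= t * x + (pressure p q t / ln 2 - s * t).
  by move=> /flip; rewrite E2; exact: spectrum_ge0.
have le2 x : s - b_max <= x <= s - b_min -> (fine \o F2) x <= 1.
  by move=> h; rewrite /= F2E //; apply: spectrum_le1 => //; exact: flip.
have f2 x : s - b_max <= x <= s - b_min ->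
    (fine \o F2) x = inf (range (fun t => t * x + (pressure p q t / ln 2 - s * t))).
  by move=> /F2E /= ->; congr inf; apply: eq_imagel => t _; rewrite E2.
split.
- by move=> al hal; rewrite F1E // spectrumE.
- by move=> be hbe; rewrite F2E // spectrumE // flip.
- by split; [exact: (env_concave ge1 f1)|exact: (env_continuous ge1 le1 f1)].
- by split; [exact: (env_concave ge2 f2)|exact: (env_continuous ge2 le2 f2)].
Qed.
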